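(* For every $n\in\{2,3,\ldots\}$, $$\mathbb J_{n,1}(-1/2)=2^{1-n}\,n\binom{n-1}{\frac12(n-1)}^{n-1}\binom{(n-1)^2}{\frac12(n-1)^2}^{-1}=\frac{n(n-1)^2}{2^n\pi^{(n-2)/2}}\left(\frac{\Gamma(\frac n2)}{\Gamma(\frac{n+1}2)}\right)^{n-1}\frac{\Gamma(\frac{(n-1)^2}2)}{\Gamma(\frac{(n-1)^2+1}2)}.$$
   Context: For $n\ge2$ let $X_1,\ldots,X_n$ be i.i.d. random points in $\mathbb R^{n-1}$ with density proportional to $(1-\|x\|^2)^{-1/2}\mathbf 1_{\{\|x\|<1\}}$. $\mathbb J_{n,1}(-1/2)$ is the expected sum of the internal solid angles at the $n$ vertices of the simplex $[X_1,\ldots,X_n]$ (convex hull). Angles are normalized so that the full-space angle is $1$: the internal angle of a full-dimensional polytope $P\subset\mathbb R^{n-1}$ at a vertex $v$ is $\mathbb P[U\in T]$, where $U$ is uniform on the unit sphere of $\mathbb R^{n-1}$ and $T=\{y\in\mathbb R^{n-1}:\exists\varepsilon>0,\ v+\varepsilon y\in P\}$ is the tangent cone. Binomial coefficients with non-integer entries are $\binom{z}{z/2}=\Gamma(z+1)/\Gamma(\frac z2+1)^2$. *)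

(* Defs.v *)
From HB Require Import structures.
From mathcomp Require Import all_boot all_order all_algebra.
From mathcomp Require Import all_classical all_reals all_analysis.
From mathcomp Require Import measurable_realfun lra.

Set Implicit Arguments.
Unset Strict Implicit.
Unset Printing Implicit Defensive.

Import Order.TTheory GRing.Theory Num.Theory.
Import numFieldNormedType.Exports.

Local Open Scope classical_set_scope.
Local Open Scope ring_scope.

Definition rV_display : measure_display.
Proof. exact: default_measure_display. Qed.

(* The product sigma-algebra on R^n, generated by the coordinates; it is the
   Borel sigma-algebra. *)
Section measurable_rV.
Context {R : realType}.
Variable n : nat.

Definition rV_coord (i : 'I_n) (v : 'rV[R]_n) : R := v ord0 i.

Let rV_set0 : g_sigma_preimage rV_coord set0.
Proof. exact: sigma_algebra0. Qed.

Let rV_setC A : g_sigma_preimage rV_coord A -> g_sigma_preimage rV_coord (~` A).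
Proof. exact: sigma_algebraC. Qed.

Let rV_bigcup (F : _^nat) : (forall i, g_sigma_preimage rV_coord (F i)) ->
  g_sigma_preimage rV_coord (\bigcup_i (F i)).
Proof. exact: sigma_algebra_bigcup. Qed.

HB.instance Definition _ := @isMeasurable.Build rV_display 'rV[R]_n
  (g_sigma_preimage rV_coord) rV_set0 rV_setC rV_bigcup.

End measurable_rV.

Lemma measurable_rV_coord (R : realType) n (i : 'I_n) :
  measurable_fun [set: 'rV[R]_n] (fun v => v ord0 i : R).
Proof.
move=> _ Y mY; rewrite setTI; apply: sub_sigma_algebra => /=.
rewrite -bigcup_seq/=; exists i => /=; first by rewrite mem_index_enum.
by exists Y => //; rewrite setTI.
Qed.

Lemma measurable_rV_box (R : realType) n (A : 'I_n -> set (measurableTypeR R)) :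
  (forall i, measurable (A i)) ->
  measurable [set v : 'rV[R]_n | forall i, A i (v ord0 i)].
Proof.
move=> mA.
rewrite [X in measurable X](_ : _ = \bigcap_(i in [set: 'I_n])
    (setT `&` (fun v : 'rV[R]_n => v ord0 i : R) @^-1` A i)).
  apply: fin_bigcap_measurable => // i _.
  exact: (@measurable_rV_coord R n i measurableT _ (mA i)).
by apply/seteqP; split => v /= h i; have := h i; rewrite setTI//=; apply.
Qed.

Lemma measurable_fun_rVP d (T : measurableType d) (R : realType) n
    (f : T -> 'rV[R]_n) :
  measurable_fun [set: T] f <->
  forall i, measurable_fun [set: T] (fun x => f x ord0 i : R).
Proof.
split=> [mf i|mf].
  exact: measurableT_comp (@measurable_rV_coord R n i) mf.
have H : g_sigma_preimage (fun i => @rV_coord R n i \o f) `<=` measurable.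
  apply: smallest_sub; first exact: sigma_algebra_measurable.
  case: n => [|n] in f mf *; first by rewrite big_ord0.
  rewrite -bigcup_mkord_ord; apply: bigcup_sub => i Ii.
  by move=> A [B mB <-]; exact: mf.
move=> _ A mA; apply: H; rewrite g_sigma_preimage_comp.
by exists A => //; rewrite setTI.
Qed.

Section lebesgue_rV.
Context {R : realType}.

Definition rV_cons n (p : measurableTypeR R * 'rV[R]_n) : 'rV[R]_n.+1 :=
  row_mx (\row_(_ < 1) p.1) p.2.

Definition rV_uncons n (v : 'rV[R]_n.+1) : measurableTypeR R * 'rV[R]_n :=
  (v ord0 ord0, \row_i v ord0 (lift ord0 i)).

Lemma rV_cons0 n p : @rV_cons n p ord0 ord0 = p.1.
Proof.
have -> : (ord0 : 'I_n.+1) = lshift n (ord0 : 'I_1) by exact/val_inj.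
by rewrite (row_mxEl (\row_(_ < 1) p.1) p.2) mxE.
Qed.

Lemma rV_cons_lift n p i : @rV_cons n p ord0 (lift ord0 i) = p.2 ord0 i.
Proof.
have -> : lift ord0 i = rshift 1 i by exact/val_inj.
by rewrite (row_mxEr (\row_(_ < 1) p.1) p.2).
Qed.

Lemma rV_consK n : cancel (@rV_cons n) (@rV_uncons n).
Proof.
move=> p; rewrite /rV_uncons rV_cons0; case: p => x v /=; congr (_, _).
by apply/rowP => i; rewrite mxE rV_cons_lift.
Qed.

Lemma measurable_rV_cons n : measurable_fun setT (@rV_cons n).
Proof.
apply/measurable_fun_rVP => i; case: (unliftP ord0 i) => [j|] ->.
  under eq_fun do rewrite rV_cons_lift.
  exact: measurableT_comp (@measurable_rV_coord R n j) measurable_snd.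
under eq_fun do rewrite rV_cons0.
exact: measurable_fst.
Qed.

Lemma measurable_rV_uncons n : measurable_fun setT (@rV_uncons n).
Proof.
apply/measurable_fun_pairP; split.
  exact: (@measurable_rV_coord R n.+1 ord0).
apply/measurable_fun_rVP => i /=.
under eq_fun do rewrite mxE.
exact: measurable_rV_coord.
Qed.

Section step.
Variables (n : nat) (m : {sigma_finite_measure set 'rV[R]_n -> \bar R}).

Definition lebesgue_rV_step : set 'rV[R]_n.+1 -> \bar R :=
  pushforward (@lebesgue_measure R \x m)%E (@rV_cons n).

Let step0 : lebesgue_rV_step set0 = 0%E.
Proof. by rewrite /lebesgue_rV_step /pushforward preimage_set0 measure0. Qed.

Let step_ge0 A : (0 <= lebesgue_rV_step A)%E.
Proof. by apply: measure_ge0; exact: measurable_rV_cons. Qed.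

Let step_sigma_additive : semi_sigma_additive lebesgue_rV_step.
Proof.
apply: measure_semi_sigma_additive; exact: measurable_rV_cons.
Qed.

HB.instance Definition _ := isMeasure.Build _ _ _
  lebesgue_rV_step step0 step_ge0 step_sigma_additive.

Let step_sigma_finite : sigma_finite setT lebesgue_rV_step.
Proof.
have /sigma_finiteP[F [TF ndF Foo]] := sigma_finiteT (@lebesgue_measure R).
have /sigma_finiteP[G [TG ndG Goo]] := sigma_finiteT m.
exists (fun k => @rV_uncons n @^-1` (F k `*` G k)).
  apply/esym; rewrite -subTset => v _.
  have [i _ Fi] : (\bigcup_i F i) (v ord0 ord0) by rewrite -TF.
  have [j _ Gj] : (\bigcup_j G j) (@rV_uncons n v).2 by rewrite -TG.
  exists (maxn i j) => //; split => /=.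
    by move: Fi; exact/subsetPset/ndF/leq_maxl.
  by move: Gj; exact/subsetPset/ndG/leq_maxr.
move=> k; have [mF Fk] := Foo k; have [mG Gk] := Goo k; split.
  rewrite -[X in measurable X]setTI; apply: measurable_rV_uncons => //.
  exact: measurableX.
rewrite /lebesgue_rV_step /pushforward -comp_preimage.
rewrite (_ : _ \o _ = id) ?preimage_id; last first.
  by rewrite funeqE => p; exact: rV_consK.
by rewrite product_measure1E// lte_mul_pinfty// ge0_fin_numE.
Qed.

HB.instance Definition _ :=
  Measure_isSigmaFinite.Build _ _ _ lebesgue_rV_step step_sigma_finite.
End step.

(* Lebesgue measure on R^n: iterated product of n copies of the Lebesgue
   measure on R. *)
Fixpoint lebesgue_rV n : {sigma_finite_measure set 'rV[R]_n -> \bar R} :=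
  if n is n'.+1 then lebesgue_rV_step (lebesgue_rV n')
  else \d_(0 : 'rV[R]_0).


Lemma lebesgue_rV_box n (A : 'I_n -> set (measurableTypeR R)) :
  (forall i, measurable (A i)) ->
  lebesgue_rV n [set v | forall i, A i (v ord0 i)] =
  (\prod_(i < n) lebesgue_measure (A i))%E.
Proof.
elim: n A => [|n IH] A mA.
  by rewrite big_ord0 /= diracE mem_set// => -[].
rewrite big_ord_recl -IH//.
have mB := measurable_rV_box (fun i => mA (lift ord0 i)).
rewrite -(product_measure1E (@lebesgue_measure R) (lebesgue_rV n) (mA ord0) mB).
rewrite [LHS]/= /lebesgue_rV_step /pushforward.
congr (product_measure1 _ _ _); apply/seteqP; split => -[x v] /=.
  move=> h; split; first by have := h ord0; rewrite rV_cons0.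
  by move=> i; have := h (lift ord0 i); rewrite rV_cons_lift.
move=> [Ax Av] i; case: (unliftP ord0 i) => [j|] ->.
  by rewrite rV_cons_lift.
by rewrite rV_cons0.
Qed.

End lebesgue_rV.

Section sphere.
Context {R : realType}.

(* The Euclidean norm; the library norm `|v| on 'rV[R]_n is the sup norm. *)
Definition enorm n (v : 'rV[R]_n) : R := Num.sqrt (\sum_(i < n) v ord0 i ^+ 2).

Definition unit_ball n : set 'rV[R]_n := [set v | enorm v < 1].
Arguments unit_ball n _ : clear implicits.

Definition unit_sphere n : set 'rV[R]_n := [set v | enorm v = 1].
Arguments unit_sphere n _ : clear implicits.

Definition radial_proj n (v : 'rV[R]_n) : 'rV[R]_n := (enorm v)^-1 *: v.

(* The uniform distribution on the unit sphere of R^n, i.e., the normalized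
   surface measure: the measure of A is the fraction of the volume of the unit
   ball lying over A, that is on the rays through A. *)
Definition uniform_sphere n (A : set 'rV[R]_n) : \bar R :=
  ((fine (lebesgue_rV n (unit_ball n)))^-1%:E *
   lebesgue_rV n (unit_ball n `&` @radial_proj n @^-1` A))%E.

Lemma measurable_enorm n : measurable_fun setT (@enorm n : _ -> R).
Proof.
apply: (measurableT_comp (f := @Num.sqrt R)).
  by apply: continuous_measurable_fun; exact: sqrt_continuous.
apply: measurable_sum => i; apply: measurable_funX.
exact: measurable_rV_coord.
Qed.

Lemma measurable_unit_ball n : measurable (unit_ball n).
Proof.
have -> : unit_ball n = setT `&` @enorm n @^-1` `]-oo, 1[%classic.
  by apply/seteqP; split => v; rewrite setTI /unit_ball /= in_itv/=.
exact: measurable_enorm.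
Qed.

Lemma measurable_radial_proj n : measurable_fun setT (@radial_proj n).
Proof.
apply/measurable_fun_rVP => i.
rewrite [X in measurable_fun _ X](_ : _ =
    (fun v => enorm v `^ (-1) * v ord0 i)); last first.
  by apply/funext => v; rewrite mxE powR_inv1// sqrtr_ge0.
apply: measurable_funM; last exact: measurable_rV_coord.
exact: (measurableT_comp (measurable_powR _) (@measurable_enorm n)).
Qed.

Lemma unit_ball_gt0 n : (0 < lebesgue_rV n (unit_ball n))%E.
Proof.
pose e : R := n.+1%:R^-1.
have e0 : 0 < e by rewrite invr_gt0.
have eK : n.+1%:R * e = 1 by rewrite mulfV.
have e1 : e <= 1 by rewrite invf_le1 // ler1n.
pose C : set (measurableTypeR R) := `](- e), e[%classic.
have mC : measurable C by exact: measurable_itv.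
apply: (@lt_le_trans _ _ (lebesgue_rV n [set v | forall i, C (v ord0 i)])).
  rewrite (lebesgue_rV_box (fun _ : 'I_n => mC)).
  apply: (big_ind (fun x => 0 < x)%E) => //.
    by move=> x y; exact: mule_gt0.
  move=> i _; rewrite /C lebesgue_measure_itv/= lte_fin -EFinD.
  have -> : - e < e by lra.
  by rewrite lte_fin; lra.
apply: le_measure; rewrite ?inE.
- exact: (measurable_rV_box (fun=> mC)).
- exact: measurable_unit_ball.
- move=> v /= h; rewrite /unit_ball /enorm /= -[ltRHS]sqrtr1 ltr_sqrt//.
  apply: (@le_lt_trans _ _ (\sum_(i < n) e)).
    apply: ler_sum => i _; have := h i; rewrite /C /= in_itv/= => /andP[a b].
    by nra.
  rewrite sumr_const card_ord -mulr_natl.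
  by move: eK; rewrite -addn1 natrD; lra.
Qed.

Lemma unit_ball_lty n : (lebesgue_rV n (unit_ball n) < +oo)%E.
Proof.
pose C : set (measurableTypeR R) := `](- 1), 1[%classic.
have mC : measurable C by exact: measurable_itv.
apply: (@le_lt_trans _ _ (lebesgue_rV n [set v | forall i, C (v ord0 i)])).
  apply: le_measure; rewrite ?inE.
  - exact: measurable_unit_ball.
  - exact: (measurable_rV_box (fun=> mC)).
  - move=> v; rewrite /unit_ball /enorm /= -[ltRHS]sqrtr1 ltr_sqrt// => h i.
    have : v ord0 i ^+ 2 < 1.
      apply: le_lt_trans h; rewrite (bigD1 i)//= lerDl.
      by apply: sumr_ge0 => j _; exact: sqr_ge0.
    by rewrite /C /= in_itv/= => hi; apply/andP; split; nra.
rewrite (lebesgue_rV_box (fun _ : 'I_n => mC)).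
suff : (\prod_(i < n) lebesgue_measure C \is a fin_num)%E.
  by rewrite fin_numElt => /andP[].
apply: (big_ind (fun x => x \is a fin_num)) => // [x y|i _].
  exact: fin_numM.
by rewrite /C lebesgue_measure_itv/= lte_fin -EFinD; case: ifP.
Qed.

Let volE n : lebesgue_rV n (unit_ball n) =
  (fine (lebesgue_rV n (unit_ball n)))%:E.
Proof. by rewrite fineK// gt0_fin_numE ?unit_ball_gt0// unit_ball_lty. Qed.

Let vol_gt0 n : 0 < fine (lebesgue_rV n (unit_ball n)).
Proof. by apply: fine_gt0; rewrite unit_ball_gt0 unit_ball_lty. Qed.

Section uniform_sphere_probability.
Variable n : nat.

Let mproj (A : set 'rV[R]_n) : measurable A ->
  measurable (unit_ball n `&` @radial_proj n @^-1` A).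
Proof.
move=> mA; apply: measurableI; first exact: measurable_unit_ball.
by rewrite -[X in measurable X]setTI; exact: measurable_radial_proj.
Qed.

Let uniform_sphere0 : @uniform_sphere n set0 = 0%E.
Proof. by rewrite /uniform_sphere preimage_set0 setI0 measure0 mule0. Qed.

Let uniform_sphere_ge0 A : (0 <= @uniform_sphere n A)%E.
Proof. by rewrite mule_ge0// lee_fin invr_ge0 ltW. Qed.

Let uniform_sphere_sigma_additive : semi_sigma_additive (@uniform_sphere n).
Proof.
move=> F mF tF mUF; rewrite /uniform_sphere preimage_bigcup setI_bigcupr.
under eq_fun do rewrite -ge0_sume_distrr//.
apply: cvgeZl => //; apply: measure_semi_sigma_additive.
- by move=> i; exact: mproj.
- apply/trivIsetP => /= i j _ _ ij; rewrite setIACA -preimage_setI.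
  by move/trivIsetP : tF => /(_ _ _ _ _ ij) ->//; rewrite preimage_set0 setI0.
- by rewrite -setI_bigcupr -preimage_bigcup; exact: mproj.
Qed.

HB.instance Definition _ := isMeasure.Build _ _ _ (@uniform_sphere n)
  uniform_sphere0 uniform_sphere_ge0 uniform_sphere_sigma_additive.

Let uniform_sphere_setT : @uniform_sphere n setT = 1%E.
Proof.
rewrite /uniform_sphere preimage_setT setIT [in X in (_ * X)%E]volE.
by rewrite -EFinM mulVf// gt_eqF.
Qed.

HB.instance Definition _ :=
  Measure_isProbability.Build _ _ _ (@uniform_sphere n) uniform_sphere_setT.

End uniform_sphere_probability.

Lemma enormZ n (a : R) (v : 'rV[R]_n) : enorm (a *: v) = `|a| * enorm v.
Proof.
rewrite /enorm; under eq_bigr do rewrite mxE exprMn.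
by rewrite -mulr_sumr sqrtrM ?sqr_ge0// sqrtr_sqr.
Qed.

Lemma enorm_eq0 n (v : 'rV[R]_n) : (enorm v == 0) = (v == 0).
Proof.
apply/idP/eqP => [|->]; last first.
  by rewrite /enorm big1 ?sqrtr0// => i _; rewrite mxE expr0n.
have s0 : 0 <= \sum_(i < n) v ord0 i ^+ 2.
  by apply: sumr_ge0 => i _; exact: sqr_ge0.
rewrite sqrtr_eq0 => sv; apply/rowP => i; rewrite mxE; apply/eqP.
rewrite -sqrf_eq0 eq_le sqr_ge0 andbT; apply: le_trans sv.
by rewrite (bigD1 i)//= lerDl sumr_ge0// => j _; exact: sqr_ge0.
Qed.

Lemma uniform_sphere_supported n :
  (0 < n)%N -> uniform_sphere (unit_sphere n) = 1%E.
Proof.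
case: n => // n _; rewrite /uniform_sphere.
have e0 : enorm (0 : 'rV[R]_n.+1) = 0 by apply/eqP; rewrite enorm_eq0.
have -> : unit_ball n.+1 `&` @radial_proj n.+1 @^-1` unit_sphere n.+1 =
    unit_ball n.+1 `\` [set 0].
  apply/seteqP; split => v [vB] /=.
    move=> vS; split=> // v0; move: vS; rewrite /unit_sphere /radial_proj /= v0.
    by rewrite scaler0 e0 => /eqP; rewrite eq_sym oner_eq0.
  move=> /eqP; rewrite -enorm_eq0 => v0; split=> //.
  rewrite /unit_sphere /radial_proj /= enormZ normfV ger0_norm ?sqrtr_ge0//.
  by rewrite mulVf.
pose Z : set 'rV[R]_n.+1 := [set 0].
have eq0 : Z = [set v | forall i, [set (0 : R)] (v ord0 i)].
  by rewrite /Z; apply/seteqP; split => v /= => [->|v0]; [|apply/rowP]=> i; rewrite mxE.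
have mR0 (i : 'I_n.+1) : measurable [set 0 : measurableTypeR R].
  exact: measurable_set1.
have m0 : measurable Z.
  by rewrite eq0; exact: measurable_rV_box mR0.
have l0 : lebesgue_rV n.+1 Z = 0%E.
  by rewrite eq0 (lebesgue_rV_box mR0) big_ord_recl lebesgue_measure_set1 mul0e.
rewrite -/Z measureD ?unit_ball_lty//; last exact: measurable_unit_ball.
rewrite (_ : unit_ball n.+1 `&` Z = Z); last first.
  by apply/setIidPr => v ->; rewrite /unit_ball /= e0.
rewrite [X in (_ - X)%E](_ : _ = 0%E) ?sube0; last exact: l0.
rewrite [X in (_ * X)%E](volE n.+1 :> _ = _).
by rewrite -EFinM mulVf// gt_eqF.
Qed.

End sphere.
Arguments unit_ball {R} n _.
Arguments unit_sphere {R} n _.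

Section angles.
Context {R : realType} {n : nat}.
Implicit Types (K : set 'rV[R]_n) (v : 'rV[R]_n).

Definition conv_hull K : set 'rV[R]_n := smallest (@convex_set R 'rV[R]_n) K.

Definition tangent_cone K v : set 'rV[R]_n :=
  [set y | exists2 e : R, 0 < e & K (v + e *: y)].

Definition internal_angle K v : R := fine (uniform_sphere (tangent_cone K v)).

(* When the points x i are affinely independent, they are exactly the vertices
   of their convex hull. *)
Definition vertex_angle_sum (k : nat) (x : 'I_k -> 'rV[R]_n) : R :=
  \sum_(i < k) internal_angle (conv_hull (range x)) (x i).

End angles.

Section random_points.
Context d (Omega : measurableType d) (R : realType) (P : probability Omega R).

Definition mutually_independent d' (T : measurableType d') (I : finType)
    (X : I -> {RV P >-> T}) : Prop :=
  forall (J : {set I}) (B : I -> set T), (forall i, measurable (B i)) ->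
    P (\bigcap_(i in [set` J]) X i @^-1` B i) =
    (\prod_(i in J) P (X i @^-1` B i))%E.

(* The law of X has density c * f for some constant c; since it has mass 1,
   c is the normalizing constant of f, and in particular depends on f only. *)
Definition has_density_proportional_to n (X : {RV P >-> 'rV[R]_n})
    (f : 'rV[R]_n -> R) : Prop :=
  exists c : R, forall B : set 'rV[R]_n, measurable B ->
    distribution P X B = (\int[lebesgue_rV n]_(x in B) (c * f x)%:E)%E.

End random_points.

Definition beta_weight (R : realType) (b : R) n (x : 'rV[R]_n) : R :=
  (1 - enorm x ^+ 2) `^ b * \1_(unit_ball n) x.

(* Euler's integral, meaningful for z > 0. *)
Definition Gamma (R : realType) (z : R) : R :=
  \int[lebesgue_measure]_(t in `]0, +oo[) (t `^ (z - 1) * expR (- t)).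

(* The binomial coefficient "z choose z/2" for real z. *)
Definition binom_half (R : realType) (z : R) : R :=
  Gamma (z + 1) / Gamma (z / 2 + 1) ^+ 2.

(* Main.v *)
(* Put D = n - 2, so that the simplex lives in R^(D+1), and let kappa_k be the
   volume of the unit ball of R^k.  By exchangeability the expectation is n times
   the expected angle at X_1.  Pairing the direction v with -v, this angle is half
   the probability that the line through X_1 in a random direction meets the
   tangent cone at X_1, i.e. that the projection of X_1 along v lies in the simplex
   spanned by the projections of the other points.  For beta = -1/2 the projected
   points are uniform in the unit ball of R^D, whatever v is, so we are left with
   Sylvester's problem: the expected volume of the simplex spanned by D+1 uniform
   points of the ball, divided by kappa_D.

   Kingman's evaluation of that volume: lift the D+1 points z_i to points (z_i, t_i)
   of the ball of R^(D+1).  The lifted points lie on the graph of a unique affine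
   function z |-> a.z + b, and the Jacobian of (t_i) in terms of (a, b) is
   |det (z_i - z_0)|, which is the volume to be averaged.  The section of the ball
   by the graph is an ellipsoid, and mapping it onto a ball reproduces the same
   integral over (z_i) with an explicit factor depending on (a, b); hence
   kappa_(D+1)^(D+1) is the wanted integral times an explicit constant.

   Finally the layer cake formula gives Gamma(k/2 + 1) = pi^(k/2) / kappa_k, and the
   duplication formula turns the constants into central binomial coefficients. *)

(* Three obstacles shape the development. The angle formula, the projection argument and the
   Jacobian all require affinely independent points, so every comparison is made off the zero set of
   an edge determinant. That set is null because moving the i-th point along the i-th axis by [s]
   adds [s] to the diagonal, and a characteristic polynomial has finitely many roots. Cones and
   simplices are tested by polynomial inequalities in the adjugate, which makes them jointly
   measurable without inverting a matrix; [vertex_angle_sum] itself is compared with a measurable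
   version through the definition of the integral as a supremum. Integrals live in the extended
   reals. Kingman's identity makes its own integral finite, since its left side is; the constant of
   the projected density comes from total mass 1, not from evaluating a beta integral. All constants
   are finally expressed by [slice_int] k = kappa_(k+1) / kappa_k, of which only the indices D and D
   (D + 2) = (n - 1)^2 - 1 survive. *)
Require Import Defs.
From HB Require Import structures.
From mathcomp Require Import all_boot all_order all_algebra.
From mathcomp Require Import all_classical all_reals all_analysis.
From mathcomp Require Import perm measurable_realfun ring lra zify.

Set Implicit Arguments.
Unset Strict Implicit.
Unset Printing Implicit Defensive.

Import Order.TTheory GRing.Theory Num.Theory.
Import numFieldNormedType.Exports.

Local Open Scope classical_set_scope.
Local Open Scope ring_scope.

(** * Lebesgue measure under affine and linear maps *)

Section lebesgue_affine.
Context {R : realType}.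
Local Notation mu := (@lebesgue_measure R).

Lemma measurable_affine (c a : R) :
  measurable_fun setT (fun x : measurableTypeR R => c * x + a : measurableTypeR R).
Proof.
by apply: measurable_funD => //; exact: measurable_funM.
Qed.

(** By uniqueness: the pushforward rescaled by |c| is a measure with the right mass on the intervals
    ]p, q]. *)
Lemma lebesgue_measure_affine (c a : R) (A : set (measurableTypeR R)) :
    c != 0 -> measurable A ->
  (`|c|%:E * mu ((fun x => (c * x + a)%R : measurableTypeR R) @^-1` A))%E = mu A.
Proof.
move=> c0 mA.
have mphi := measurable_affine c a.
have nc0 : 0 <= `|c| by [].
pose phi (x : measurableTypeR R) : measurableTypeR R := c * x + a.
pose m0 : {measure set (measurableTypeR R) -> \bar R} :=
  mscale (NngNum nc0) (pushforward mu phi).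
pose m := m0 mphi.
suff : mu A = m A by move=> ->.
apply: lebesgue_measure_unique => //= _ [[p q]] _ <- /=.
rewrite /m /mscale /= /pushforward /=.
have [c_gt0|c_le0] := ltP 0 c.
  rewrite (_ : _ @^-1` _ = `](p - a) / c, (q - a) / c]%classic); last first.
    by apply/seteqP; split => x /=;
      rewrite !in_itv/= ltr_pdivrMr// ler_pdivlMr// ltrBlDr lerBrDr (mulrC x).
  rewrite !lebesgue_measure_itv/= !lte_fin ltr_pM2r ?invr_gt0// ltrD2r.
  case: ifPn => pq; last by rewrite mule0.
  by rewrite -!EFinD -EFinM gtr0_norm//; congr EFin; field.
have c_lt0 : c < 0 by rewrite lt_neqAle c0.
(* A decreasing affine map exchanges the closed end and the open end; the length is not affected. *)
rewrite (_ : _ @^-1` _ = `[(q - a) / c, (p - a) / c[%classic); last first.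
  by apply/seteqP; split => x /=;
    rewrite !in_itv/= ltr_ndivlMr// ler_ndivrMr// ltrBlDr lerBrDr (mulrC x) andbC.
rewrite !lebesgue_measure_itv/= !lte_fin ltr_nM2r ?invr_lt0// ltrD2r.
case: ifPn => pq; last by rewrite mule0.
by rewrite -!EFinD -EFinM ltr0_norm//; congr EFin; field.
Qed.

Lemma integral_lebesgue_affine (c a : R) (f : measurableTypeR R -> \bar R) :
    c != 0 -> measurable_fun setT f -> (forall x, 0 <= f x)%E ->
  (`|c|%:E * \int[mu]_x f (c * x + a)%R = \int[mu]_x f x)%E.
Proof.
move=> c0 mf f0.
have mphi := measurable_affine c a.
have nc0 : 0 <= `|c| by [].
pose phi (x : measurableTypeR R) : measurableTypeR R := c * x + a.
pose m0 : {measure set (measurableTypeR R) -> \bar R} :=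
  mscale (NngNum nc0) (pushforward mu phi).
pose m := m0 mphi.
rewrite [RHS](_ : _ = \int[m]_x f x)%E; last first.
  apply: eq_measure_integral => A mA _.
  exact: (esym (lebesgue_measure_affine a c0 mA)).
rewrite ge0_integral_mscale//= ge0_integral_pushforward//.
Qed.

End lebesgue_affine.

Section lebesgue_rV_fubini.
Context {R : realType}.
Local Notation mu := (@lebesgue_measure R).

Lemma integral_lebesgue_rVS n (f : 'rV[R]_n.+1 -> \bar R) :
    measurable_fun setT f -> (forall v, 0 <= f v)%E ->
  (\int[lebesgue_rV n.+1]_v f v =
   \int[mu]_x \int[lebesgue_rV n]_v f (rV_cons (x, v)))%E.
Proof.
move=> mf f0.
rewrite (_ : lebesgue_rV n.+1 = lebesgue_rV_step (lebesgue_rV n) :> (set _ -> _))//.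
rewrite (ge0_integral_pushforward (@measurable_rV_cons R n))//.
rewrite preimage_setT fubini_tonelli1//; last by move=> p; exact: f0.
by apply: measurableT_comp => //; exact: measurable_rV_cons.
Qed.

Lemma integral_lebesgue_rVS_swap n (f : 'rV[R]_n.+1 -> \bar R) :
    measurable_fun setT f -> (forall v, 0 <= f v)%E ->
  (\int[lebesgue_rV n.+1]_v f v =
   \int[lebesgue_rV n]_v \int[mu]_x f (rV_cons (x, v)))%E.
Proof.
move=> mf f0; rewrite integral_lebesgue_rVS//.
rewrite (fubini_tonelli (fun p : measurableTypeR R * 'rV[R]_n => f (rV_cons p)))//.
by apply: measurableT_comp => //; exact: measurable_rV_cons.
Qed.

End lebesgue_rV_fubini.

Lemma ge0_integralZT d (T : measurableType d) (R : realType)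
    (m : {measure set T -> \bar R}) (k : R) (f : T -> \bar R) :
    0 <= k -> measurable_fun setT f -> (forall x, 0 <= f x)%E ->
  (\int[m]_x (k%:E * f x) = k%:E * \int[m]_x f x)%E.
Proof. by move=> k0 mf f0; rewrite ge0_integralZl. Qed.

(** * Entrywise measurability of matrix operations *)

Section measurable_matrix.
Context d {T : measurableType d} {R : realType}.

(** The sigma-algebra above is one on row vectors; for general matrices measurability is stated
    entry by entry, which suits determinants and adjugates. *)
Definition measurable_mx m n (f : T -> 'M[R]_(m, n)) :=
  forall i j, measurable_fun setT (fun x => f x i j).

Lemma measurable_mxP n (f : T -> 'rV[R]_n) :
  measurable_mx f <-> measurable_fun setT f.
Proof.
split=> [mf|/measurable_fun_rVP mf i j]; last by rewrite ord1; exact: mf.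
by apply/measurable_fun_rVP => i; exact: mf.
Qed.

Lemma measurable_mulmx m n p (f : T -> 'M[R]_(m, n)) (g : T -> 'M[R]_(n, p)) :
  measurable_mx f -> measurable_mx g -> measurable_mx (fun x => f x *m g x).
Proof.
move=> mf mg i j; under eq_fun do rewrite mxE.
by apply: measurable_sum => k; exact: measurable_funM.
Qed.

Lemma measurable_det n (f : T -> 'M[R]_n) :
  measurable_mx f -> measurable_fun setT (fun x => \det (f x)).
Proof.
move=> mf; rewrite /determinant; apply: measurable_sum => s.
by apply: measurable_funM => //; apply: measurable_prod => i _; exact: mf.
Qed.

Lemma measurable_adj n (f : T -> 'M[R]_n) :
  measurable_mx f -> measurable_mx (fun x => \adj (f x)).
Proof.
move=> mf i j; under eq_fun do rewrite mxE /cofactor.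
apply: measurable_funM => //; apply: measurable_det => k l.
by under eq_fun do rewrite !mxE; exact: mf.
Qed.

Lemma measurable_addmx m n (f g : T -> 'M[R]_(m, n)) :
  measurable_mx f -> measurable_mx g -> measurable_mx (fun x => f x + g x).
Proof.
by move=> mf mg i j; under eq_fun do rewrite mxE; exact: measurable_funD.
Qed.

Lemma measurable_scalemx m n (k : T -> R) (f : T -> 'M[R]_(m, n)) :
  measurable_fun setT k -> measurable_mx f -> measurable_mx (fun x => k x *: f x).
Proof.
by move=> mk mf i j; under eq_fun do rewrite mxE; exact: measurable_funM.
Qed.

Lemma measurable_cstmx m n (A : 'M[R]_(m, n)) : measurable_mx (fun=> A).
Proof. by move=> i j. Qed.

End measurable_matrix.

(** * Translations and linear changes of variables in R^n *)

Section lebesgue_rV_linear.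
Context {R : realType}.
Local Notation mu := (@lebesgue_measure R).

Lemma rV_consE n (x : R) (v : 'rV[R]_n) :
  rV_cons (x, v) = row_mx x%:M v :> 'rV_(1 + n).
Proof.
rewrite /rV_cons /=; congr row_mx; apply/rowP => i.
by rewrite !ord1 !mxE eqxx mulr1n.
Qed.

Lemma rV_cons_mul_block n (x : R) (v : 'rV[R]_n) (a : R) b c S :
  rV_cons (x, v) *m (block_mx a%:M b c S : 'M[R]_(1 + n)) =
  rV_cons (x * a + (v *m c) 0 0, x *: b + v *m S).
Proof.
rewrite !rV_consE.
refine (etrans (mul_row_block (x%:M : 'M[R]_1) v a%:M b c S) _).
rewrite -scalar_mxM mul_scalar_mx raddfD /=.
by congr (row_mx (_ + _) _); rewrite [LHS]mx11_scalar.
Qed.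

Lemma measurable_fun_addr n (a : 'rV[R]_n) :
  measurable_fun setT (fun v : 'rV[R]_n => v + a).
Proof.
apply/measurable_mxP; apply: measurable_addmx; last exact: measurable_cstmx.
by apply/measurable_mxP; exact: measurable_id.
Qed.

Lemma measurable_fun_mulmxr n m (A : 'M[R]_(n, m)) :
  measurable_fun setT (fun v : 'rV[R]_n => v *m A).
Proof.
apply/measurable_mxP; apply: measurable_mulmx; last exact: measurable_cstmx.
by apply/measurable_mxP; exact: measurable_id.
Qed.

Lemma measurable_rV_consr n (x : R) :
  measurable_fun setT (fun v : 'rV[R]_n => rV_cons (x, v)).
Proof.
exact: (measurableT_comp (@measurable_rV_cons R n)).
Qed.

Lemma measurable_rV_consl n (v : 'rV[R]_n) :
  measurable_fun setT (fun x : measurableTypeR R => rV_cons (x, v)).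
Proof.
exact: (measurableT_comp (@measurable_rV_cons R n)).
Qed.

Lemma integral_lebesgue_translation (a : R) (f : measurableTypeR R -> \bar R) :
    measurable_fun setT f -> (forall x, 0 <= f x)%E ->
  (\int[mu]_x f (x + a)%R = \int[mu]_x f x)%E.
Proof.
move=> mf f0; rewrite -[RHS](integral_lebesgue_affine a (oner_neq0 R))//.
by rewrite normr1 mul1e; apply: eq_integral => x _; rewrite mul1r.
Qed.

Lemma integral_lebesgue_rV0 (f : 'rV[R]_0 -> \bar R) :
  measurable_fun setT f -> (\int[lebesgue_rV 0]_v f v = f 0%R)%E.
Proof.
by move=> mf; rewrite [LHS]integral_dirac//= diracT mul1e.
Qed.

Lemma integral_lebesgue_rV_translation n (a : 'rV[R]_n) (f : 'rV[R]_n -> \bar R) :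
    measurable_fun setT f -> (forall v, 0 <= f v)%E ->
  (\int[lebesgue_rV n]_v f (v + a)%R = \int[lebesgue_rV n]_v f v)%E.
Proof.
elim: n a f => [|n IH] a f mf f0.
  have mfa : measurable_fun setT (fun v : 'rV[R]_0 => f (v + a)).
    exact: (measurableT_comp mf (measurable_fun_addr a)).
  by rewrite (integral_lebesgue_rV0 mf) (integral_lebesgue_rV0 mfa) [(0 + a)%R]thinmx0.
rewrite (integral_lebesgue_rVS mf f0) (integral_lebesgue_rVS
  (measurableT_comp mf (measurable_fun_addr a)) (fun v => f0 _)) /=.
pose a1 : R := a ord0 ord0; pose a2 := (rV_uncons a).2.
have aE : a = rV_cons (a1, a2).
  apply/rowP => i; case: (unliftP ord0 i) => [j|] ->; last by rewrite rV_cons0.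
  by rewrite rV_cons_lift /a2 /= mxE.
have consD x v : rV_cons (x, v) + a = rV_cons (x + a1, v + a2).
  rewrite aE; apply/rowP => i; rewrite mxE.
  by case: (unliftP ord0 i) => [j|] ->; rewrite ?rV_cons0 ?rV_cons_lift /= ?mxE.
transitivity (\int[mu]_x \int[lebesgue_rV n]_v f (rV_cons ((x + a1)%R, v)))%E.
  apply: eq_integral => x _; under eq_integral do rewrite consD.
  apply: (IH a2 (fun v => f (rV_cons (x + a1, v)))) => //.
  exact: (measurableT_comp mf (measurable_rV_consr _)).
rewrite (integral_lebesgue_translation a1
  (f := fun x => (\int[lebesgue_rV n]_v f (rV_cons (x, v)))%E))//; last first.
  by move=> x; apply: integral_ge0 => v _; exact: f0.
apply: (measurable_fun_fubini_tonelli_F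
  (fun p : measurableTypeR R * 'rV[R]_n => f (rV_cons p))) => //.
by apply: measurableT_comp => //; exact: measurable_rV_cons.
Qed.

(** Kept as a property of the matrix so that it passes through products: a factorization into shears
    and a block diagonal matrix then suffices. *)
Definition change_of_variables n (A : 'M[R]_n) :=
  forall f : 'rV[R]_n -> \bar R, measurable_fun setT f -> (forall v, 0 <= f v)%E ->
  (`|\det A|%:E * \int[lebesgue_rV n]_v f (v *m A) = \int[lebesgue_rV n]_v f v)%E.

Lemma change_of_variablesM n (A B : 'M[R]_n) :
  change_of_variables A -> change_of_variables B -> change_of_variables (A *m B).
Proof.
move=> hA hB f mf f0; rewrite det_mulmx normrM mulrC EFinM -muleA -(hB f)//.
congr (_ * _)%E; rewrite -(hA (fun v => f (v *m B)))//.
  by congr (_ * _)%E; apply: eq_integral => v _; rewrite mulmxA.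
exact: (measurableT_comp mf (measurable_fun_mulmxr B)).
Qed.

Let mcons n (f : 'rV[R]_n.+1 -> \bar R) : measurable_fun setT f ->
  measurable_fun setT (fun p : measurableTypeR R * 'rV[R]_n => f (rV_cons p)).
Proof. by move=> mf; apply: measurableT_comp => //; exact: measurable_rV_cons. Qed.

(** At a fixed first coordinate this shear is a translation of the remaining ones. *)
Lemma change_of_variables_ublock n (b : 'rV[R]_n) :
  @change_of_variables (1 + n) (block_mx 1%:M b 0 1%:M).
Proof.
move=> f mf f0; rewrite det_ublock !det1 mulr1 normr1 mul1e.
rewrite (integral_lebesgue_rVS mf f0) (integral_lebesgue_rVS
  (measurableT_comp mf (measurable_fun_mulmxr _)) (fun v => f0 _)) /=.
apply: eq_integral => x _.
rewrite -(integral_lebesgue_rV_translation (x *: b)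
  (f := fun v => f (rV_cons (x, v))))//; last first.
  exact: (measurableT_comp mf (measurable_rV_consr _)).
apply: eq_integral => v _ /=.
by rewrite rV_cons_mul_block mulmx0 mxE addr0 mulr1 mulmx1 [(v + _)%R]addrC.
Qed.

(** Here the first coordinate is translated by an amount depending on the others, hence the opposite
    order of integration. *)
Lemma change_of_variables_lblock n (c : 'cV[R]_n) :
  @change_of_variables (1 + n) (block_mx 1%:M 0 c 1%:M).
Proof.
move=> f mf f0; rewrite det_lblock !det1 mulr1 normr1 mul1e.
rewrite (integral_lebesgue_rVS_swap mf f0) (integral_lebesgue_rVS_swap
  (measurableT_comp mf (measurable_fun_mulmxr _)) (fun v => f0 _)) /=.
apply: eq_integral => v _ /=.
rewrite -(integral_lebesgue_translation ((v *m c) 0 0)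
  (f := fun x => f (rV_cons (x, v))))//; last first.
  exact: (measurableT_comp mf (measurable_rV_consl _)).
apply: eq_integral => x _.
by rewrite rV_cons_mul_block scaler0 add0r mulr1 mulmx1.
Qed.

Lemma change_of_variables_diag_block n (a : R) (S : 'M[R]_n) :
    a != 0 -> change_of_variables S ->
  @change_of_variables (1 + n) (block_mx a%:M 0 0 S).
Proof.
move=> a0 hS f mf f0; rewrite det_lblock det_scalar1 normrM EFinM.
rewrite (integral_lebesgue_rVS mf f0) (integral_lebesgue_rVS
  (measurableT_comp mf (measurable_fun_mulmxr _)) (fun v => f0 _)) /=.
have mF : measurable_fun setT
    (fun x : measurableTypeR R => \int[lebesgue_rV n]_v f (rV_cons (x, v)))%E.
  exact: (measurable_fun_fubini_tonelli_F _ (mcons mf) (fun p => f0 _)).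
have F0 (x : measurableTypeR R) : (0 <= \int[lebesgue_rV n]_v f (rV_cons (x, v)))%E.
  exact: integral_ge0.
rewrite -(integral_lebesgue_affine 0 a0 mF F0) -muleA; congr (_ * _)%E.
have mG := measurable_fun_fubini_tonelli_F (m2 := lebesgue_rV n) _
  (mcons (measurableT_comp mf (measurable_fun_mulmxr (block_mx a%:M 0 0 S))))
  (fun p => f0 _).
rewrite -(ge0_integralZT _ (normr_ge0 (\det S)) mG); last first.
  by move=> x; apply: integral_ge0 => v _; exact: f0.
apply: eq_integral => x _.
rewrite -(hS (fun v => f (rV_cons ((a * x + 0)%R, v))))//; last first.
  exact: (measurableT_comp mf (measurable_rV_consr _)).
congr (_ * _)%E; apply: eq_integral => v _ /=.
by rewrite rV_cons_mul_block mulmx0 mxE scaler0 add0r mulrC.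
Qed.

(** Induction by block elimination at the top left entry; a row operation first makes that entry
    nonzero when necessary. *)
Lemma change_of_variables_unitmx n (A : 'M[R]_n) :
  A \in unitmx -> change_of_variables A.
Proof.
elim: n A => [|n IH] A uA.
  move=> f mf f0; rewrite det_mx00 normr1 mul1e.
  by apply: eq_integral => v _; rewrite [v]thinmx0 mul0mx.
have pivot (B : 'M[R]_(1 + n)) : B \in unitmx -> ulsubmx B 0 0 != 0 ->
    @change_of_variables (1 + n) B.
  move=> uB; set a := ulsubmx B 0 0 => a0.
  pose b := ursubmx B; pose c := dlsubmx B.
  (* Since det B = a det S, this Schur complement is again invertible. *)
  pose S := drsubmx B - a^-1 *: (c *m b).
  have BE : B = block_mx 1%:M 0 (a^-1 *: c) 1%:M *m
                (block_mx a%:M 0 0 S *m block_mx 1%:M (a^-1 *: b) 0 1%:M).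
    rewrite [X in _ *m X](_ : _ = block_mx a%:M b 0 S); last first.
      rewrite mulmx_block !mulmx0 !mul0mx !mulmx1 !addr0 !add0r.
      by rewrite mul_scalar_mx scalerA mulfV// scale1r.
    rewrite mulmx_block !mulmx0 !mul0mx !mul1mx !addr0 mul_mx_scalar.
    rewrite scalerA mulfV// scale1r -scalemxAl /S [(_ + (_ - _))%R]addrC subrK.
    by rewrite -{1}[B]submxK; congr block_mx; rewrite [LHS]mx11_scalar.
  have uS : S \in unitmx.
    move: uB; rewrite !unitmxE BE !det_mulmx !det_lblock det_ublock !det1 !mulr1 !mul1r.
    by rewrite unitrM => /andP[].
  rewrite BE; apply: change_of_variablesM; first exact: change_of_variables_lblock.
  apply: change_of_variablesM; last exact: change_of_variables_ublock.
  by apply: change_of_variables_diag_block => //; exact: IH.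
pose B : 'M[R]_(1 + n) := A.
have [a0|] := eqVneq (ulsubmx B 0 0) 0; last exact: (@pivot B).
have [c0|] := eqVneq (dlsubmx B) 0.
  move: uA; rewrite unitmxE (_ : \det A = \det B)// -[B]submxK c0 det_ublock.
  by rewrite [ulsubmx B]mx11_scalar a0 det_scalar1 mul0r unitr0.
move=> /cV0Pn[k ck].
(* [U 1] adds a lower row to the first one, so that the pivot becomes the nonzero entry [k] found in
   the first column; [U (-1)] undoes it. *)
pose U (s : R) : 'M[R]_(1 + n) := block_mx 1%:M (s *: delta_mx 0 k) 0 1%:M.
have UK : U (-1) *m U 1 = 1%:M.
  rewrite mulmx_block !mulmx0 !mul0mx !mulmx1 !mul1mx !addr0 !add0r scale1r scaleN1r.
  by rewrite subrr -scalar_mx_block.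
rewrite (_ : A = (U (-1) *m (U 1 *m B))); last by rewrite mulmxA UK mul1mx.
apply: change_of_variablesM; first exact: change_of_variables_ublock.
apply: pivot.
  by rewrite unitmx_mul uA andbT unitmxE det_ublock !det1 mulr1 unitr1.
rewrite -[B]submxK mulmx_block block_mxKul mul1mx scale1r mxE a0 add0r.
by rewrite -rowE mxE.
Qed.

End lebesgue_rV_linear.

(** * Laws of independent tuples *)

Section tuple_measure.
Context d {T : measurableType d} {R : realType}.

Definition tcons n (p : T * n.-tuple T) : n.+1.-tuple T := [tuple of p.1 :: p.2].

Definition tuncons n (t : n.+1.-tuple T) : T * n.-tuple T :=
  (thead t, [tuple of behead t]).

Lemma tcons0 n (p : T * n.-tuple T) : tnth (tcons p) ord0 = p.1.
Proof. by []. Qed.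

Lemma tconsS n (p : T * n.-tuple T) i : tnth (tcons p) (lift ord0 i) = tnth p.2 i.
Proof. by rewrite tnthS. Qed.

Lemma tconsK n : cancel (@tcons n) (@tuncons n).
Proof. by move=> [x t]; congr pair; exact/val_inj. Qed.

Lemma tnth_tuncons n (t : n.+1.-tuple T) i :
  tnth (tuncons t).2 i = tnth t (lift ord0 i).
Proof. by rewrite [in RHS](tuple_eta t) tnthS. Qed.

Lemma measurable_tcons n : measurable_fun setT (@tcons n).
Proof. by apply: measurable_cons; [exact: measurable_fst|exact: measurable_snd]. Qed.

Lemma measurable_tuncons n : measurable_fun setT (@tuncons n).
Proof.
apply/measurable_fun_pairP; split.
  rewrite (_ : _ \o _ = (fun t : n.+1.-tuple T => tnth t ord0)).
    exact: measurable_tnth.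
  by apply/funext => t /=; rewrite /thead.
exact: measurable_behead.
Qed.

Section step.
Variables (m1 : {sigma_finite_measure set T -> \bar R}) (n : nat).
Variable (m : {sigma_finite_measure set n.-tuple T -> \bar R}).

Definition tuple_measure_step : set (n.+1.-tuple T) -> \bar R :=
  pushforward (m1 \x m)%E (@tcons n).

Let step0 : tuple_measure_step set0 = 0%E.
Proof. by rewrite /tuple_measure_step /pushforward preimage_set0 measure0. Qed.

Let step_ge0 A : (0 <= tuple_measure_step A)%E.
Proof. by apply: measure_ge0; exact: measurable_tcons. Qed.

Let step_sigma_additive : semi_sigma_additive tuple_measure_step.
Proof. by apply: measure_semi_sigma_additive; exact: measurable_tcons. Qed.

HB.instance Definition _ := isMeasure.Build _ _ _
  tuple_measure_step step0 step_ge0 step_sigma_additive.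

Let step_sigma_finite : sigma_finite setT tuple_measure_step.
Proof.
have /sigma_finiteP[F [TF ndF Foo]] := sigma_finiteT m1.
have /sigma_finiteP[G [TG ndG Goo]] := sigma_finiteT m.
exists (fun k => @tuncons n @^-1` (F k `*` G k)).
  apply/esym; rewrite -subTset => t _.
  have [i _ Fi] : (\bigcup_i F i) (tuncons t).1 by rewrite -TF.
  have [j _ Gj] : (\bigcup_j G j) (tuncons t).2 by rewrite -TG.
  exists (maxn i j) => //; split => /=.
    by move: Fi; exact/subsetPset/ndF/leq_maxl.
  by move: Gj; exact/subsetPset/ndG/leq_maxr.
move=> k; have [mF Fk] := Foo k; have [mG Gk] := Goo k; split.
  by rewrite -[X in measurable X]setTI; apply: measurable_tuncons => //; exact: measurableX.
rewrite /tuple_measure_step /pushforward -comp_preimage.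
rewrite (_ : _ \o _ = id) ?preimage_id; last by rewrite funeqE => p; exact: tconsK.
by rewrite product_measure1E// lte_mul_pinfty// ge0_fin_numE.
Qed.

HB.instance Definition _ :=
  Measure_isSigmaFinite.Build _ _ _ tuple_measure_step step_sigma_finite.
End step.

(** Built head first like [lebesgue_rV], so that Tonelli's theorem for two factors peels off one
    point at a time. It is used both for Lebesgue measure and for laws of points, hence
    sigma-finiteness. *)
Fixpoint tuple_measure (m : {sigma_finite_measure set T -> \bar R}) n :
    {sigma_finite_measure set n.-tuple T -> \bar R} :=
  if n is n'.+1 then tuple_measure_step m (tuple_measure m n')
  else \d_([tuple] : 0.-tuple T).

Variable m : {sigma_finite_measure set T -> \bar R}.

Lemma integral_tuple0 (f : 0.-tuple T -> \bar R) :
  measurable_fun setT f -> (\int[tuple_measure m 0]_t f t = f [tuple])%E.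
Proof. by move=> mf; rewrite [LHS]integral_dirac//= diracT mul1e. Qed.

Lemma measurable_comp_tcons n (f : n.+1.-tuple T -> \bar R) :
  measurable_fun setT f -> measurable_fun setT (fun p => f (@tcons n p)).
Proof. by move=> mf; apply: (measurableT_comp mf); exact: measurable_tcons. Qed.

Lemma integral_tupleS n (f : n.+1.-tuple T -> \bar R) :
    measurable_fun setT f -> (forall t, 0 <= f t)%E ->
  (\int[tuple_measure m n.+1]_t f t =
   \int[m]_x \int[tuple_measure m n]_t f (tcons (x, t)))%E.
Proof.
move=> mf f0.
rewrite (_ : tuple_measure m n.+1 = tuple_measure_step m (tuple_measure m n)
  :> (set _ -> _))//.
rewrite (ge0_integral_pushforward (@measurable_tcons n))//.
rewrite preimage_setT fubini_tonelli1//; last by move=> p; exact: f0.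
exact: measurable_comp_tcons.
Qed.

Lemma integral_tupleS_swap n (f : n.+1.-tuple T -> \bar R) :
    measurable_fun setT f -> (forall t, 0 <= f t)%E ->
  (\int[tuple_measure m n.+1]_t f t =
   \int[tuple_measure m n]_t \int[m]_x f (tcons (x, t)))%E.
Proof.
move=> mf f0; rewrite (integral_tupleS mf f0).
by rewrite (fubini_tonelli (fun p : T * n.-tuple T => f (tcons p)))//;
  exact: measurable_comp_tcons.
Qed.

Lemma measurable_tconsr n (x : T) :
  measurable_fun setT (fun t : n.-tuple T => tcons (x, t)).
Proof. exact: (measurableT_comp (@measurable_tcons n)). Qed.

Lemma measurable_tuple_box n (A : 'I_n -> set T) : (forall i, measurable (A i)) ->
  measurable [set t : n.-tuple T | forall i, A i (tnth t i)].
Proof.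
move=> mA.
rewrite [X in measurable X](_ : _ = \bigcap_(i in [set: 'I_n])
    (setT `&` (fun t : n.-tuple T => tnth t i) @^-1` A i)).
  apply: fin_bigcap_measurable => // i _.
  by apply: measurable_tnth.
by apply/seteqP; split => v /= h i; have := h i; rewrite setTI//=; apply.
Qed.

Lemma tuple_measure_box n (A : 'I_n -> set T) : (forall i, measurable (A i)) ->
  tuple_measure m n [set t | forall i, A i (tnth t i)] = (\prod_(i < n) m (A i))%E.
Proof.
elim: n A => [|n IH] A mA.
  by rewrite big_ord0 /= diracE mem_set// => -[].
rewrite big_ord_recl -IH//.
have mB := measurable_tuple_box (fun i => mA (lift ord0 i)).
rewrite -(product_measure1E m (tuple_measure m n) (mA ord0) mB).
rewrite [LHS]/= /tuple_measure_step /pushforward.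
congr (product_measure1 _ _ _); apply/seteqP; split => -[x v] /=.
  move=> h; split; first exact: (h ord0).
  by move=> i; have := h (lift ord0 i); rewrite tconsS.
move=> [Ax Av] i; case: (unliftP ord0 i) => [j|] ->//.
by rewrite tconsS.
Qed.

End tuple_measure.

Section tuple_measure_map.
Context d1 d2 {T1 : measurableType d1} {T2 : measurableType d2} {R : realType}.
Variables (m1 : {sigma_finite_measure set T1 -> \bar R}).
Variables (m2 : {sigma_finite_measure set T2 -> \bar R}).
Variables (phi : T1 -> T2) (g : T1 -> R).
Hypothesis mphi : measurable_fun setT phi.
Hypothesis mg : measurable_fun setT g.
Hypothesis g0 : forall x, 0 <= g x.
Hypothesis int_map : forall f : T2 -> \bar R, measurable_fun setT f ->
  (forall x, 0 <= f x)%E ->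
  (\int[m1]_x ((g x)%:E * f (phi x)) = \int[m2]_y f y)%E.

Lemma measurable_map_tuple n :
  measurable_fun setT (fun t : n.-tuple T1 => map_tuple phi t).
Proof.
apply/measurable_fun_tnthP => i.
rewrite (_ : _ \o _ = (fun t : n.-tuple T1 => phi (tnth t i))); last first.
  by apply/funext => t /=; rewrite tnth_map.
by apply: (measurableT_comp mphi); exact: measurable_tnth.
Qed.

Lemma measurable_prod_tnth n :
  measurable_fun setT (fun t : n.-tuple T1 => \prod_(i < n) g (tnth t i)).
Proof.
apply: measurable_prod => i _; apply: (measurableT_comp mg).
exact: measurable_tnth.
Qed.

(** Peeling off one point at a time, a change of variables for one point with weight [g] extends to
    tuples with the product weight. It serves for affine substitutions ([g] constant), densities
    ([phi] the identity) and projections ([g] = 1). *)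
Lemma integral_tuple_map n (f : n.-tuple T2 -> \bar R) :
    measurable_fun setT f -> (forall x, 0 <= f x)%E ->
  (\int[tuple_measure m1 n]_t ((\prod_(i < n) g (tnth t i))%:E * f (map_tuple phi t))
   = \int[tuple_measure m2 n]_t f t)%E.
Proof.
have mF k (h : k.-tuple T2 -> \bar R) : measurable_fun setT h ->
    measurable_fun setT (fun t : k.-tuple T1 =>
      ((\prod_(i < k) g (tnth t i))%:E * h (map_tuple phi t))%E).
  move=> mh; apply: emeasurable_funM.
    by apply/measurable_EFinP; exact: measurable_prod_tnth.
  by apply: (measurableT_comp mh); exact: measurable_map_tuple.
have F0 k (h : k.-tuple T2 -> \bar R) : (forall x, 0 <= h x)%E -> forall t : k.-tuple T1,
    (0 <= (\prod_(i < k) g (tnth t i))%:E * h (map_tuple phi t))%E.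
  by move=> h0 t; rewrite mule_ge0// lee_fin; apply: prodr_ge0.
elim: n f => [|n IH] f mf f0.
  rewrite (integral_tuple0 _ mf) (integral_tuple0 _ (mF _ _ mf)) big_ord0 mul1e.
  by congr f; exact/val_inj.
rewrite (integral_tupleS _ (mF _ _ mf) (F0 _ _ f0)) (integral_tupleS _ mf f0).
rewrite -int_map; last 2 first.
- exact: (measurable_fun_fubini_tonelli_F _ (measurable_comp_tcons mf) (fun=> f0 _)).
- by move=> x; exact: integral_ge0.
apply: eq_integral => x _.
have mfx : measurable_fun setT (fun t : n.-tuple T2 => f (tcons (phi x, t))).
  by apply: (measurableT_comp mf); exact: measurable_tconsr.
rewrite -(IH _ mfx (fun=> f0 _)) -ge0_integralZT//.
- apply: eq_integral => t _; rewrite big_ord_recl tcons0 /= EFinM -muleA.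
  congr (_ * (_ * _))%E; first by congr EFin; apply: eq_bigr => i _; rewrite tconsS.
  by congr f; exact/val_inj.
- exact: (mF _ _ mfx).
- by move=> t; exact: (F0 _ _ (fun=> f0 _)).
Qed.

End tuple_measure_map.

Section tuple_measure_unique.
Context d {T : measurableType d} {R : realType} (n : nat).

(** Boxes form a generating pi-system, and [setT] is itself a box of finite mass. *)
Lemma eq_measure_tuple (m1 m2 : {measure set n.-tuple T -> \bar R}) :
    (m1 setT < +oo)%E ->
    (forall A : 'I_n -> set T, (forall i, measurable (A i)) ->
      m1 [set t | forall i, A i (tnth t i)] = m2 [set t | forall i, A i (tnth t i)]) ->
  forall E, measurable E -> m1 E = m2 E.
Proof.
move=> m1oo m12 E mE.
pose G : set (set (n.-tuple T)) := [set B | exists2 A : 'I_n -> set T,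
  (forall i, measurable (A i)) & B = [set t | forall i, A i (tnth t i)]].
apply: (@g_sigma_algebra_measure_unique _ _ _ G _ (fun=> setT)).
- by move=> _ [A mA ->]; exact: measurable_tuple_box.
- by move=> i; exists (fun=> setT) => //; apply/seteqP; split.
- by apply/seteqP; split => // x _; exists 0%N.
- move=> _ _ [A mA ->] [B mB ->]; exists (fun i => A i `&` B i).
    by move=> i; exact: measurableI.
  apply/seteqP; split => t /=; first by move=> [hA hB] i; split.
  by move=> h; split => i; case: (h i).
- by move=> _ [A mA ->]; exact: m12.
- by move=> _.
- move: mE; apply: sub_sigma_algebra2 => B.
  rewrite -bigcup_seq/= => -[i _ [C mC <-]].
  exists (fun j => if j == i then C else setT); first by move=> j; case: ifP.
  apply/seteqP; split => t /=; first by move=> [_ h] j; case: eqP => // ->.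
  by move=> /(_ i); rewrite eqxx.
Qed.

End tuple_measure_unique.

Section independent_law.
Context d {Omega : measurableType d} {R : realType} {P : probability Omega R}.
Context d' {T : measurableType d'} (n : nat) (X : 'I_n -> {RV P >-> T}).
Variable m : probability T R.
Hypothesis indepX : mutually_independent X.
Hypothesis lawX : forall i A, measurable A -> P (X i @^-1` A) = m A.

Lemma measurable_mktuple_RV :
  measurable_fun setT (fun w => [tuple X i w | i < n]).
Proof.
apply/measurable_fun_tnthP => i.
rewrite (_ : _ \o _ = X i); first exact: measurable_funPT.
by apply/funext => w /=; rewrite tnth_mktuple.
Qed.

(** Independence over the full index set says that the joint law and the product measure agree on
    boxes. *)
Lemma integral_independent (f : n.-tuple T -> \bar R) :
    measurable_fun setT f -> (forall t, 0 <= f t)%E ->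
  (\int[P]_w f [tuple X i w | i < n] = \int[tuple_measure m n]_t f t)%E.
Proof.
move=> mf f0.
have mX := measurable_mktuple_RV.
rewrite -[LHS](ge0_integral_pushforward mX P (D := setT) (f := f))//.
pose PX0 : {measure set n.-tuple T -> \bar R} :=
  pushforward P (fun w => [tuple X i w | i < n]).
pose PX := PX0 mX.
apply: (@eq_measure_integral _ _ _ _ (tuple_measure m n) PX) => A mA _.
apply: (@eq_measure_tuple _ _ _ n PX (tuple_measure m n)) => // {A mA}.
  by rewrite /PX /= /pushforward preimage_setT probability_setT ltry.
move=> B mB.
rewrite [RHS](tuple_measure_box m mB) /PX /= /pushforward.
have := indepX (finset.setTfor 'I_n) mB.
rewrite (_ : \bigcap_(i in _) _ =
    (fun w => [tuple X i w | i < n]) @^-1` [set t | forall i, B i (tnth t i)]).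
  by move=> ->; apply: eq_big => [i|i _]; rewrite ?inE// lawX.
apply/seteqP; split => w /=.
  by move=> h i; rewrite tnth_mktuple; apply: h => /=; rewrite inE.
by move=> h i _; have := h i; rewrite tnth_mktuple.
Qed.

End independent_law.

(** * Degenerate configurations *)

Section indicator_bool.
Context {R : realType}.

(** Conditions are kept as booleans and enter integrals through this cast, which turns conjunctions
    into products. *)
Definition Iv (b : bool) : \bar R := (b%:R)%:E.

Lemma Iv_ge0 b : (0 <= Iv b)%E.
Proof. by rewrite lee_fin ler0n. Qed.

Lemma IvM a b : Iv (a && b) = (Iv a * Iv b)%E.
Proof. by rewrite /Iv -EFinM -natrM mulnb. Qed.

Lemma Iv_forall n (p : pred 'I_n) :
  Iv [forall i, p i] = (\prod_(i < n) (p i)%:R : R)%:E.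
Proof.
rewrite /Iv; congr EFin; case: (boolP [forall i, p i]) => [/forallP h|].
  by rewrite big1// => i _; rewrite h.
by rewrite negb_forall => /existsP[i /negbTE pi]; rewrite (bigD1 i)//= pi mul0r.
Qed.

Lemma measurable_Iv d (T : measurableType d) (b : T -> bool) :
  measurable_fun setT b -> measurable_fun setT (fun x => Iv (b x)).
Proof.
move=> mb; rewrite (_ : (fun x => _) = fun x => if b x then 1%E else 0%E).
  exact: measurable_fun_ifT.
by apply/funext => x; rewrite /Iv; case: (b x).
Qed.

Lemma measurable_forall d (T : measurableType d) n (b : T -> 'I_n -> bool) :
  (forall i, measurable_fun setT (b ^~ i)) ->
  measurable_fun setT (fun x => [forall i, b x i]).
Proof.
move=> mb; rewrite (_ : (fun x => _) = fun x => \big[andb/true]_(i < n) b x i).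
  elim: (index_enum _) => [|i s IH].
    by under eq_fun do rewrite big_nil; exact: measurable_cst.
  by under eq_fun do rewrite big_cons; exact: measurable_and.
apply/funext => x; rewrite big_andE.
by apply/forallP/forallP => h i; have := h i.
Qed.

Lemma integral_null d (T : measurableType d) (m : {measure set T -> \bar R})
    (N : set T) (f : T -> \bar R) :
    measurable N -> m N = 0%E -> measurable_fun setT f -> (forall x, 0 <= f x)%E ->
    (forall x, ~ N x -> f x = 0%E) ->
  (\int[m]_x f x = 0)%E.
Proof.
move=> mN N0 mf f0 fN.
rewrite (ge0_negligible_integral mN measurableT mf (fun x _ => f0 x) N0).
by apply: integral0_eq => x [_ Nx]; exact: fN.
Qed.

(** The exceptional set is given by a boolean test of integral zero, the form in which degenerate
    configurations arise. *)
Lemma eq_integral_null d (T : measurableType d) (m : {measure set T -> \bar R})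
    (b : T -> bool) (f g : T -> \bar R) :
    measurable_fun setT b -> (\int[m]_x Iv (b x) = 0)%E ->
    measurable_fun setT f -> measurable_fun setT g ->
    (forall x, 0 <= f x)%E -> (forall x, 0 <= g x)%E ->
    (forall x, ~~ b x -> f x = g x) ->
  (\int[m]_x f x = \int[m]_x g x)%E.
Proof.
move=> mb b0 mf mg f0 g0 fg.
have mN : measurable [set x | b x].
  rewrite (_ : [set x | b x] = setT `&` b @^-1` [set true]); last first.
    by rewrite setTI; apply/seteqP; split.
  exact: mb.
have mN0 : m [set x | b x] = 0%E.
  rewrite -b0 -(setIT [set x | b x]) -(integral_indic m measurableT mN).
  by apply: eq_integral => x _; rewrite indicE /Iv -[RHS]/((b x)%:R%:E) mem_setE.
rewrite (ge0_negligible_integral mN measurableT mf (fun x _ => f0 x) mN0).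
rewrite (ge0_negligible_integral mN measurableT mg (fun x _ => g0 x) mN0).
by apply: eq_integral => x; rewrite inE => -[_ /negP]; exact: fg.
Qed.

End indicator_bool.

Section tuple_translation.
Context {R : realType}.
Local Notation lam D := (@lebesgue_rV R D).

Definition tadd D n (a t : n.-tuple 'rV[R]_D) : n.-tuple 'rV[R]_D :=
  [tuple tnth t i + tnth a i | i < n].

Lemma measurable_tadd D n (a : n.-tuple 'rV[R]_D) : measurable_fun setT (tadd a).
Proof.
apply/measurable_fun_tnthP => i.
rewrite (_ : _ \o _ = (fun t : n.-tuple _ => tnth t i + tnth a i)); last first.
  by apply/funext => t /=; rewrite tnth_mktuple.
apply: (measurableT_comp (measurable_fun_addr (tnth a i))).
exact: measurable_tnth.
Qed.

Lemma integral_tuple_translation D n (a : n.-tuple 'rV[R]_D)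
    (f : n.-tuple 'rV[R]_D -> \bar R) :
    measurable_fun setT f -> (forall t, 0 <= f t)%E ->
  (\int[tuple_measure (lam D) n]_t f (tadd a t) =
   \int[tuple_measure (lam D) n]_t f t)%E.
Proof.
elim: n a f => [|n IH] a f mf f0.
  have mfa := measurableT_comp mf (measurable_tadd a).
  rewrite (integral_tuple0 _ mf) [LHS](integral_tuple0 _ mfa) /=.
  by rewrite [tadd _ _]tuple0.
have mfa := measurableT_comp mf (measurable_tadd a).
rewrite (integral_tupleS _ mf f0) (integral_tupleS _ mfa (fun=> f0 _)) /=.
have taddE x (t : n.-tuple 'rV[R]_D) : tadd a (tcons (x, t)) =
    tcons (x + thead a, tadd [tuple of behead a] t).
  apply: eq_from_tnth => i; rewrite tnth_mktuple.
  case: (unliftP ord0 i) => [j|] ->; last by rewrite !tcons0.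
  rewrite !tconsS tnth_mktuple; congr (_ + _).
  by rewrite [in LHS](tuple_eta a) tnthS.
pose F x := (\int[tuple_measure (lam D) n]_t f (tcons (x, t)))%E.
have mF : measurable_fun setT F.
  exact: (measurable_fun_fubini_tonelli_F _ (measurable_comp_tcons mf) (fun=> f0 _)).
transitivity (\int[lam D]_x F (x + thead a)%R)%E; last first.
  apply: integral_lebesgue_rV_translation => // x.
  by apply: integral_ge0 => t _; exact: f0.
apply: eq_integral => x _.
under eq_integral do rewrite taddE.
apply: (IH _ (fun t => f (tcons ((x + thead a)%R, t)))) => //.
by apply: (measurableT_comp mf); exact: measurable_tconsr.
Qed.

End tuple_translation.

Section degenerate.
Context {R : realType}.
Local Notation lam D := (@lebesgue_rV R D).
Local Notation mu := (@lebesgue_measure R).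

(** Its determinant is, up to sign, D! times the volume of the simplex; it vanishes exactly when the
    points are affinely dependent. *)
Definition edgemx D (z : D.+1.-tuple 'rV[R]_D) : 'M[R]_D :=
  \matrix_(i, j) (tnth z (lift ord0 i) ord0 j - tnth z ord0 ord0 j).

Lemma measurable_tnth_coord d (T : measurableType d) D n
    (f : T -> n.-tuple 'rV[R]_D) i j : measurable_fun setT f ->
  measurable_fun setT (fun x => tnth (f x) i ord0 j).
Proof.
move=> mf.
have mt : measurable_fun setT (fun x => tnth (f x) i).
  by apply: (measurableT_comp (measurable_tnth i)).
by move/measurable_fun_rVP : mt; exact.
Qed.

Lemma measurable_edgemx d (T : measurableType d) D (f : T -> D.+1.-tuple 'rV[R]_D) :
  measurable_fun setT f -> measurable_mx (fun x => edgemx (f x)).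
Proof.
move=> mf i j; under eq_fun do rewrite mxE.
by apply: measurable_funB; exact: measurable_tnth_coord.
Qed.

Lemma measurable_det_edgemx_eq0 d (T : measurableType d) D
    (f : T -> D.+1.-tuple 'rV[R]_D) :
  measurable_fun setT f -> measurable_fun setT (fun x => \det (edgemx (f x)) == 0).
Proof.
move=> mf; apply: measurable_fun_eqr => //.
by apply: measurable_det; exact: measurable_edgemx.
Qed.

Lemma horner_char_poly n (A : 'M[R]_n) s : (char_poly A).[s] = \det (s%:M - A).
Proof.
rewrite /char_poly -horner_evalE -det_map_mx; congr (\det _).
by apply/matrixP => i j; rewrite !mxE /= /horner_eval hornerD hornerN hornerC hornerMn hornerX.
Qed.

Lemma roots_in_seq (p : {poly R}) : p != 0 ->
  exists s : seq R, forall x, root p x -> x \in s.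
Proof.
have [n] := ubnP (size p); elim: n p => // n IH p /ltnSE pn p0.
have [[a pa]|nroot] := pselect (exists a, root p a); last first.
  by exists [::] => x px; exfalso; apply: nroot; exists x.
have [q pq] := factor_theorem p a pa.
have q0 : q != 0 by apply: contra_neq p0 => q0; rewrite pq q0 mul0r.
have [|s hs] := IH q _ q0.
  by move: pn; rewrite pq size_Mmonic ?monicXsubC// size_XsubC addn2.
exists (a :: s) => x; rewrite pq rootM root_XsubC inE => /orP[/hs ->|->]//.
by rewrite orbT.
Qed.

(** In [s] the determinant is the characteristic polynomial of [- A], which is monic and so has
    finitely many roots. The test [b] allows a cut-off in [s]. *)
Lemma det_shift_null n (A : 'M[R]_n) (b : R -> bool) :
    measurable_fun setT (b : measurableTypeR R -> bool) ->
  (\int[mu]_s Iv (b s && (\det (A + s%:M) == 0))%R = 0)%E.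
Proof.
move=> mb.
have p0 : char_poly (- A) != 0 by rewrite monic_neq0// char_poly_monic.
have [s hs] := roots_in_seq p0.
have cs : countable [set` s] by apply: finite_set_countable; exact: finite_seq.
pose N : set (measurableTypeR R) := [set` s].
apply: (@integral_null R _ (measurableTypeR R) mu N).
- exact: countable_measurable.
- exact: countable_lebesgue_measure0.
- apply: measurable_Iv; apply: measurable_and => //.
  apply: measurable_fun_eqr => //; apply: measurable_det.
  apply: measurable_addmx; first exact: measurable_cstmx.
  by move=> i j; under eq_fun do rewrite mxE -mulr_natr; exact: measurable_funM.
- by move=> x; exact: Iv_ge0.
- move=> x /= xs; rewrite /Iv; case: eqP => [dx|]; last by rewrite andbF.
  by exfalso; apply: xs; apply: hs; rewrite /root horner_char_poly opprK addrC dx.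
Qed.

Lemma edgemx_tadd D (z0 : 'rV[R]_D) (t : D.-tuple 'rV[R]_D) (s : R) :
  edgemx (tcons (z0, tadd [tuple s *: delta_mx ord0 i | i < D] t)) =
  edgemx (tcons (z0, t)) + s%:M.
Proof.
apply/matrixP => i j; rewrite !mxE !tconsS !tcons0 !tnth_mktuple !mxE /=.
by rewrite addrAC mulr_natr eq_sym.
Qed.

(** Shifting the i-th free point by [s] along the i-th axis, and averaging over [s], leaves the
    integral unchanged; after exchanging the integrals, almost every [s] gives a nonzero
    determinant. *)
Lemma edgemx_null0 D (z0 : 'rV[R]_D) :
  (\int[tuple_measure (lam D) D]_t Iv (\det (edgemx (tcons (z0, t))) == 0)%R = 0)%E.
Proof.
pose F (t : D.-tuple 'rV[R]_D) := Iv (\det (edgemx (tcons (z0, t))) == 0) : \bar R.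
have mF : measurable_fun setT F.
  by apply: measurable_Iv; apply: measurable_det_edgemx_eq0; exact: measurable_tconsr.
have F0 t : (0 <= F t)%E by exact: Iv_ge0.
pose e (s : R) : D.-tuple 'rV[R]_D := [tuple s *: delta_mx ord0 i | i < D].
(* The cut-off to [0, 1] gives the average over [s] total mass 1. *)
pose b (s : measurableTypeR R) := (0 <= s) && (s <= 1).
have mb : measurable_fun setT b by apply: measurable_and; exact: measurable_fun_ler.
have intb : (\int[mu]_s Iv (b s) = 1)%E.
  rewrite (_ : 1%E = mu (`[0, 1]%classic)); last first.
    by rewrite lebesgue_measure_itv/= lte_fin ltr01 oppr0 adde0.
  rewrite -[in RHS](setIT `[0, 1]%classic) -integral_indic//.
  by apply: eq_integral => s _; rewrite indicE mem_setE /Iv.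
have intF : (0 <= \int[tuple_measure (lam D) D]_t F t)%E by exact: integral_ge0.
have H : (\int[tuple_measure (lam D) D]_t F t =
  \int[mu]_s \int[tuple_measure (lam D) D]_t (Iv (b s) * F (tadd (e s) t)))%E.
  rewrite -[LHS]mul1e -intb -ge0_integralZr//; first last.
  - by move=> s _; exact: Iv_ge0.
  - exact: measurable_Iv.
  apply: eq_integral => s _.
  rewrite /Iv ge0_integralZT//; last first.
    exact: (measurableT_comp mF (measurable_tadd _)).
  by rewrite (integral_tuple_translation (e s) mF F0).
rewrite -/(F _) [LHS]H.
have mG : measurable_fun setT (fun p : measurableTypeR R * D.-tuple 'rV[R]_D =>
    (Iv (b p.1) * F (tadd (e p.1) p.2))%E).
  apply: emeasurable_funM.
    by apply: measurable_Iv; exact: (measurableT_comp mb measurable_fst).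
  apply: (measurableT_comp mF).
  apply/measurable_fun_tnthP => i.
  rewrite (_ : _ \o _ = (fun p => tnth p.2 i + p.1 *: delta_mx ord0 i)); last first.
    by apply/funext => p /=; rewrite !tnth_mktuple.
  apply/measurable_mxP; apply: measurable_addmx.
    apply/measurable_mxP; apply: (measurableT_comp (measurable_tnth i)).
    exact: measurable_snd.
  apply: measurable_scalemx; first exact: measurable_fst.
  exact: measurable_cstmx.
have G0 (p : measurableTypeR R * D.-tuple 'rV[R]_D) :
    (0 <= Iv (b p.1) * F (tadd (e p.1) p.2))%E.
  by rewrite mule_ge0 ?Iv_ge0.
rewrite (fubini_tonelli (fun p : measurableTypeR R * D.-tuple 'rV[R]_D =>
    (Iv (b p.1) * F (tadd (e p.1) p.2))%E) mG G0) /=.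
apply: integral0_eq => t _.
transitivity (\int[mu]_s Iv (b s && (\det (edgemx (tcons (z0, t)) + s%:M) == 0))%R)%E.
  by apply: eq_integral => s _; rewrite IvM /F edgemx_tadd.
exact: det_shift_null.
Qed.

Lemma edgemx_null D :
  (\int[tuple_measure (lam D) D.+1]_z Iv (\det (edgemx z) == 0)%R = 0)%E.
Proof.
rewrite integral_tupleS.
- by apply: integral0_eq => z0 _; exact: edgemx_null0.
- by apply: measurable_Iv; apply: measurable_det_edgemx_eq0; exact: measurable_id.
- by move=> t; exact: Iv_ge0.
Qed.

End degenerate.

(** * The unit ball and its hyperplane sections *)

Section dot_product.
Context {R : realType} {n : nat}.
Implicit Types u v w : 'rV[R]_n.

Definition dot u v : R := \sum_(i < n) u ord0 i * v ord0 i.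

Lemma dotE u v : u *m v^T = (dot u v)%:M.
Proof.
rewrite [LHS]mx11_scalar; congr (_%:M); rewrite mxE.
by apply: eq_bigr => i _; rewrite mxE.
Qed.

Lemma dotC u v : dot u v = dot v u.
Proof. by apply: eq_bigr => i _; rewrite mulrC. Qed.

Lemma dotDl u v w : dot (u + v) w = dot u w + dot v w.
Proof. by rewrite -big_split; apply: eq_bigr => i _; rewrite mxE mulrDl. Qed.

Lemma dotDr u v w : dot w (u + v) = dot w u + dot w v.
Proof. by rewrite dotC dotDl !(dotC w). Qed.

Lemma dotZl k u v : dot (k *: u) v = k * dot u v.
Proof. by rewrite mulr_sumr; apply: eq_bigr => i _; rewrite mxE mulrA. Qed.

Lemma dotZr k u v : dot u (k *: v) = k * dot u v.
Proof. by rewrite dotC dotZl dotC. Qed.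

Lemma dotNl u v : dot (- u) v = - dot u v.
Proof. by rewrite -scaleN1r dotZl mulN1r. Qed.

Lemma dotNr u v : dot u (- v) = - dot u v.
Proof. by rewrite dotC dotNl dotC. Qed.

Lemma dot_ge0 u : 0 <= dot u u.
Proof. by apply: sumr_ge0 => i _; rewrite -expr2 sqr_ge0. Qed.

Lemma dot_eq0 u : (dot u u == 0) = (u == 0).
Proof.
apply/idP/eqP => [|->]; last by rewrite /dot big1// => i _; rewrite mxE mul0r.
rewrite psumr_eq0 => [/allP h|i _]; last by rewrite -expr2 sqr_ge0.
apply/rowP => i; rewrite mxE; apply/eqP.
by have := h i (mem_index_enum _); rewrite -expr2 sqrf_eq0.
Qed.

Lemma enorm_dot u : enorm u = Num.sqrt (dot u u).
Proof. by rewrite /enorm; congr Num.sqrt; apply: eq_bigr => i _; rewrite expr2. Qed.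

Lemma enorm_sqr u : enorm u ^+ 2 = dot u u.
Proof. by rewrite enorm_dot sqr_sqrtr// dot_ge0. Qed.

Lemma enorm_lt1 u : (enorm u < 1) = (dot u u < 1).
Proof. by rewrite enorm_dot -[X in _ < X]sqrtr1 ltr_sqrt. Qed.

Lemma dot_mulmx_orthogonal (Q : 'M[R]_n) u v : Q *m Q^T = 1%:M ->
  dot (u *m Q) (v *m Q) = dot u v.
Proof.
move=> QQ; have := dotE (u *m Q) (v *m Q).
rewrite trmx_mul mulmxA -(mulmxA u) QQ mulmx1 dotE => /(congr1 (fun A : 'M[R]_1 => A 0 0)).
by rewrite !mxE eqxx !mulr1n.
Qed.

End dot_product.

Section linear_algebra.
Context {R : realType}.

(** Conjugation by a shear turns a block triangular matrix of determinant det (1 + u v) into one of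
    determinant 1 + v u. *)
Lemma det_add1_mul n (u : 'cV[R]_n) (v : 'rV[R]_n) :
  \det (1%:M + u *m v) = 1 + (v *m u) 0 0.
Proof.
have E : block_mx 1%:M 0 v 1%:M *m block_mx (1%:M + u *m v) u 0 1%:M *m
    block_mx 1%:M 0 (- v) 1%:M = block_mx 1%:M u 0 (1%:M + v *m u) :> 'M[R]_(n + 1).
  rewrite !mulmx_block !mulmx0 !mul0mx !mulmx1 !mul1mx !addr0 !add0r.
  congr block_mx; first by rewrite mulmxN addrK.
    rewrite mulmxDr mulmx1 mulmxN mulmxDl mul1mx mulmxA.
    by rewrite [X in _ - X]addrC subrr.
  by rewrite addrC.
have := congr1 determinant E.
rewrite !det_mulmx !det_lblock !det_ublock !det1 !mul1r !mulr1 => ->.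
by rewrite det_mx11 !mxE.
Qed.

Lemma det_orthogonal n (Q : 'M[R]_n) : Q *m Q^T = 1%:M -> `|\det Q| = 1.
Proof.
move=> /(congr1 determinant); rewrite det_mulmx det_tr det1 -expr2 => /eqP.
by rewrite sqrf_eq1 => /orP[/eqP ->|/eqP ->]; rewrite ?normrN normr1.
Qed.

(* Q is the Householder reflection exchanging v and |v| e_0. *)
Lemma orthogonal_to_axis n (v : 'rV[R]_n.+1) : exists Q : 'M[R]_n.+1,
  Q *m Q^T = 1%:M /\ v *m Q = enorm v *: delta_mx 0 0.
Proof.
have [w wE] : exists w, w = v - enorm v *: delta_mx 0 0 by exists (v - enorm v *: delta_mx 0 0).
have [w0|w0] := eqVneq w 0.
  exists 1%:M; rewrite trmx1 !mulmx1; split=> //.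
  by apply/eqP; rewrite -subr_eq0 -wE w0.
have dw0 : dot w w != 0 by rewrite dot_eq0.
pose k := 2 / dot w w.
have symQ : (1%:M - k *: (w^T *m w))^T = 1%:M - k *: (w^T *m w).
  by rewrite linearB /= linearZ /= trmx1 trmx_mul trmxK.
have dd : dot (delta_mx 0 0 : 'rV[R]_n.+1) (delta_mx 0 0) = 1.
  rewrite /dot (bigD1 ord0)//= !mxE eqxx mulr1 big1 ?addr0// => i /negbTE i0.
  by rewrite !mxE i0 mulr0.
(* This holds because [v] and [enorm v *: delta_mx 0 0] have the same norm; it makes the reflection
   in the hyperplane orthogonal to [w] carry one to the other. *)
have vw : 2 * dot v w = dot w w.
  rewrite wE !(dotDl, dotDr, dotNl, dotNr, dotZl, dotZr) dd -(enorm_sqr v).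
  by rewrite (dotC (delta_mx 0 0)); ring.
exists (1%:M - k *: (w^T *m w)); split.
  rewrite symQ mulmxBl mul1mx mulmxBr mulmx1.
  rewrite -scalemxAl -scalemxAr mulmxA -(mulmxA w^T) dotE.
  rewrite mul_mx_scalar -scalemxAl !scalerA.
  rewrite (_ : k * (k * dot w w) = 2 * k); last by rewrite /k; field.
  move: (w^T *m w) => M; apply/matrixP => i j; rewrite !mxE; ring.
rewrite mulmxBr mulmx1 -scalemxAr mulmxA dotE mul_scalar_mx scalerA.
rewrite (_ : k * dot v w = 1) ?scale1r; first by rewrite wE opprB addrC subrK.
by rewrite /k mulrAC vw divff.
Qed.

Lemma edgemx_affine D (L : 'M[R]_D) (c : 'rV[R]_D) (z : D.+1.-tuple 'rV[R]_D) :
  edgemx (map_tuple (fun u => u *m L + c) z) = edgemx z *m L.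
Proof.
apply/matrixP => i j; rewrite !mxE !tnth_map !mxE.
rewrite opprD addrACA subrr addr0 -sumrB; apply: eq_bigr => k _.
by rewrite !mxE mulrBl.
Qed.

Section ellipsoid.
Variables (D : nat) (a : 'rV[R]_D) (b : R).

(** The length of the normal (a, -1) of the graph of z |-> a.z + b; thus |b| / r is the distance
    from the origin to that hyperplane. *)
Definition ell_r : R := Num.sqrt (1 + dot a a).
Local Notation r := ell_r.

(** The constant is chosen to give eigenvalue 1 / r along [a]: since |a|^2 = r^2 - 1, one has 1 -
    |a|^2 / (r (r + 1)) = 1 / r. On the orthogonal complement the eigenvalue is 1. *)
Definition ell_mx : 'M[R]_D := 1%:M - (r * (r + 1))^-1 *: (a^T *m a).

Lemma ell_r_gt0 : 0 < r.
Proof. by rewrite sqrtr_gt0 ltr_pwDl// dot_ge0. Qed.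

Lemma ell_r_sqr : r ^+ 2 = 1 + dot a a.
Proof. by rewrite sqr_sqrtr// addr_ge0// dot_ge0. Qed.

Lemma det_ell_mx : \det ell_mx = r^-1.
Proof.
have r0 := ell_r_gt0; have r1 : r + 1 != 0 by rewrite gt_eqF// ltr_wpDr.
rewrite /ell_mx -scaleNr scalemxAl det_add1_mul -scalemxAr dotE !mxE eqxx mulr1n.
rewrite (_ : dot a a = r ^+ 2 - 1); last by rewrite ell_r_sqr addrC addKr.
by field; rewrite r1 gt_eqF.
Qed.

(* ell_mx is the inverse square root of 1 + a^T a; completing the square turns
   the section of the ball by the graph of z |-> a.z + b into a ball. *)
Lemma ell_mx_dot (s : R) (y : 'rV[R]_D) :
  let z := s *: (y *m ell_mx) - (b / r ^+ 2) *: a in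
  dot z z + (dot z a + b) ^+ 2 = s ^+ 2 * dot y y + b ^+ 2 / r ^+ 2.
Proof.
have r0 := ell_r_gt0; have r1 : r + 1 != 0 by rewrite gt_eqF// ltr_wpDr.
have -> : y *m ell_mx = y - ((r * (r + 1))^-1 * dot y a) *: a.
  by rewrite mulmxBr mulmx1 -scalemxAr mulmxA dotE mul_scalar_mx scalerA.
move=> z; rewrite /z !(dotDl, dotDr, dotNl, dotNr, dotZl, dotZr) (dotC a y).
rewrite (_ : dot a a = r ^+ 2 - 1); last by rewrite ell_r_sqr addrC addKr.
by field; rewrite r1 gt_eqF.
Qed.

(** The left side is the squared distance from the origin to the graph. With s = 1 the identity
    [ell_mx_dot] reaches every [z], and its other term is nonnegative. *)
Lemma ell_lower (z : 'rV[R]_D) :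
  b ^+ 2 / r ^+ 2 <= dot z z + (dot z a + b) ^+ 2.
Proof.
have uL : ell_mx \in unitmx by rewrite unitmxE det_ell_mx unitfE invr_eq0 gt_eqF// ell_r_gt0.
pose y := (z + (b / r ^+ 2) *: a) *m invmx ell_mx.
have := ell_mx_dot 1 y; rewrite /y mulmxKV// scale1r addrK expr1n mul1r => ->.
by rewrite lerDr dot_ge0.
Qed.

End ellipsoid.
End linear_algebra.

Section ball_volume.
Context {R : realType}.
Local Notation lam D := (@lebesgue_rV R D).
Local Notation mu := (@lebesgue_measure R).
Local Open Scope ereal_scope.

Lemma measurable_dot d (T : measurableType d) n (f g : T -> 'rV[R]_n) :
  measurable_fun setT f -> measurable_fun setT g ->
  measurable_fun setT (fun x => dot (f x) (g x)).
Proof.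
move=> /measurable_fun_rVP mf /measurable_fun_rVP mg.
by apply: measurable_sum => i; exact: measurable_funM.
Qed.

Definition inball n (v : 'rV[R]_n) : bool := (dot v v < 1)%R.

Lemma measurable_inball d (T : measurableType d) n (f : T -> 'rV[R]_n) :
  measurable_fun setT f -> measurable_fun setT (fun x => inball (f x)).
Proof. by move=> mf; apply: measurable_fun_ltr => //; exact: measurable_dot. Qed.

Definition ball_vol n : R := fine (lam n (unit_ball n)).
Local Notation kappa := ball_vol.

Lemma integral_Iv d (T : measurableType d) (m : {measure set T -> \bar R})
    (A : set T) (b : T -> bool) :
  measurable A -> (forall x, A x <-> b x) -> \int[m]_x Iv (b x) = m A.
Proof.
move=> mA Ab; rewrite -[in RHS](setIT A) -integral_indic//.
apply: eq_integral => x _; rewrite indicE /Iv; congr (_%:R%:E).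
by congr nat_of_bool; apply/idP/idP => [/Ab|]; rewrite inE// => /Ab.
Qed.

Lemma integral_inball n : \int[lam n]_v Iv (inball v) = (kappa n)%:E.
Proof.
rewrite (@integral_Iv _ _ _ (unit_ball n)); last 2 first.
- exact: measurable_unit_ball.
- by move=> v; rewrite /inball -enorm_lt1.
by rewrite fineK// ge0_fin_numE// unit_ball_lty.
Qed.

Lemma ball_vol_gt0 n : (0 < kappa n)%R.
Proof. by apply: fine_gt0; rewrite unit_ball_gt0 unit_ball_lty. Qed.

Lemma ball_vol0 : kappa 0 = 1%R.
Proof.
have : (kappa 0)%:E = 1%:E.
  rewrite -integral_inball integral_lebesgue_rV0.
    by rewrite /inball /dot big_ord0 /Iv ltr01.
  by apply: measurable_Iv; apply: measurable_inball; exact: measurable_id.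
by case.
Qed.

Lemma integral_scale n (s : R) (f : 'rV[R]_n -> \bar R) :
    s != 0%R -> measurable_fun setT f -> (forall v, 0 <= f v) ->
  (`|s| ^+ n)%:E * \int[lam n]_v f (s *: v)%R = \int[lam n]_v f v.
Proof.
move=> s0 mf f0.
have uA : (s%:M : 'M[R]_n) \in unitmx by rewrite unitmxE det_scalar unitfE expf_neq0.
rewrite -(change_of_variables_unitmx uA mf f0) det_scalar normrX.
by congr (_ * _); apply: eq_integral => v _; rewrite mul_mx_scalar.
Qed.

Lemma dot_rV_cons n (x y : R) (u v : 'rV[R]_n) :
  dot (rV_cons (x, u)) (rV_cons (y, v)) = (x * y + dot u v)%R.
Proof.
rewrite /dot big_ord_recl !rV_cons0 /=; congr (_ + _)%R.
by apply: eq_bigr => i _; rewrite !rV_cons_lift.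
Qed.

(** Up to the factor kappa_k, the volume of the section at height h of the unit ball of R^(k+1). *)
Definition slice_wt (k : nat) (h : R) : R :=
  ((h ^+ 2 < 1)%R%:R * Num.sqrt (1 - h ^+ 2) ^+ k)%R.

(** The ratio kappa_(k+1) / kappa_k of consecutive ball volumes, by [ball_volS]. Kingman's formula
    uses it again at a larger index, where it comes from a power of the radius of a section. *)
Definition slice_int (k : nat) : R := fine (\int[mu]_h (slice_wt k h)%:E).
Local Notation w := slice_int.

Lemma slice_wt_ge0 k h : (0 <= slice_wt k h)%R.
Proof. by rewrite mulr_ge0// exprn_ge0// sqrtr_ge0. Qed.

Lemma slice_wt_le k (h : R) :
  (slice_wt k h <= ((-1 <= h) && (h <= 1))%:R)%R.
Proof.
rewrite /slice_wt; case: ltP => h1; last by rewrite mul0r ler0n.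
have -> : ((-1 <= h) && (h <= 1))%R by apply/andP; split; nra.
rewrite mul1r exprn_ile1 ?sqrtr_ge0// -[leRHS]sqrtr1 ler_sqrt//.
by rewrite lerBlDr lerDl sqr_ge0.
Qed.

Lemma measurable_slice_wt k : measurable_fun setT (slice_wt k : measurableTypeR R -> R).
Proof.
apply: measurable_funM.
  rewrite (_ : (fun x => _) = fun x : measurableTypeR R => if (x ^+ 2 < 1)%R then 1%R else 0%R).
    by apply: measurable_fun_ifT => //; exact: measurable_fun_ltr.
  by apply/funext => x; case: ifP.
apply: measurable_funX; apply: (measurableT_comp (f := @Num.sqrt R)).
  by apply: continuous_measurable_fun; exact: sqrt_continuous.
by apply: measurable_funB => //; exact: exprn_measurable.
Qed.

(** The weight is at most the indicator of [-1, 1], so [fine] discards nothing. *)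
Lemma slice_intE k : \int[mu]_h (slice_wt k h)%:E = (w k)%:E.
Proof.
have wt0 h : 0 <= (slice_wt k h)%:E by rewrite lee_fin slice_wt_ge0.
rewrite fineK// ge0_fin_numE; last by apply: integral_ge0 => h _; exact: wt0.
apply: (@le_lt_trans _ _ (\int[mu]_h Iv ((-1 <= h) && (h <= 1))%R)).
  apply: ge0_le_integral => //.
  - by apply/measurable_EFinP; exact: measurable_slice_wt.
  - apply: measurable_Iv; apply: measurable_and; apply: measurable_fun_ler => //.
  - by move=> h _; rewrite lee_fin slice_wt_le.
have -> : \int[mu]_h Iv ((-1 <= h) && (h <= 1))%R = mu `[(-1)%R, 1%R]%classic.
  by apply: integral_Iv => // h; rewrite /= in_itv.
by rewrite lebesgue_measure_itv/=; case: ifP => _; rewrite -?EFinB ltry.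
Qed.

(** The section at height h of the first coordinate is a ball of radius sqrt (1 - h^2). *)
Lemma ball_volS n : kappa n.+1 = (kappa n * w n)%R.
Proof.
have mI k : measurable_fun setT (fun v : 'rV[R]_k => Iv (inball v) : \bar R).
  by apply: measurable_Iv; apply: measurable_inball; exact: measurable_id.
suff : (kappa n.+1)%:E = (kappa n)%:E * (w n)%:E by case.
rewrite -integral_inball integral_lebesgue_rVS//; last by move=> v; exact: Iv_ge0.
rewrite -slice_intE -ge0_integralZT//; last 3 first.
- exact: ltW (ball_vol_gt0 n).
- by apply/measurable_EFinP; exact: measurable_slice_wt.
- by move=> h; rewrite lee_fin slice_wt_ge0.
apply: eq_integral => h _; rewrite /inball.
under eq_integral do rewrite dot_rV_cons -expr2.
rewrite /slice_wt; case: (ltP (h ^+ 2)%R 1%R) => h1; last first.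
  rewrite mul0r mule0; apply: integral0_eq => v _; rewrite /Iv ltNge.
  by rewrite (le_trans h1)//= lerDl dot_ge0.
set s := Num.sqrt (1 - h ^+ 2)%R.
have s0 : (0 < s)%R by rewrite sqrtr_gt0 subr_gt0.
have s2 : (s ^+ 2 = 1 - h ^+ 2)%R by rewrite sqr_sqrtr// subr_ge0 ltW.
rewrite -(@integral_scale _ s) ?gt_eqF//; last 2 first.
- apply: measurable_Iv; apply: measurable_fun_ltr => //.
  by apply: measurable_funD => //; apply: measurable_dot; exact: measurable_id.
- by move=> v; exact: Iv_ge0.
rewrite mul1r muleC gtr0_norm// -integral_inball; congr (_ * _).
apply: eq_integral => v _; congr (Iv _); rewrite /inball dotZl dotZr mulrA -expr2 s2.
by rewrite -[RHS](ltr_pM2l (x := 1 - h ^+ 2)%R) ?subr_gt0// mulr1 -ltrBrDl.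
Qed.

End ball_volume.

(** * Integrating a power of the normal length over all slopes *)

Section cone_integral.
Context {R : realType}.
Local Notation lam D := (@lebesgue_rV R D).
Local Notation mu := (@lebesgue_measure R).
Local Open Scope ereal_scope.

Lemma integral_itv_FTC (f F : R -> R) (a b : R) : (a < b)%R ->
    continuous f -> (forall x : R, is_derive x (1%R : R) F (f x)) ->
  \int[mu]_(x in `[a, b]) (f x)%:E = (F b - F a)%:E.
Proof.
move=> ab cf dF.
have cF (x : R) : {for x, continuous F}.
  by apply: differentiable_continuous; apply/derivable1_diffP; have [] := dF x.
rewrite (@continuous_FTC2 _ f F)//.
- exact: continuous_subspaceT.
- split.
  + by move=> x _; have [] := dF x.
  + by apply: cvg_at_right_filter; exact: cF.
  + by apply: cvg_at_left_filter; exact: cF.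
- by move=> x _; rewrite derive1E; exact: derive_val.
Qed.

Lemma integral_exprn01 D : \int[mu]_(s in `[0%R, 1%R]) (s ^+ D)%:E = (D.+1%:R^-1)%:E.
Proof.
pose F : R -> R := (D.+1%:R^-1 \*: ((id : R -> R) ^+ D.+1))%R.
have dF (s : R) : is_derive s (1%R : R) F (s ^+ D)%R.
  apply: is_derive_eq.
  by rewrite /GRing.scale /= mulr1 mulrA mulVf ?mul1r// pnatr_eq0.
rewrite (integral_itv_FTC ltr01 (@exprn_continuous R D) dF) /F !fctE /GRing.scale /=.
by rewrite expr1n expr0n/= scaler0 subr0 [X in X%:E]mulr1.
Qed.

Lemma integral_set1_Iv (c : R) : \int[mu]_s Iv (s == c) = 0.
Proof.
transitivity (mu [set c]); last exact: lebesgue_measure_set1.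
by apply: integral_Iv => [|s]; [exact: measurable_set1|split => [->|/eqP]].
Qed.

Lemma integral_normX D :
  \int[mu]_s (`|s| ^+ D * (s ^+ 2 < 1)%R%:R)%R%:E = (2 / D.+1%:R)%R%:E.
Proof.
pose g (s : measurableTypeR R) : R := (((0 < s) && (s < 1))%:R * s ^+ D)%R.
have g0 s : 0 <= (g s)%:E.
  rewrite lee_fin /g; have [/andP[s0 _]|_] := boolP (0 < s < 1)%R; last by rewrite mul0r.
  by rewrite mul1r exprn_ge0// ltW.
have mg : measurable_fun setT (fun s => (g s)%:E).
  apply/measurable_EFinP; apply: measurable_funM => //.
  have mb : measurable_fun setT (fun s : measurableTypeR R => (0 < s) && (s < 1))%R.
    by apply: measurable_and; exact: measurable_fun_ltr.
  by have /measurable_EFinP := @measurable_Iv R _ _ _ mb.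
have ig : \int[mu]_s (g s)%:E = (D.+1%:R^-1)%:E.
  rewrite -integral_exprn01 integral_itv_bndoo; last first.
    by apply/measurable_EFinP; exact: exprn_measurable.
  rewrite [RHS]integral_mkcond; apply: eq_integral => s _.
  rewrite patchE /g; have [s01|s01] := boolP (0 < s < 1)%R.
    by rewrite mem_set ?mul1r//= in_itv.
  by rewrite memNset ?mul0r//= in_itv /= => h; rewrite h in s01.
have mgN : measurable_fun setT (fun s : measurableTypeR R => (g (- s)%R)%:E).
  apply: (measurableT_comp mg); exact: oppr_measurable.
have igN : \int[mu]_s (g (- s)%R)%:E = (D.+1%:R^-1)%:E.
  have N1 : (-1 != 0 :> R)%R by rewrite oppr_eq0 oner_eq0.
  rewrite -ig -(integral_lebesgue_affine 0 N1 mg g0).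
  by rewrite normrN1 mul1e; apply: eq_integral => s _; rewrite addr0 mulN1r.
transitivity (\int[mu]_s ((g s)%:E + (g (- s)%R)%:E)); last first.
  by rewrite ge0_integralD// ig igN -EFinD; congr EFin; ring.
(* The point 0 has to be removed: for D = 0 the left side is 0^0 = 1 there, while both halves
   vanish. *)
apply: (@eq_integral_null R _ (measurableTypeR R) mu (fun s => s == 0)%R).
- exact: measurable_fun_eqr.
- exact: integral_set1_Iv.
- apply/measurable_EFinP; apply: measurable_funM.
    by apply: measurable_funX; exact: normr_measurable.
  have mb : measurable_fun setT (fun s : measurableTypeR R => s ^+ 2 < 1)%R.
    exact: measurable_fun_ltr.
  by have /measurable_EFinP := @measurable_Iv R _ _ _ mb.
- exact: emeasurable_funD.
- by move=> s; rewrite lee_fin mulr_ge0// exprn_ge0.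
- by move=> s; rewrite adde_ge0.
- move=> s s0; rewrite -EFinD /g; congr EFin.
  have [sp|sn] := ltP 0%R s.
    have -> : (0 < - s)%R = false by apply/negbTE; rewrite -leNgt; lra.
    rewrite gtr0_norm// mul0r addr0 mulrC; congr (_%:R * _)%R.
    congr nat_of_bool; apply/idP/idP => h; nra.
  have sn' : (s < 0)%R by rewrite lt_neqAle s0.
  have -> : (0 < - s)%R by lra.
  rewrite ltr0_norm// mul0r add0r mulrC; congr (_%:R * _)%R.
  congr nat_of_bool; apply/idP/idP => h; nra.
Qed.

Lemma measurable_ell_r d (T : measurableType d) D (f : T -> 'rV[R]_D) :
  measurable_fun setT f -> measurable_fun setT (fun x => ell_r (f x)).
Proof.
move=> mf; apply: (measurableT_comp (f := @Num.sqrt R)).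
  by apply: continuous_measurable_fun; exact: sqrt_continuous.
by apply: measurable_funD => //; exact: measurable_dot.
Qed.

Lemma measurable_ell_rV D n :
  measurable_fun setT (fun a : 'rV[R]_D => (ell_r a ^- n : R)).
Proof.
rewrite (_ : (fun a => _) = (fun a : 'rV[R]_D => (ell_r a `^ (-1)) ^+ n)%R).
  apply: measurable_funX; apply: (measurableT_comp (measurable_powR _)).
  by apply: measurable_ell_r; exact: measurable_id.
by apply/funext => a; rewrite powR_inv1 ?exprVn// ltW// ell_r_gt0.
Qed.

(* Radial projection of the ball of R^(D+1) onto the hyperplane s = 1. *)
Lemma integral_ell_r D :
  \int[lam D]_a (ell_r a ^- D.+1)%:E = (ball_vol D.+1 * D.+1%:R / 2)%:E.
Proof.
suff : (2 / D.+1%:R)%:E * \int[lam D]_a (ell_r a ^- D.+1)%:E = (ball_vol D.+1)%:E :> \bar R.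
  move=> /(congr1 (fun x => (D.+1%:R / 2)%:E * x)).
  have D0 : (D.+1%:R != 0 :> R)%R by rewrite pnatr_eq0.
  rewrite muleA -!EFinM (_ : _ * (2 / _) = 1)%R; last by field.
  by rewrite mul1e => ->; congr EFin; ring.
have rV0 (a : 'rV[R]_D) : 0 <= (ell_r a ^- D.+1)%:E.
  by rewrite lee_fin invr_ge0 exprn_ge0// ltW// ell_r_gt0.
rewrite -ge0_integralZT//; last by apply/measurable_EFinP; exact: measurable_ell_rV.
(* In the coordinates (s, s a) on the ball of R^(D+1) the slice at height s contributes the Jacobian
   |s|^D; the slice s = 0 is dropped as a null set. *)
pose G (p : measurableTypeR R * 'rV[R]_D) : \bar R :=
  (`|p.1| ^+ D)%:E * Iv (p.1 ^+ 2 + dot (p.1 *: p.2) (p.1 *: p.2) < 1)%R.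
have mG : measurable_fun setT G.
  apply: emeasurable_funM.
    apply/measurable_EFinP; apply: measurable_funX.
    exact: (measurableT_comp (@normr_measurable R setT) measurable_fst).
  apply: measurable_Iv; apply: measurable_fun_ltr => //.
  apply: measurable_funD; first by apply: measurable_funX; exact: measurable_fst.
  have mp : measurable_fun setT (fun p : measurableTypeR R * 'rV[R]_D => p.1 *: p.2).
    apply/measurable_mxP; apply: measurable_scalemx; first exact: measurable_fst.
    by apply/measurable_mxP; exact: measurable_snd.
  exact: measurable_dot.
have G0 p : 0 <= G p by rewrite mule_ge0 ?Iv_ge0// lee_fin exprn_ge0.
have mI : measurable_fun setT (fun v : 'rV[R]_D.+1 => Iv (inball v) : \bar R).
  by apply: measurable_Iv; apply: measurable_inball; exact: measurable_id.
rewrite -integral_inball integral_lebesgue_rVS//; last by move=> v; exact: Iv_ge0.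
transitivity (\int[mu]_s \int[lam D]_a G (s, a)); last first.
  apply: (@eq_integral_null R _ (measurableTypeR R) mu (fun s => s == 0)%R).
  - exact: measurable_fun_eqr.
  - exact: integral_set1_Iv.
  - exact: (measurable_fun_fubini_tonelli_F G mG G0).
  - apply: (measurable_fun_fubini_tonelli_F
      (fun p : measurableTypeR R * 'rV[R]_D => Iv (inball (rV_cons p)) : \bar R)).
      by apply: (measurableT_comp mI); exact: measurable_rV_cons.
    by move=> p; exact: Iv_ge0.
  - by move=> s; exact: integral_ge0.
  - by move=> s; apply: integral_ge0 => a _; exact: Iv_ge0.
  - move=> s s0; have := mI => _.
    have mJ : measurable_fun setT
        (fun v : 'rV[R]_D => Iv (inball (rV_cons (s, v))) : \bar R).
      by apply: (measurableT_comp mI); exact: measurable_rV_consr.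
    rewrite -(@integral_scale R D s _ s0 mJ); last by move=> v; exact: Iv_ge0.
    rewrite -ge0_integralZT.
    + apply: eq_integral => a _; rewrite /G /=; congr (_ * Iv _).
      by rewrite /inball dot_rV_cons expr2.
    + by rewrite exprn_ge0.
    + apply: (measurableT_comp mJ).
      apply/measurable_mxP; apply: measurable_scalemx => //.
      by apply/measurable_mxP; exact: measurable_id.
    + by move=> v; exact: Iv_ge0.
rewrite (fubini_tonelli G mG G0).
apply: eq_integral => a _.
have r0 := @ell_r_gt0 R D a.
rewrite -integral_normX muleC -ge0_integralZT; last 3 first.
- by rewrite invr_ge0 exprn_ge0// ltW.
- apply/measurable_EFinP; apply: measurable_funM.
    by apply: measurable_funX; exact: normr_measurable.
  have mb : measurable_fun setT (fun s : measurableTypeR R => s ^+ 2 < 1)%R.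
    exact: measurable_fun_ltr.
  by have /measurable_EFinP := @measurable_Iv R _ _ _ mb.
- by move=> s; rewrite lee_fin mulr_ge0// exprn_ge0.
have mGa : measurable_fun setT (fun s : measurableTypeR R => G (s, a)).
  exact: (measurableT_comp mG (pair2_measurable a)).
(* At fixed [a] the ball is s^2 r^2 < 1. Rescaling s by 1 / r leaves the integral 2 / (D + 1) and
   the factor r^-(D+1), with D powers from the Jacobian and one from ds. *)
rewrite -(@integral_lebesgue_affine R (ell_r a)^-1 0 (fun s => G (s, a))) ?invr_eq0 ?gt_eqF//.
rewrite gtr0_norm ?invr_gt0// -ge0_integralZT; last 3 first.
- by rewrite invr_ge0 ltW.
- exact: (measurableT_comp mGa (measurable_affine _ _)).
- by move=> s; exact: G0.
apply: eq_integral => s _; rewrite /G /= addr0 /Iv -!EFinM; congr EFin.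
rewrite dotZl dotZr (_ : dot a a = ell_r a ^+ 2 - 1)%R; last first.
  by rewrite ell_r_sqr addrC addKr.
set r := ell_r a in r0 *.
rewrite (_ : (_ + _ = s ^+ 2)%R); last by field; rewrite gt_eqF.
rewrite normrM normfV (gtr0_norm r0) exprMn exprVn exprS invfM.
by rewrite -!mulrA; congr (_ * (_ * _))%R; rewrite mulrC.
Qed.

End cone_integral.

(** * Kingman's formula *)

Section kingman.
Context {R : realType}.
Local Notation lam D := (@lebesgue_rV R D).
Local Notation mu := (@lebesgue_measure R).

Lemma integral_tuple_prod d (T : measurableType d)
    (m : {sigma_finite_measure set T -> \bar R}) (f : T -> \bar R) n :
    measurable_fun setT f -> (forall x, 0 <= f x)%E ->
  (\int[tuple_measure m n]_t \prod_(i < n) f (tnth t i) =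
   (\int[m]_x f x) ^+ n)%E.
Proof.
move=> mf f0.
have mP k : measurable_fun setT (fun t : k.-tuple T => \prod_(i < k) f (tnth t i))%E.
  elim: (index_enum _) => [|i s IH].
    by under eq_fun do rewrite big_nil; exact: measurable_cst.
  under eq_fun do rewrite big_cons; apply: emeasurable_funM => //.
  by apply: (measurableT_comp mf); exact: measurable_tnth.
have P0 k (t : k.-tuple T) : (0 <= \prod_(i < k) f (tnth t i))%E.
  by apply: prode_ge0 => i _.
elim: n => [|n IH].
  by rewrite (integral_tuple0 _ (mP 0%N)) big_ord0.
rewrite (integral_tupleS _ (mP _) (P0 _)) expeS -ge0_integralZr//; last first.
  by rewrite -IH; apply: integral_ge0 => t _; exact: P0.
apply: eq_integral => x _; rewrite -IH -ge0_integralZl//; last exact: mP.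
apply: eq_integral => t _; rewrite big_ord_recl tcons0; congr (_ * _)%E.
by apply: eq_bigr => i _; rewrite tconsS.
Qed.

(** Up to the factor D!, the integrated volume of the simplex spanned by D + 1 points of the ball.
    It stays an extended real; its finiteness is drawn from [kingman]. *)
Definition simplex_int D : \bar R :=
  (\int[tuple_measure (lam D) D.+1]_z
     (`|\det (edgemx z)|%:E * Iv [forall i, inball (tnth z i)]))%E.

Lemma measurable_abs_det_edgemx d (T : measurableType d) D (f : T -> D.+1.-tuple 'rV[R]_D) :
  measurable_fun setT f -> measurable_fun setT (fun x => `|\det (edgemx (f x))|%:E).
Proof.
move=> mf; apply/measurable_EFinP; apply: (measurableT_comp (@normr_measurable R setT)).
by apply: measurable_det; exact: measurable_edgemx.
Qed.

Lemma measurable_all_inball d (T : measurableType d) D n (f : T -> n.-tuple 'rV[R]_D) :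
  measurable_fun setT f ->
  measurable_fun setT (fun x => [forall i, inball (tnth (f x) i)]).
Proof.
move=> mf; apply: measurable_forall => i; apply: measurable_inball.
exact: (measurableT_comp (measurable_tnth i)).
Qed.

(* The lifts of the points z_i to the graph of z |-> a.z + b lie in the ball. *)
Definition in_graph D (z : D.+1.-tuple 'rV[R]_D) (b : R) (a : 'rV[R]_D) : bool :=
  [forall i, dot (tnth z i) (tnth z i) + (dot (tnth z i) a + b) ^+ 2 < 1].

(** Each of the D + 1 points undergoes the affine map that turns the section into a ball, with
    Jacobian s^D / r; the edge determinant contributes one more such factor, hence the exponent D +
    2. *)
Lemma integral_graph D (b : R) (a : 'rV[R]_D) :
  (\int[tuple_measure (lam D) D.+1]_z
     (`|\det (edgemx z)|%:E * Iv (in_graph z b a)) =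
   (((b ^+ 2 < ell_r a ^+ 2)%R%:R *
    (Num.sqrt (1 - b ^+ 2 / ell_r a ^+ 2) ^+ D / ell_r a) ^+ D.+2)%R)%:E *
   simplex_int D)%E.
Proof.
set r := ell_r a; have r0 : 0 < r := ell_r_gt0 a.
have [br|br] := ltP (b ^+ 2) (r ^+ 2); last first.
  (* For |b| >= r the hyperplane is at distance at least 1 from the origin and misses the ball. *)
  rewrite mul0r mul0e; apply: integral0_eq => z _.
  rewrite (_ : in_graph z b a = false) ?mule0//; apply/negbTE.
  rewrite negb_forall; apply/existsP; exists ord0; rewrite -leNgt.
  by apply: le_trans (ell_lower a b _); rewrite ler_pdivlMr ?exprn_gt0// mul1r.
rewrite mul1r.
have s2_gt0 : 0 < 1 - b ^+ 2 / r ^+ 2.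
  by rewrite subr_gt0 ltr_pdivrMr ?exprn_gt0// mul1r.
set s := Num.sqrt _; have s0 : 0 < s by rewrite sqrtr_gt0.
have s2 : s ^+ 2 = 1 - b ^+ 2 / r ^+ 2 by rewrite sqr_sqrtr// ltW.
pose L := s *: ell_mx a; pose c := - (b / r ^+ 2) *: a.
have detL : \det L = s ^+ D / r by rewrite detZ det_ell_mx.
have detL_gt0 : 0 < \det L by rewrite detL divr_gt0// exprn_gt0.
have uL : L \in unitmx by rewrite unitmxE unitfE gt_eqF.
pose phi (u : 'rV[R]_D) := u *m L + c.
have mphi : measurable_fun setT phi.
  exact: (measurableT_comp (measurable_fun_addr c) (measurable_fun_mulmxr L)).
have int_phi (f : 'rV[R]_D -> \bar R) : measurable_fun setT f -> (forall x, 0 <= f x)%E ->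
    (\int[lam D]_x ((\det L)%:E * f (phi x)) = \int[lam D]_y f y)%E.
  move=> mf f0.
  rewrite ge0_integralZT//; last by exact: (measurableT_comp mf mphi).
    rewrite -(integral_lebesgue_rV_translation c mf f0).
    have mfc := measurableT_comp mf (measurable_fun_addr c).
    rewrite -[in RHS](change_of_variables_unitmx uL mfc (fun=> f0 _)).
    by rewrite gtr0_norm.
  exact: ltW.
pose F (z : D.+1.-tuple 'rV[R]_D) : \bar R :=
  (`|\det (edgemx z)|%:E * Iv (in_graph z b a))%E.
have mF : measurable_fun setT F.
  apply: emeasurable_funM; first by apply: measurable_abs_det_edgemx; exact: measurable_id.
  apply: measurable_Iv; apply: measurable_forall => i.
  have mt : measurable_fun setT (fun z : D.+1.-tuple 'rV[R]_D => tnth z i) by exact: measurable_tnth.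
  apply: measurable_fun_ltr => //; apply: measurable_funD; first exact: measurable_dot.
  by apply: measurable_funX; apply: measurable_funD => //; exact: measurable_dot.
have F0 z : (0 <= F z)%E by rewrite mule_ge0 ?Iv_ge0.
have mdet : measurable_fun setT (fun _ : 'rV[R]_D => \det L) by [].
rewrite -[LHS](integral_tuple_map mphi mdet (fun=> ltW detL_gt0) int_phi mF F0).
rewrite /simplex_int -ge0_integralZT; last 3 first.
- by rewrite exprn_ge0// divr_ge0 ?exprn_ge0 ?ltW.
- apply: emeasurable_funM; first by apply: measurable_abs_det_edgemx; exact: measurable_id.
  by apply: measurable_Iv; apply: measurable_all_inball; exact: measurable_id.
- by move=> z; rewrite mule_ge0 ?Iv_ge0.
apply: eq_integral => z _; rewrite /F edgemx_affine det_mulmx normrM (gtr0_norm detL_gt0).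
rewrite prodr_const card_ord -detL ![in RHS]muleA ![in LHS]muleA -!EFinM.
congr (_%:E * Iv _)%E; first by rewrite [in RHS]exprSr; ring.
apply: eq_forallb => i; rewrite tnth_map /inball; set y := tnth z i.
have := ell_mx_dot a b s y; rewrite -/r /= => E.
have -> : phi y = s *: (y *m ell_mx a) - (b / r ^+ 2) *: a.
  by rewrite /phi /L /c scaleNr -scalemxAr.
rewrite E s2 -[RHS](ltr_pM2l s2_gt0) mulr1 -ltrBrDr.
by congr (_ < _).
Qed.

End kingman.

Section kingman_formula.
Context {R : realType}.
Local Notation lam D := (@lebesgue_rV R D).
Local Notation mu := (@lebesgue_measure R).

(** The heights are split into [t] over the first point and [s] over the others, since the change to
    intercept and slope is a translation in the former and a linear map in the latter. *)
Let in_lift D (z : D.+1.-tuple 'rV[R]_D) (t : R) (s : 'rV[R]_D) : bool :=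
  (dot (tnth z ord0) (tnth z ord0) + t ^+ 2 < 1) &&
  [forall j, dot (tnth z (lift ord0 j)) (tnth z (lift ord0 j)) + s ord0 j ^+ 2 < 1].

Lemma measurable_in_graph d (T : measurableType d) D (z : T -> D.+1.-tuple 'rV[R]_D)
    (b : T -> R) (a : T -> 'rV[R]_D) :
  measurable_fun setT z -> measurable_fun setT b -> measurable_fun setT a ->
  measurable_fun setT (fun x => in_graph (z x) (b x) (a x)).
Proof.
move=> mz mb ma; apply: measurable_forall => i.
have mt : measurable_fun setT (fun x => tnth (z x) i).
  exact: (measurableT_comp (measurable_tnth i)).
apply: measurable_fun_ltr => //; apply: measurable_funD; first exact: measurable_dot.
by apply: measurable_funX; apply: measurable_funD => //; exact: measurable_dot.
Qed.

Let measurable_in_lift d (T : measurableType d) D (z : T -> D.+1.-tuple 'rV[R]_D)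
    (t : T -> R) (s : T -> 'rV[R]_D) :
  measurable_fun setT z -> measurable_fun setT t -> measurable_fun setT s ->
  measurable_fun setT (fun x => in_lift (z x) (t x) (s x)).
Proof.
move=> mz mt ms.
have mzi i : measurable_fun setT (fun x => tnth (z x) i).
  exact: (measurableT_comp (measurable_tnth i)).
apply: measurable_and.
  apply: measurable_fun_ltr => //; apply: measurable_funD; first exact: measurable_dot.
  exact: measurable_funX.
apply: measurable_forall => i.
apply: measurable_fun_ltr => //; apply: measurable_funD; first exact: measurable_dot.
by apply: measurable_funX; move/measurable_fun_rVP : ms; exact.
Qed.

(* The points (z_i, t_i) of the graph of an affine function are parametrized by
   the value t_0 and the slope; the Jacobian is the determinant of the edges. *)
Lemma integral_lift_graph D (z : D.+1.-tuple 'rV[R]_D) : \det (edgemx z) != 0 ->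
  (\int[mu]_t \int[lam D]_s Iv (in_lift z t s) =
   `|\det (edgemx z)|%:E * \int[mu]_b \int[lam D]_a Iv (in_graph z b a))%E.
Proof.
move=> dz; set A := edgemx z.
have uA : A^T \in unitmx by rewrite unitmx_tr unitmxE unitfE.
have mg : measurable_fun setT (fun p : measurableTypeR R * 'rV[R]_D =>
    Iv (in_graph z p.1 p.2) : \bar R).
  by apply: measurable_Iv; exact: measurable_in_graph.
have g0 (p : measurableTypeR R * 'rV[R]_D) : (0 <= Iv (in_graph z p.1 p.2) :> \bar R)%E.
  exact: Iv_ge0.
rewrite (fubini_tonelli (fun p : measurableTypeR R * 'rV[R]_D =>
    Iv (in_graph z p.1 p.2)) mg g0) /=.
pose z0 := tnth z ord0.
have mdot : measurable_fun setT (fun p : measurableTypeR R * 'rV[R]_D =>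
    (p.1 - dot z0 p.2 : R)).
  by apply: measurable_funB; [exact: measurable_fst|exact: measurable_dot].
have mh : measurable_fun setT (fun p : measurableTypeR R * 'rV[R]_D =>
    Iv (in_graph z (p.1 - dot z0 p.2) p.2) : \bar R).
  by apply: measurable_Iv; exact: measurable_in_graph.
(* At a fixed slope the intercept b = t - a.z_0 is traded for the height [t] over z_0. *)
rewrite (_ : \int[lam D]_a _ = \int[lam D]_a \int[mu]_t Iv (in_graph z (t - dot z0 a)%R a))%E;
    last first.
  apply: eq_integral => a _.
  apply/esym/(integral_lebesgue_translation (- dot z0 a)%R
    (f := fun b => Iv (in_graph z b a))) => [|b]; last exact: Iv_ge0.
  exact: (measurableT_comp mg (pair2_measurable a)).
rewrite -(fubini_tonelli (fun p : measurableTypeR R * 'rV[R]_D =>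
    Iv (in_graph z (p.1 - dot z0 p.2) p.2)) mh (fun=> Iv_ge0 _)) /=.
rewrite -ge0_integralZT; last 3 first.
- exact: normr_ge0.
- exact: (measurable_fun_fubini_tonelli_F _ mh (fun=> Iv_ge0 _)).
- by move=> t; apply: integral_ge0 => a _; exact: Iv_ge0.
apply: eq_integral => t _.
have ml : measurable_fun setT (fun s : 'rV[R]_D => Iv (in_lift z t s) : \bar R).
  by apply: measurable_Iv; apply: measurable_in_lift => //; exact: measurable_id.
have mlt : measurable_fun setT
    (fun s : 'rV[R]_D => Iv (in_lift z t (s + const_mx t)) : \bar R).
  exact: (measurableT_comp ml (measurable_fun_addr _)).
(* The other heights are s = a A^T + t, so the Jacobian of the passage from [a] to [s] is |det
   A|. *)
rewrite -(integral_lebesgue_rV_translation (const_mx t) ml (fun=> Iv_ge0 _)).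
rewrite -[LHS](change_of_variables_unitmx uA mlt (fun=> Iv_ge0 _)) det_tr.
congr (_ * _)%E; apply: eq_integral => a _; congr Iv.
have dotA j : (a *m A^T) ord0 j = dot (tnth z (lift ord0 j)) a - dot z0 a.
  rewrite mxE -sumrB; apply: eq_bigr => k _; rewrite !mxE mulrBr.
  by rewrite !(mulrC (a _ _)).
apply/idP/idP => [/andP[h0 /forallP h]|/forallP h].
  apply/forallP => i; case: (unliftP ord0 i) => [j|] ->.
    have := h j; rewrite mxE dotA mxE; congr (_ + _ ^+ 2 < _); ring.
  by move: h0; congr (_ + _ ^+ 2 < _); rewrite /z0; ring.
apply/andP; split.
  by have := h ord0; congr (_ + _ ^+ 2 < _); rewrite /z0; ring.
apply/forallP => j; have := h (lift ord0 j).
by rewrite mxE dotA mxE; congr (_ + _ ^+ 2 < _); ring.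
Qed.

(** At fixed z the conditions on the D + 1 heights are separate, so the inner integrals form a
    product of chord lengths; each factor integrates to kappa_(D+1) over its own z_i. *)
Lemma integral_in_lift D :
  (\int[tuple_measure (lam D) D.+1]_z \int[mu]_t \int[lam D]_s Iv (in_lift z t s) =
   (ball_vol D.+1 ^+ D.+1)%:E)%E.
Proof.
pose h (u : 'rV[R]_D) : \bar R := (\int[mu]_t Iv (dot u u + t ^+ 2 < 1)%R)%E.
have mp : measurable_fun setT (fun p : measurableTypeR R * 'rV[R]_D =>
    Iv (dot p.2 p.2 + p.1 ^+ 2 < 1)%R : \bar R).
  apply: measurable_Iv; apply: measurable_fun_ltr => //; apply: measurable_funD.
    by apply: measurable_dot; exact: measurable_snd.
  by apply: measurable_funX; exact: measurable_fst.
have mh : measurable_fun setT h.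
  exact: (measurable_fun_fubini_tonelli_G _ mp (fun=> Iv_ge0 _)).
have h0 u : (0 <= h u)%E by apply: integral_ge0 => t _; exact: Iv_ge0.
have hE : (\int[lam D]_u h u = (ball_vol D.+1)%:E)%E.
  rewrite -integral_inball integral_lebesgue_rVS_swap; last 2 first.
  - by apply: measurable_Iv; apply: measurable_inball; exact: measurable_id.
  - by move=> v; exact: Iv_ge0.
  apply: eq_integral => u _; apply: eq_integral => t _.
  by rewrite /inball dot_rV_cons addrC -expr2.
rewrite EFin_expe -hE -(integral_tuple_prod _ _ mh h0); apply: eq_integral => z _.
have mA u : measurable [set t : measurableTypeR R | dot u u + t ^+ 2 < 1 :> R].
  rewrite (_ : [set t | _] = setT `&`
      (fun t : measurableTypeR R => dot u u + t ^+ 2 < 1) @^-1` [set true]); last first.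
    by rewrite setTI; apply/seteqP; split.
  by apply: measurable_fun_ltr => //; exact: measurable_funD.
have hA u : h u = mu [set t : measurableTypeR R | dot u u + t ^+ 2 < 1 :> R].
  by apply: integral_Iv.
transitivity (h (tnth z ord0) * \int[lam D]_s
   Iv [forall j, dot (tnth z (lift ord0 j)) (tnth z (lift ord0 j)) + s ord0 j ^+ 2 < 1]%R)%E.
  rewrite -ge0_integralZr//.
  - apply: eq_integral => t _; rewrite -ge0_integralZT.
    + by apply: eq_integral => s _; rewrite -IvM.
    + by rewrite ler0n.
    + apply: measurable_Iv; apply: measurable_forall => j.
      apply: measurable_fun_ltr => //; apply: measurable_funD => //.
      by apply: measurable_funX; exact: measurable_rV_coord.
    + by move=> s; exact: Iv_ge0.
  - exact: (measurableT_comp mp (pair2_measurable (tnth z ord0))).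
  - by move=> t _; exact: Iv_ge0.
  - by apply: integral_ge0 => s _; exact: Iv_ge0.
rewrite big_ord_recl; congr (_ * _)%E.
rewrite (eq_bigr _ (fun j _ => hA _)) -lebesgue_rV_box; last by move=> j; exact: mA.
apply: integral_Iv => [|s]; last by split => [?|/forallP//]; exact/forallP.
pose B (j : 'I_D) := [set t : measurableTypeR R |
  dot (tnth z (lift ord0 j)) (tnth z (lift ord0 j)) + t ^+ 2 < 1 :> R].
by refine (measurable_rV_box (A := B) _) => j; exact: mA.
Qed.

(** With h = b / r the factor of [integral_graph] is r^-(D+2) times (1 - h^2)^(D (D+2) / 2).
    Integrating in b restores one r and gives the slice integral; the remaining r^-(D+1) is
    integrated by [integral_ell_r]. *)
Theorem kingman D :
  ((ball_vol D.+1 ^+ D.+1)%:E =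
   simplex_int D * (slice_int (D * D.+2) * (ball_vol D.+1 * D.+1%:R / 2))%:E :> \bar R)%E.
Proof.
rewrite -integral_in_lift.
have mL : measurable_fun setT
    (fun q : (D.+1.-tuple 'rV[R]_D * measurableTypeR R) * 'rV[R]_D =>
       Iv (in_lift q.1.1 q.1.2 q.2) : \bar R).
  apply: measurable_Iv; apply: measurable_in_lift; last exact: measurable_snd.
    exact: (measurableT_comp measurable_fst measurable_fst).
  exact: (measurableT_comp measurable_snd measurable_fst).
pose E (q : (D.+1.-tuple 'rV[R]_D * measurableTypeR R) * 'rV[R]_D) : \bar R :=
  (`|\det (edgemx q.1.1)|%:E * Iv (in_graph q.1.1 q.1.2 q.2))%E.
have mE : measurable_fun setT E.
  apply: emeasurable_funM.
    apply: measurable_abs_det_edgemx.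
    exact: (measurableT_comp measurable_fst measurable_fst).
  apply: measurable_Iv; apply: measurable_in_graph; last exact: measurable_snd.
    exact: (measurableT_comp measurable_fst measurable_fst).
  exact: (measurableT_comp measurable_snd measurable_fst).
have E0 q : (0 <= E q)%E by rewrite mule_ge0 ?Iv_ge0.
pose L1 (q : D.+1.-tuple 'rV[R]_D * measurableTypeR R) : \bar R :=
  (\int[lam D]_s Iv (in_lift q.1 q.2 s))%E.
have mL1 : measurable_fun setT L1.
  exact: (measurable_fun_fubini_tonelli_F (m2 := lam D) _ mL (fun=> Iv_ge0 _)).
have L10 q : (0 <= L1 q)%E by apply: integral_ge0 => s _; exact: Iv_ge0.
have [E1 E1E] : exists E1 : (D.+1.-tuple 'rV[R]_D * measurableTypeR R) -> \bar R,
    E1 = fun q => (\int[lam D]_a E (q, a))%E by eexists.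
have mE1 : measurable_fun setT E1.
  by rewrite E1E; exact: (measurable_fun_fubini_tonelli_F (m2 := lam D) _ mE E0).
have E10 q : (0 <= E1 q)%E by rewrite E1E; apply: integral_ge0 => s _; exact: E0.
transitivity (\int[tuple_measure (lam D) D.+1]_z \int[mu]_b E1 (z, b))%E.
  (* The passage from heights to slope and intercept inverts the edge matrix, so degenerate [z] are
     discarded first. *)
  apply: (@eq_integral_null R _ _ _ (fun z => \det (edgemx z) == 0)).
  - by apply: measurable_det_edgemx_eq0; exact: measurable_id.
  - exact: edgemx_null.
  - exact: (measurable_fun_fubini_tonelli_F (m2 := mu) L1 mL1 L10).
  - exact: (measurable_fun_fubini_tonelli_F (m2 := mu) E1 mE1 E10).
  - by move=> z; apply: integral_ge0 => t _; exact: (L10 (z, t)).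
  - by move=> z; apply: integral_ge0 => t _; exact: (E10 (z, t)).
  - move=> z dz; rewrite (integral_lift_graph dz).
    have mg : measurable_fun setT (fun p : measurableTypeR R * 'rV[R]_D =>
        Iv (in_graph z p.1 p.2) : \bar R).
      by apply: measurable_Iv; exact: measurable_in_graph.
    rewrite -ge0_integralZT; last 3 first.
    + exact: normr_ge0.
    + exact: (measurable_fun_fubini_tonelli_F (m2 := lam D) _ mg (fun=> Iv_ge0 _)).
    + by move=> b; apply: integral_ge0 => a _; exact: Iv_ge0.
    apply: eq_integral => b _; rewrite E1E -ge0_integralZT//.
    + by apply: measurable_Iv; exact: measurable_in_graph.
    + by move=> a; exact: Iv_ge0.
rewrite (fubini_tonelli E1 mE1 E10).
have mEb (b : measurableTypeR R) : measurable_fun setT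
    (fun p : D.+1.-tuple 'rV[R]_D * 'rV[R]_D => E ((p.1, b), p.2)).
  apply: (measurableT_comp mE); apply/measurable_fun_pairP; split; last exact: measurable_snd.
  by apply: measurable_fun_pair; [exact: measurable_fst|exact: measurable_cst].
transitivity (\int[mu]_b \int[lam D]_a \int[tuple_measure (lam D) D.+1]_z E ((z, b), a))%E.
  by apply: eq_integral => b _; rewrite E1E (fubini_tonelli _ (mEb b) (fun=> E0 _)).
pose N := D.+1; pose k := (D * D.+2)%N.
pose G (p : measurableTypeR R * 'rV[R]_D) : R :=
  (p.1 ^+ 2 < ell_r p.2 ^+ 2)%R%:R *
   (Num.sqrt (1 - p.1 ^+ 2 / ell_r p.2 ^+ 2) ^+ D / ell_r p.2) ^+ D.+2.
have G0 p : 0 <= G p.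
  by rewrite mulr_ge0// exprn_ge0// divr_ge0 ?exprn_ge0 ?sqrtr_ge0.
have GE (p : measurableTypeR R * 'rV[R]_D) :
    G p = ell_r p.2 ^- D.+2 * slice_wt k ((ell_r p.2)^-1 * p.1 + 0).
  have r0 := ell_r_gt0 p.2; rewrite /G /slice_wt.
  rewrite (_ : (_ * p.1 + 0) ^+ 2 = p.1 ^+ 2 / ell_r p.2 ^+ 2); last first.
    by rewrite addr0 exprMn exprVn mulrC.
  rewrite ltr_pdivrMr ?exprn_gt0// mul1r expr_div_n -exprM [RHS]mulrCA.
  by congr (_ * _); rewrite [RHS]mulrC.
have mG : measurable_fun setT (fun p => (G p)%:E).
  apply/measurable_EFinP; rewrite (_ : G = (fun p => ell_r p.2 ^- D.+2 *
    slice_wt k ((ell_r p.2)^-1 * p.1 + 0))); last by apply/funext.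
  apply: measurable_funM.
    exact: (measurableT_comp (@measurable_ell_rV R D D.+2) measurable_snd).
  apply: (measurableT_comp (@measurable_slice_wt R k)); apply: measurable_funD => //.
  apply: measurable_funM; last exact: measurable_fst.
  exact: (measurableT_comp (@measurable_ell_rV R D 1) measurable_snd).
have K0 : (0 <= simplex_int D :> \bar R)%E.
  by apply: integral_ge0 => z _; rewrite mule_ge0 ?Iv_ge0.
transitivity (\int[mu]_b \int[lam D]_a ((G (b, a))%:E * simplex_int D))%E.
  by apply: eq_integral => b _; apply: eq_integral => a _; rewrite [LHS]integral_graph.
have mGF := measurable_fun_fubini_tonelli_F (m2 := lam D) _ mG (fun p => G0 p).
transitivity (\int[mu]_b ((\int[lam D]_a (G (b, a))%:E) * simplex_int D))%E.
  apply: eq_integral => b _; rewrite ge0_integralZr//.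
    exact: (measurableT_comp mG (pair1_measurable b)).
  by move=> a _; rewrite lee_fin.
rewrite ge0_integralZr//; last by move=> b _; apply: integral_ge0 => a _; rewrite lee_fin.
rewrite muleC; congr (_ * _)%E.
rewrite (fubini_tonelli _ mG (fun p => G0 p)).
rewrite EFinM -integral_ell_r -ge0_integralZT; last 3 first.
- by rewrite fine_ge0//; apply: integral_ge0 => h _; rewrite lee_fin slice_wt_ge0.
- by apply/measurable_EFinP; exact: measurable_ell_rV.
- by move=> a; rewrite lee_fin invr_ge0 exprn_ge0// ltW// ell_r_gt0.
apply: eq_integral => a _.
have r0 := ell_r_gt0 a.
have rV0 : (ell_r a)^-1 != 0 by rewrite invr_eq0 gt_eqF.
have mw : measurable_fun setT (fun h : measurableTypeR R => (slice_wt k h)%:E).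
  by apply/measurable_EFinP; exact: measurable_slice_wt.
have w0 (h : measurableTypeR R) : (0 <= (slice_wt k h)%:E)%E by rewrite lee_fin slice_wt_ge0.
under eq_integral do rewrite GE EFinM /=.
rewrite ge0_integralZT; last 3 first.
- by rewrite invr_ge0 exprn_ge0// ltW.
- exact: (measurableT_comp mw (measurable_affine _ _)).
- by move=> h; exact: w0.
rewrite -slice_intE -(integral_lebesgue_affine 0 rV0 mw w0).
rewrite gtr0_norm ?invr_gt0// [RHS]muleC muleA -EFinM; congr (_%:E * _)%E.
by rewrite -invfM -exprSr.
Qed.

End kingman_formula.

(** * Simplices, tangent cones and projections *)

Section cones_and_simplices.
Context {R : realType}.

(** The coordinates of [v] along the rows of [A] are v adj(A) / det A; multiplied by (det A)^2 they
    become polynomials with the same signs. When det A = 0 the test accepts every [v]. *)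
Definition in_cone n (A : 'M[R]_n) (v : 'rV[R]_n) : bool :=
  [forall j, 0 <= (v *m \adj A) ord0 j * \det A].

(** The barycentric coordinates of [y], cleared of denominators by the square of the determinant. *)
Definition in_simplex D (y : 'rV[R]_D) (t : D.+1.-tuple 'rV[R]_D) : bool :=
  let w := (y - tnth t ord0) *m \adj (edgemx t) in
  [forall j, 0 <= w ord0 j * \det (edgemx t)] &&
  (\sum_j w ord0 j * \det (edgemx t) <= \det (edgemx t) ^+ 2).

Lemma mul_adj_det n (A : 'M[R]_n) (c : 'rV[R]_n) j :
  (c *m A *m \adj A) ord0 j * \det A = c ord0 j * \det A ^+ 2.
Proof. by rewrite -mulmxA mul_mx_adj mul_mx_scalar mxE expr2; ring. Qed.

Lemma in_cone_mul n (A : 'M[R]_n) (c : 'rV[R]_n) : \det A != 0 ->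
  in_cone A (c *m A) = [forall j, 0 <= c ord0 j].
Proof.
move=> dA; have d2 : 0 < \det A ^+ 2 by rewrite exprn_even_gt0.
by apply: eq_forallb => j; rewrite mul_adj_det pmulr_lge0.
Qed.

Lemma in_simplex_mul D (t : D.+1.-tuple 'rV[R]_D) (c : 'rV[R]_D) :
    \det (edgemx t) != 0 ->
  in_simplex (c *m edgemx t + tnth t ord0) t =
  [forall j, 0 <= c ord0 j] && (\sum_j c ord0 j <= 1).
Proof.
move=> dA; have d2 : 0 < \det (edgemx t) ^+ 2 by rewrite exprn_even_gt0.
rewrite /in_simplex addrK; congr (_ && _).
  by apply: eq_forallb => j; rewrite mul_adj_det pmulr_lge0.
under eq_bigr do rewrite mul_adj_det.
by rewrite -mulr_suml -[X in _ <= X]mul1r ler_pM2r.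
Qed.

Lemma mul_edgemx D (t : D.+1.-tuple 'rV[R]_D) (c : 'rV[R]_D) :
  c *m edgemx t = \sum_j c ord0 j *: (tnth t (lift ord0 j) - tnth t ord0).
Proof.
by rewrite mulmx_sum_row; apply: eq_bigr => j _; congr (_ *: _);
  apply/rowP => k; rewrite !mxE.
Qed.

(* A line through the vertex x_0 meets the cone spanned by the edges at x_0 iff
   the projection along it sends x_0 into the simplex of the other vertices. *)
Lemma in_cone_projection D (x : D.+2.-tuple 'rV[R]_D.+1) (v : 'rV[R]_D.+1)
    (Pi : 'M[R]_(D.+1, D)) (t : D.+1.-tuple 'rV[R]_D) :
    v != 0 -> v *m Pi = 0 ->
    (forall u, u *m Pi = 0 -> exists k, u = k *: v) ->
    (forall j, tnth t j = tnth x (lift ord0 j) *m Pi) ->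
    \det (edgemx x) != 0 -> \det (edgemx t) != 0 ->
  (in_cone (edgemx x) v + in_cone (edgemx x) (- v))%N =
  in_simplex (tnth x ord0 *m Pi) t.
Proof.
move=> v0 vPi kerPi tE dx dt; set A := edgemx x; set y := tnth x ord0 *m Pi.
have uA : A \in unitmx by rewrite unitmxE unitfE.
have [c vE] : exists c, v = c *m A by exists (v *m invmx A); rewrite mulmxKV.
have c0 : c != 0 by apply: contra_neq v0 => c0; rewrite vE c0 mul0mx.
have AE : A *m Pi = \matrix_(j < D.+1) (tnth t j - y).
  apply/row_matrixP => j; rewrite row_mul rowK tE -mulmxBl; congr (_ *m _).
  by apply/rowP => k; rewrite !mxE.
have cAPi (e : 'rV[R]_D.+1) :
    e *m A *m Pi = (\sum_j e ord0 j *: tnth t j) - (\sum_j e ord0 j) *: y.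
  rewrite -mulmxA AE mulmx_sum_row scaler_suml -sumrB; apply: eq_bigr => j _.
  by rewrite rowK scalerBr.
have split_sum (e : 'rV[R]_D.+1) : \sum_j e ord0 j =
    e ord0 ord0 + \sum_(j < D) e ord0 (lift ord0 j) by rewrite big_ord_recl.
have bary (e : 'rV[R]_D.+1) : \sum_j e ord0 j *: tnth t j =
    \sum_(j < D) e ord0 (lift ord0 j) *: (tnth t (lift ord0 j) - tnth t ord0) +
    (\sum_j e ord0 j) *: tnth t ord0.
  under [in RHS]eq_bigr do rewrite scalerBr.
  rewrite sumrB -scaler_suml split_sum scalerDl big_ord_recl.
  by rewrite [RHS]addrC -addrA; congr (_ + _); rewrite addrC subrK.
(* A nonnegative combination of edges that projects to 0 becomes a barycentric representation of [y]
   after division by the sum of its coefficients. *)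
have to_simplex (e : 'rV[R]_D.+1) : e != 0 -> e *m A *m Pi = 0 ->
    [forall j, 0 <= e ord0 j] -> in_simplex y t.
  move=> e0 eAPi /forallP ege0; pose S := \sum_j e ord0 j.
  have S0 : 0 < S.
    rewrite lt_neqAle sumr_ge0 ?andbT//; apply: contra_neq e0 => /esym/eqP.
    rewrite psumr_eq0// => /allP h; apply/rowP => j; rewrite mxE; apply/eqP.
    exact: (h j (mem_index_enum _)).
  pose l := \row_(j < D) (e ord0 (lift ord0 j) / S).
  have -> : y = l *m edgemx t + tnth t ord0.
    have Sn0 : S != 0 by rewrite gt_eqF.
    apply: (scalerI Sn0); rewrite scalerDr mul_edgemx scaler_sumr.
    move/eqP : eAPi; rewrite cAPi subr_eq0 => /eqP <-; rewrite bary; congr (_ + _).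
    by apply: eq_bigr => j _; rewrite mxE scalerA mulrC divfK.
  rewrite in_simplex_mul//; apply/andP; split.
    by apply/forallP => j; rewrite mxE divr_ge0// ltW.
  under eq_bigr do rewrite mxE.
  by rewrite -mulr_suml ler_pdivrMr// mul1r /S split_sum lerDr.
(* If v and -v were both in the cone the coordinates of v would vanish, so the count on the left is
   0 or 1 and equals a disjunction. *)
have excl : ~~ (in_cone A v && in_cone A (- v)).
  apply/negP => /andP[]; rewrite {1}vE in_cone_mul// => /forallP h1.
  rewrite {1}vE -mulNmx in_cone_mul// => /forallP h2; move/eqP : c0; apply.
  apply/rowP => j; rewrite mxE; apply/eqP; rewrite eq_le; apply/andP; split.
    by have := h2 j; rewrite mxE oppr_ge0.
  exact: h1.
have cAPi0 : c *m A *m Pi = 0 by rewrite -vE.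
have ->: (in_cone A v + in_cone A (- v))%N = (in_cone A v || in_cone A (- v)).
  by case: (in_cone A v) (in_cone A (- v)) excl => [] [].
congr nat_of_bool; apply/idP/idP.
  move=> /orP[|]; rewrite {1}vE -?mulNmx in_cone_mul//; first exact: to_simplex.
  by apply: to_simplex; rewrite ?oppr_eq0// mulNmx mulNmx cAPi0 oppr0.
have [l yE] : exists l, y = l *m edgemx t + tnth t ord0.
  exists ((y - tnth t ord0) *m invmx (edgemx t)).
  by rewrite mulmxKV ?subrK// unitmxE unitfE.
rewrite {1}yE in_simplex_mul// => /andP[/forallP l0 l1].
(* All barycentric coordinates of [y], the one of vertex 0 being what the others lack to sum to
   1. *)
pose e := \row_(j < D.+1) if unlift ord0 j is Some i then l ord0 i else 1 - \sum_i l ord0 i.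
have e0 : e ord0 ord0 = 1 - \sum_i l ord0 i by rewrite mxE unlift_none.
have eS j : e ord0 (lift ord0 j) = l ord0 j by rewrite mxE liftK.
have ege0 : [forall j, 0 <= e ord0 j].
  apply/forallP => j; case: (unliftP ord0 j) => [i|] ->; first by rewrite eS.
  by rewrite e0 subr_ge0.
have sume : \sum_j e ord0 j = 1.
  by rewrite split_sum e0 (eq_bigr _ (fun j _ => eS j)) subrK.
(* This combination of edges projects to 0, so it is a multiple k of [v]; the sign of k tells which
   of v and -v lies in the cone. *)
have [|k ek] := kerPi (e *m A).
  rewrite cAPi sume bary sume !scale1r yE mul_edgemx; apply/eqP; rewrite subr_eq0.
  by apply/eqP; congr (_ + _); apply: eq_bigr => j _; rewrite eS.
have k0 : k != 0.
  apply/eqP => k0; move: ek; rewrite k0 scale0r => /(congr1 (mulmx^~ (invmx A))).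
  rewrite mulmxK// mul0mx => e00; move: sume; rewrite e00.
  by rewrite big1 => [/eqP|i _]; rewrite ?mxE// eq_sym oner_eq0.
have vk : v = k^-1 *: e *m A by rewrite -scalemxAl ek scalerA mulVf// scale1r.
have [k_gt0|k_le0] := ltP 0 k; apply/orP; [left|right].
  rewrite vk in_cone_mul//; apply/forallP => j; rewrite mxE mulr_ge0//.
    by rewrite invr_ge0 ltW.
  exact: (forallP ege0 j).
rewrite vk -mulNmx -scaleNr in_cone_mul//; apply/forallP => j; rewrite mxE mulr_ge0//.
  by rewrite oppr_ge0 invr_le0.
exact: (forallP ege0 j).
Qed.

End cones_and_simplices.

(** * Volume of a simplex and the integral in Sylvester's problem *)

Section simplex_volume.
Context {R : realType}.
Local Notation lam D := (@lebesgue_rV R D).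
Local Notation mu := (@lebesgue_measure R).

Let in_std D (s : R) (c : 'rV[R]_D) : bool :=
  [forall j, 0 <= c ord0 j] && (\sum_j c ord0 j <= s).

Let measurable_in_std d (T : measurableType d) D (s : T -> R) (c : T -> 'rV[R]_D) :
  measurable_fun setT s -> measurable_fun setT c ->
  measurable_fun setT (fun x => in_std (s x) (c x)).
Proof.
move=> ms /measurable_fun_rVP mc; apply: measurable_and.
  by apply: measurable_forall => j; exact: measurable_fun_ler.
by apply: measurable_fun_ler => //; exact: measurable_sum.
Qed.

(** The slice at first coordinate x is the simplex of one dimension less scaled by 1 - x, which
    leaves the integral of (1 - x)^D. *)
Lemma std_simplex_volume D :
  (\int[lam D]_c Iv (in_std 1 c) = (D`!%:R^-1)%:E)%E.
Proof.
elim: D => [|D IH].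
  rewrite integral_lebesgue_rV0; last first.
    by apply: measurable_Iv; apply: measurable_in_std => //; exact: measurable_id.
  rewrite /in_std big_ord0 ler01 andbT fact0 invr1 /Iv.
  by rewrite (_ : [forall j, _] = true)//; apply/forallP => -[].
have m1 k : measurable_fun setT (fun c : 'rV[R]_k => Iv (in_std 1 c) : \bar R).
  by apply: measurable_Iv; apply: measurable_in_std => //; exact: measurable_id.
rewrite (integral_lebesgue_rVS (m1 _) (fun=> Iv_ge0 _)).
pose b (x : measurableTypeR R) : bool := (0 < x) && (x < 1).
pose g (x : measurableTypeR R) : \bar R := ((b x)%:R * x ^+ D)%:E.
have mb : measurable_fun setT b by apply: measurable_and; exact: measurable_fun_ltr.
have mbR : measurable_fun setT (fun x => (b x)%:R : R).
  by have /measurable_EFinP := @measurable_Iv R _ _ _ mb.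
have mg : measurable_fun setT g.
  by apply/measurable_EFinP; apply: measurable_funM.
have g0 x : (0 <= g x)%E.
  rewrite lee_fin /b; have [/andP[x0 _]|_] := boolP (0 < x < 1); last by rewrite mul0r.
  by rewrite mul1r exprn_ge0// ltW.
have N1 : (-1 != 0 :> R) by rewrite oppr_eq0 oner_eq0.
have ig : (\int[mu]_x g x = (D.+1%:R^-1)%:E)%E.
  rewrite -integral_exprn01 integral_itv_bndoo; last first.
    by apply/measurable_EFinP; exact: exprn_measurable.
  rewrite [RHS]integral_mkcond; apply: eq_integral => s _.
  rewrite patchE /g /b; have [s01|s01] := boolP (0 < s < 1).
    by rewrite mem_set ?mul1r//= in_itv.
  by rewrite memNset ?mul0r//= in_itv /= => h; rewrite h in s01.
have mg1 : measurable_fun setT (fun x : measurableTypeR R => g (-1 * x + 1)).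
  exact: (measurableT_comp mg (measurable_affine _ _)).
transitivity (\int[mu]_x ((D`!%:R^-1)%:E * g (-1 * x + 1)%R))%E; last first.
  rewrite (ge0_integralZT _ _ mg1)//.
  have := integral_lebesgue_affine 1 N1 mg g0; rewrite normrN1 mul1e => ->.
  by rewrite ig -EFinM factS natrM invfM mulrC.
have nb : measurable_fun setT (fun x : measurableTypeR R => (x == 0) || (x == 1)).
  by apply: measurable_or; exact: measurable_fun_eqr.
(* The scaling by 1 - x degenerates at x = 1, and the comparison function vanishes at both ends
   while the slices need not. *)
apply: (@eq_integral_null R _ (measurableTypeR R) mu (fun x => (x == 0) || (x == 1))) => //.
- transitivity (mu [set x : R | (x == 0) || (x == 1)]).
    apply: integral_Iv => //.
    rewrite (_ : [set x | _] = [set 0] `|` [set 1]); last first.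
      by apply/seteqP; split => x /=; [move=> /orP[/eqP|/eqP]; [left|right]|move=> [->|->]; rewrite eqxx ?orbT].
    by apply: measurableU; exact: measurable_set1.
  apply: countable_lebesgue_measure0.
  apply: (@sub_countable _ _ _ [set` [:: 0; 1 : R]]); last exact: finite_set_countable.
  by apply: subset_card_le => x /=; rewrite !inE.
- apply: (measurable_fun_fubini_tonelli_F
    (fun p : measurableTypeR R * 'rV[R]_D => Iv (in_std 1 (rV_cons p)) : \bar R)).
    by apply: (measurableT_comp (m1 _)); exact: measurable_rV_cons.
  by move=> p; exact: Iv_ge0.
- apply: (@emeasurable_funM _ _ _ _ (fun=> _)) => //.
- by move=> x; apply: integral_ge0 => c _; exact: Iv_ge0.
- by move=> x; rewrite mule_ge0.
- move=> x; rewrite negb_or => /andP[x0 x1].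
  have inE' (v : 'rV[R]_D) : in_std 1 (rV_cons (x, v)) = (0 <= x) && in_std (1 - x) v.
    rewrite /in_std big_ord_recl rV_cons0 /= andbA; congr (_ && _).
      apply/forallP/andP => [h|[hx /forallP h] j].
        split; first by have := h ord0; rewrite rV_cons0.
        by apply/forallP => j; have := h (lift ord0 j); rewrite rV_cons_lift.
      by case: (unliftP ord0 j) => [i|] ->; rewrite ?rV_cons_lift ?rV_cons0.
    by rewrite -lerBrDl; congr (_ <= _); apply: eq_bigr => j _; rewrite rV_cons_lift.
  rewrite /g /b mulN1r; under eq_integral do rewrite inE'.
  have [x01|x01] := boolP (0 < x < 1); last first.
    rewrite (_ : (0 < - x + 1) && (- x + 1 < 1) = false); last first.
      by apply/negbTE; apply: contra x01 => /andP[? ?]; apply/andP; split; lra.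
    rewrite mul0r mule0; apply: integral0_eq => v _; rewrite /Iv.
    case: (leP 0 x) => //= xge0; rewrite (_ : in_std _ _ = false)//.
    apply/negbTE; apply: contra x01 => /andP[/forallP v0 sv].
    have : 0 <= \sum_j v ord0 j by apply: sumr_ge0 => j _; exact: v0.
    have xgt0 : 0 < x by rewrite lt_neqAle eq_sym x0.
    have xne1 : x <= 1 -> x < 1 by move=> h; rewrite lt_neqAle x1.
    by move=> sv0; rewrite xgt0 /=; apply: xne1; lra.
  have /andP[xgt0 xlt1] := x01.
  have -> : (0 < - x + 1) && (- x + 1 < 1) by apply/andP; split; lra.
  rewrite mul1r (ltW xgt0) /=.
  have s0 : 0 < 1 - x by lra.
  have ms : measurable_fun setT (fun v : 'rV[R]_D => Iv (in_std (1 - x) v) : \bar R).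
    by apply: measurable_Iv; apply: measurable_in_std => //; exact: measurable_id.
  rewrite -(@integral_scale R D (1 - x) _ (lt0r_neq0 s0) ms (fun=> Iv_ge0 _)).
  rewrite gtr0_norm// muleC [(- x + 1)%R]addrC; congr (_ * _)%E; rewrite -IH; apply: eq_integral => v _.
  congr Iv; rewrite /in_std; congr (_ && _).
    by apply: eq_forallb => j; rewrite mxE pmulr_rge0.
  under eq_bigr do rewrite mxE.
  by rewrite -mulr_sumr -[X in _ <= X]mulr1 ler_pM2l.
Qed.

Lemma measurable_in_simplex d (T : measurableType d) D (y : T -> 'rV[R]_D)
    (t : T -> D.+1.-tuple 'rV[R]_D) :
  measurable_fun setT y -> measurable_fun setT t ->
  measurable_fun setT (fun x => in_simplex (y x) (t x)).
Proof.
move=> my mt.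
have md : measurable_fun setT (fun x => \det (edgemx (t x))).
  by apply: measurable_det; exact: measurable_edgemx.
have mw : measurable_mx (fun x => (y x - tnth (t x) ord0) *m \adj (edgemx (t x))).
  apply: measurable_mulmx; last by apply: measurable_adj; exact: measurable_edgemx.
  move=> i j; rewrite ord1; under eq_fun do rewrite !mxE.
  apply: measurable_funB; first by move/measurable_fun_rVP : my; exact.
  exact: measurable_tnth_coord.
apply: measurable_and.
  apply: measurable_forall => j; apply: measurable_fun_ler => //.
  by apply: measurable_funM => //; exact: mw.
apply: measurable_fun_ler; last exact: measurable_funX.
by apply: measurable_sum => j; apply: measurable_funM => //; exact: mw.
Qed.

Lemma integral_in_simplex D (t : D.+1.-tuple 'rV[R]_D) : \det (edgemx t) != 0 ->
  (\int[lam D]_y Iv (in_simplex y t) = (`|\det (edgemx t)| / D`!%:R)%:E)%E.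
Proof.
move=> dt; have ut : edgemx t \in unitmx by rewrite unitmxE unitfE.
have ms : measurable_fun setT (fun y : 'rV[R]_D => Iv (in_simplex y t) : \bar R).
  by apply: measurable_Iv; apply: measurable_in_simplex => //; exact: measurable_id.
rewrite -(integral_lebesgue_rV_translation (tnth t ord0) ms (fun=> Iv_ge0 _)).
have mst := measurableT_comp ms (measurable_fun_addr (tnth t ord0)).
rewrite -[LHS](change_of_variables_unitmx ut mst (fun=> Iv_ge0 _)) EFinM.
rewrite -std_simplex_volume; congr (_ * _)%E; apply: eq_integral => c _ /=.
by rewrite in_simplex_mul.
Qed.

(** Convexity of the open ball, obtained from Jensen's inequality for the square of each
    coordinate. *)
Lemma in_simplex_inball D (y : 'rV[R]_D) (t : D.+1.-tuple 'rV[R]_D) :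
    \det (edgemx t) != 0 -> [forall i, inball (tnth t i)] -> in_simplex y t ->
  inball y.
Proof.
move=> dt /forallP tB.
have ut : edgemx t \in unitmx by rewrite unitmxE unitfE.
have [l yE] : exists l, y = l *m edgemx t + tnth t ord0.
  by exists ((y - tnth t ord0) *m invmx (edgemx t)); rewrite mulmxKV ?subrK.
rewrite {1}yE in_simplex_mul// => /andP[/forallP l0 l1].
pose e (i : 'I_D.+1) := if unlift ord0 i is Some j then l ord0 j else 1 - \sum_j l ord0 j.
have e0 : e ord0 = 1 - \sum_j l ord0 j by rewrite /e unlift_none.
have eS j : e (lift ord0 j) = l ord0 j by rewrite /e liftK.
have ege0 i : 0 <= e i.
  by case: (unliftP ord0 i) => [j|] ->; rewrite ?eS// e0 subr_ge0.
have sume : \sum_i e i = 1.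
  by rewrite big_ord_recl e0 (eq_bigr _ (fun j _ => eS j)) subrK.
have yk k : y ord0 k = \sum_i e i * tnth t i ord0 k.
  rewrite big_ord_recl e0 (eq_bigr _ (fun j _ => congr1 (fun x => x * _) (eS j))).
  rewrite yE mul_edgemx !mxE summxE.
  under [in LHS]eq_bigr do rewrite !mxE mulrBr.
  by rewrite sumrB -mulr_suml mulrBl mul1r; ring.
have jensen k : y ord0 k * y ord0 k <= \sum_i e i * (tnth t i ord0 k * tnth t i ord0 k).
  rewrite -subr_ge0; set m := y ord0 k.
  (* The gap is the variance of the k-th coordinate under the weights [e]. *)
  have -> : \sum_i e i * (tnth t i ord0 k * tnth t i ord0 k) - m * m =
      \sum_i e i * (tnth t i ord0 k - m) ^+ 2.
    transitivity (\sum_i (e i * (tnth t i ord0 k * tnth t i ord0 k) -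
        2 * m * (e i * tnth t i ord0 k) + m ^+ 2 * e i)).
      by rewrite big_split sumrB /= -!mulr_sumr -yk sume -/m; ring.
    by apply: eq_bigr => i _; ring.
  by apply: sumr_ge0 => i _; rewrite mulr_ge0// sqr_ge0.
rewrite /inball; apply: (@le_lt_trans _ _ (\sum_i e i * dot (tnth t i) (tnth t i))).
  rewrite /dot; under [leRHS]eq_bigr do rewrite mulr_sumr.
  by rewrite exchange_big /=; apply: ler_sum => k _.
rewrite -subr_gt0 -[X in X - _]sume -sumrB.
have eB i : 0 <= e i - e i * dot (tnth t i) (tnth t i).
  by rewrite -[X in X - _]mulr1 -mulrBr mulr_ge0// subr_ge0 ltW//; exact: tB.
(* Equality would force every weight e_i to vanish, since 1 - |t_i|^2 > 0, against their sum being
   1. *)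
rewrite lt_neqAle sumr_ge0 ?andbT//; apply/eqP => /esym/eqP.
rewrite psumr_eq0// => /allP h; move/eqP: sume; apply/negP.
rewrite big1 ?(eq_sym 0) ?oner_eq0// => i _; apply/eqP.
have := h i (mem_index_enum _); rewrite /= -[X in X - _]mulr1 -mulrBr mulf_eq0 => /orP[//|].
by rewrite subr_eq0 => /eqP tB1; have := tB i; rewrite /inball -tB1 ltxx.
Qed.

(** When the t_i are in the ball so is their simplex; the ball condition on the first point is thus
    implied, and integrating that point out gives the volume |det| / D!. *)
Lemma integral_simplex_prob D :
  (\int[tuple_measure (lam D) D.+2]_z
     Iv ([forall i, inball (tnth z i)] && in_simplex (tuncons z).1 (tuncons z).2) =
   simplex_int D * (D`!%:R^-1)%:E)%E.
Proof.
have mb (T := (D.+2.-tuple 'rV[R]_D)%type) : measurable_fun setT (fun z : T =>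
    Iv ([forall i, inball (tnth z i)] && in_simplex (tuncons z).1 (tuncons z).2) : \bar R).
  apply: measurable_Iv; apply: measurable_and.
    by apply: measurable_all_inball; exact: measurable_id.
  by apply: measurable_in_simplex;
    apply: (measurableT_comp _ (@measurable_tuncons _ _ _));
    [exact: measurable_fst|exact: measurable_snd].
rewrite (integral_tupleS_swap _ mb (fun=> Iv_ge0 _)).
pose K (t : D.+1.-tuple 'rV[R]_D) : \bar R :=
  (`|\det (edgemx t)|%:E * Iv [forall i, inball (tnth t i)])%E.
have mKt : measurable_fun setT K.
  apply: emeasurable_funM; first by apply: measurable_abs_det_edgemx; exact: measurable_id.
  by apply: measurable_Iv; apply: measurable_all_inball; exact: measurable_id.
have K0 t : (0 <= K t)%E by rewrite mule_ge0 ?Iv_ge0.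
have f0 : 0 <= D`!%:R^-1 :> R by rewrite invr_ge0.
rewrite muleC -[RHS](ge0_integralZT _ f0 mKt K0).
apply: (@eq_integral_null R _ _ _ (fun t => \det (edgemx t) == 0)).
- by apply: measurable_det_edgemx_eq0; exact: measurable_id.
- exact: edgemx_null.
- exact: (measurable_fun_fubini_tonelli_G _ (measurable_comp_tcons mb) (fun=> Iv_ge0 _)).
- exact: (@emeasurable_funM _ _ _ _ (fun=> _)).
- by move=> t; apply: integral_ge0 => y _; exact: Iv_ge0.
- by move=> t; rewrite mule_ge0// lee_fin invr_ge0.
- move=> t dt.
  have tE (y : 'rV[R]_D) : [forall i, inball (tnth (tcons (y, t)) i)] && in_simplex y t =
      [forall i, inball (tnth t i)] && in_simplex y t.
    apply/andP/andP => -[/forallP h yt]; split => //; apply/forallP => i.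
      by have := h (lift ord0 i); rewrite tconsS.
    case: (unliftP ord0 i) => [j|] ->; first by rewrite tconsS.
    by rewrite tcons0 /=; apply: (in_simplex_inball dt) yt; exact/forallP.
  under eq_integral do rewrite tconsK /= tE IvM.
  rewrite ge0_integralZT; last 3 first.
  + by rewrite ler0n.
  + by apply: measurable_Iv; apply: measurable_in_simplex => //; exact: measurable_id.
  + by move=> y; exact: Iv_ge0.
  by rewrite integral_in_simplex// /K /Iv -!EFinM; congr EFin; ring.
Qed.

End simplex_volume.

(** * Expected angles *)

Section density.
Context d (T : measurableType d) (R : realType).
Variables (m lam : {measure set T -> \bar R}) (h : T -> R).
Hypothesis mh : measurable_fun setT h.
Hypothesis h0 : forall x, 0 <= h x.
Hypothesis mE : forall A, measurable A -> m A = (\int[lam]_(x in A) (h x)%:E)%E.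
Local Open Scope ereal_scope.

Import HBNNSimple.

Let integral_density_nnsfun (f : {nnsfun T >-> R}) :
  \int[m]_x (f x)%:E = \int[lam]_x ((h x)%:E * (f x)%:E).
Proof.
have mhE : measurable_fun setT (fun x => (h x)%:E) by exact/measurable_EFinP.
under [LHS]eq_integral do rewrite fimfunE -fsumEFin//.
rewrite [LHS]ge0_integral_fsum//; last 2 first.
  - by move=> r; exact/measurable_EFinP/measurableT_comp.
  - by move=> n x _; rewrite EFinM nnfun_muleindic_ge0.
under [RHS]eq_integral.
  move=> x xD; rewrite fimfunE -fsumEFin// ge0_mule_fsumr; last first.
    by move=> r; rewrite EFinM nnfun_muleindic_ge0.
  over.
rewrite [RHS]ge0_integral_fsum//; last 2 first.
  - by move=> r; apply: emeasurable_funM => //; exact/measurable_EFinP/measurableT_comp.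
  - by move=> n x _; rewrite mule_ge0 ?lee_fin// -lee_fin EFinM nnfun_muleindic_ge0.
apply: eq_fsbigr => r _; rewrite integralZl_indic_nnsfun// integral_indic// setIT.
rewrite mE//; have [r0|r0] := leP 0%R r; last first.
  rewrite preimage_nnfun0// integral_set0 mule0; apply/esym/integral0_eq => x _.
  by rewrite indicE in_set0 mulr0 mule0.
rewrite -ge0_integralZl//; last 2 first.
- exact: measurable_funTS mhE.
- by move=> x _; rewrite lee_fin.
rewrite integral_mkcond; apply: eq_integral => x _; rewrite patchE indicE.
by case: ifPn => xr; rewrite ?mulr1 ?mulr0 ?mule0// muleC.
Qed.

Lemma ge0_integral_density (f : T -> \bar R) :
    measurable_fun setT f -> (forall x, 0 <= f x) ->
  \int[m]_x f x = \int[lam]_x ((h x)%:E * f x).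
Proof.
move=> mf f0; pose f_ := nnsfun_approx measurableT mf.
have mhE : measurable_fun setT (fun x => (h x)%:E) by exact/measurable_EFinP.
transitivity (lim (\int[m]_x (f_ n x)%:E @[n --> \oo])).
  rewrite -monotone_convergence//=.
  - apply: eq_integral => x _; apply/esym/cvg_lim => //=.
    exact: cvg_nnsfun_approx.
  - by move=> n; exact/measurable_EFinP/measurable_funTS.
  - by move=> n x _; rewrite lee_fin.
  - by move=> x _ a b ab; rewrite lee_fin; exact/lefP/nd_nnsfun_approx.
rewrite [RHS](_ : _ = lim (\int[lam]_x ((h x)%:E * (f_ n x)%:E) @[n --> \oo])).
  by apply: congr_lim; apply/funext => n; exact: integral_density_nnsfun.
rewrite -monotone_convergence//=.
- apply: eq_integral => x _; apply/esym/cvg_lim => //=.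
  by apply: cvgeZl => //; exact: cvg_nnsfun_approx.
- by move=> n; apply: emeasurable_funM => //; exact/measurable_EFinP.
- by move=> n x _; rewrite mule_ge0// lee_fin.
- move=> x _ a b ab; apply: lee_wpmul2l; rewrite ?lee_fin//.
  exact/lefP/nd_nnsfun_approx.
Qed.

End density.

Section integral_nonmeasurable.
Context d (T : measurableType d) (R : realType) (m : {measure set T -> \bar R}).
Local Open Scope ereal_scope.

Import HBNNSimple.

(* No measurability of f is assumed: the integral of a nonnegative function is
   a supremum over simple functions below it. *)
Lemma ge0_integral_off_null (b : T -> bool) (f g : T -> \bar R) :
    measurable_fun setT b -> \int[m]_x Iv (b x) = 0 ->
    measurable_fun setT g -> (forall x, 0 <= f x) -> (forall x, 0 <= g x) ->
    (forall x, ~~ b x -> f x = g x) ->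
  \int[m]_x f x = \int[m]_x g x.
Proof.
move=> mb b0 mg f0 g0 fg.
(* [g'] vanishes on the null set, so it lies below [f] everywhere while having the integral of [g]:
   this gives the lower bound. *)
pose g' x := Iv (~~ b x) * g x.
have mg' : measurable_fun setT g'.
  by apply: emeasurable_funM => //; apply: measurable_Iv; exact: measurable_neg.
have g'0 x : 0 <= g' x by rewrite mule_ge0 ?Iv_ge0.
have gg' : \int[m]_x g x = \int[m]_x g' x.
  by apply: (eq_integral_null mb b0) => // x bx; rewrite /g' /Iv bx mul1e.
have mN : measurable [set x | b x].
  rewrite (_ : [set x | b x] = setT `&` b @^-1` [set true]); first exact: mb.
  by rewrite setTI; apply/seteqP; split.
have mN0 : m [set x | b x] = 0 by rewrite -b0; apply/esym/integral_Iv.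
apply/eqP; rewrite eq_le; apply/andP; split; last first.
  rewrite gg' !ge0_integralTE//; apply: ge_ereal_sup => _ [s sg' <-].
  apply: ereal_sup_ubound; exists s => // x.
  apply: le_trans (sg' x) _; rewrite /g' /Iv; case: (boolP (b x)) => bx /=.
    by rewrite mul0e.
  by rewrite mul1e fg.
(* For the upper bound, a simple function below [f] is below [g] almost everywhere. *)
rewrite ge0_integralTE//; apply: ge_ereal_sup => _ [s sf <-].
rewrite -integralT_nnsfun; apply: ae_ge0_le_integral => //.
- by move=> x _; rewrite lee_fin.
- exact/measurable_EFinP.
exists [set x | b x]; split => // x /=; apply: contra_notP => /negP bx _.
by rewrite -fg//; exact: sf.
Qed.

End integral_nonmeasurable.

(** * The tangent cone and the angle of a simplex at a vertex *)

Section tangent_cones.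
Context {R : realType} {n : nat}.
Implicit Types (K : set 'rV[R]_n) (v : 'rV[R]_n).

Lemma convex_setP K : @convex_set R 'rV[R]_n K <->
  (forall x y (k : R), 0 <= k -> k <= 1 -> K x -> K y -> K (k *: x + (1 - k) *: y)).
Proof.
split=> [cK x y k k0 k1 Kx Ky|cK x y k].
  by have := cK x y (Itv01 k0 k1); rewrite !inE; exact.
rewrite !inE => Kx Ky; apply: cK => //.
Qed.

Lemma convex_conv_hull K : @convex_set R 'rV[R]_n (conv_hull K).
Proof.
apply/convex_setP => x y k k0 k1 Kx Ky C [cC KC].
by move/convex_setP : (cC); apply => //; [exact: Kx|exact: Ky].
Qed.

Section tangent_cone_convex.
Variables (K : set 'rV[R]_n) (x : 'rV[R]_n).
Hypotheses (cK : @convex_set R 'rV[R]_n K) (Kx : K x).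

Lemma tangent_coneD u v : tangent_cone K x u -> tangent_cone K x v ->
  tangent_cone K x (u + v).
Proof.
(* The point reached is the convex combination of x + e u and x + f v with weights f / (e + f) and e
   / (e + f). *)
move=> [e e0 Ku] [f f0 Kv]; exists (e * f / (e + f)).
  by rewrite divr_gt0 ?mulr_gt0 ?addr_gt0.
have ef0 : e + f != 0 by rewrite gt_eqF// addr_gt0.
have k0 : 0 <= f / (e + f) by rewrite divr_ge0 ?ltW ?addr_gt0.
have k1 : f / (e + f) <= 1.
  by rewrite ler_pdivrMr ?addr_gt0// mul1r lerDr ltW.
have := (convex_setP K).1 cK _ _ _ k0 k1 Ku Kv.
congr K; apply/rowP => i; rewrite !mxE.
by field.
Qed.

Lemma tangent_coneZ k v : 0 <= k -> tangent_cone K x v -> tangent_cone K x (k *: v).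
Proof.
rewrite le_eqVlt => /predU1P[<- _|k0 [e e0 Kv]].
  by exists 1 => //; rewrite scale0r scaler0 addr0.
exists (e / k); first by rewrite divr_gt0.
by rewrite scalerA divfK// gt_eqF.
Qed.

Lemma tangent_cone_sum (I : finType) (c : I -> R) (w : I -> 'rV[R]_n) :
  (forall i, 0 <= c i) -> (forall i, K (x + w i)) ->
  tangent_cone K x (\sum_i c i *: w i).
Proof.
move=> c0 Kw; apply: (big_ind (tangent_cone K x)).
- by exists 1 => //; rewrite scaler0 addr0.
- exact: tangent_coneD.
- move=> i _; apply: tangent_coneZ => //.
  by exists 1 => //; rewrite scale1r.
Qed.

End tangent_cone_convex.

End tangent_cones.

Section simplex_angle.
Context {R : realType}.

(** The hull lies in the translated cone of the edges, a convex set containing the vertices;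
    conversely each edge is a tangent direction, and the tangent cone of a convex set is a convex
    cone. *)
Lemma tangent_cone_simplex n (x : n.+1.-tuple 'rV[R]_n) : \det (edgemx x) != 0 ->
  tangent_cone (conv_hull (range (tnth x))) (tnth x ord0) =
  [set v | in_cone (edgemx x) v].
Proof.
move=> dx; have ux : edgemx x \in unitmx by rewrite unitmxE unitfE.
set K := conv_hull _; set x0 := tnth x ord0.
have Kx i : K (tnth x i) by move=> C [_ xC]; apply: xC; exists i.
have cK : @convex_set R 'rV[R]_n K := @convex_conv_hull R n _.
have KS : K `<=` [set y | exists2 c : 'rV[R]_n, (forall j, 0 <= c ord0 j) & y = x0 + c *m edgemx x].
  apply: smallest_sub.
    apply/convex_setP => _ _ k k0 k1 [c c0 ->] [e e0 ->].
    exists (k *: c + (1 - k) *: e).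
      by move=> j; rewrite !mxE addr_ge0 ?mulr_ge0 ?subr_ge0.
    rewrite mulmxDl -!scalemxAl; move: (c *m _) (e *m _) => a b.
    by apply/rowP => i; rewrite !mxE; ring.
  move=> _ [i _ <-]; case: (unliftP ord0 i) => [j|] ->.
    exists (delta_mx ord0 j); first by move=> k; rewrite mxE ler0n.
    by rewrite -rowE; apply/rowP => k; rewrite !mxE addrC subrK.
  exists 0; first by move=> j; rewrite mxE.
  by rewrite mul0mx addr0.
apply/seteqP; split => v /=.
  move=> [e e0 /KS[c c0]] => /addrI ev.
  have -> : v = (e^-1 *: c) *m edgemx x.
    by rewrite -scalemxAl -ev scalerA mulVf ?scale1r// gt_eqF.
  rewrite in_cone_mul//; apply/forallP => j.
  by rewrite mxE mulr_ge0// invr_ge0 ltW.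
have -> : v = (v *m invmx (edgemx x)) *m edgemx x by rewrite mulmxKV.
rewrite in_cone_mul// => /forallP c0; rewrite mul_edgemx.
by apply: (tangent_cone_sum cK (Kx ord0)) => // j; rewrite addrC subrK.
Qed.

Lemma in_coneZ n (A : 'M[R]_n) k v : 0 < k -> in_cone A (k *: v) = in_cone A v.
Proof.
move=> k0; apply: eq_forallb => j.
by rewrite -scalemxAl mxE -mulrA pmulr_rge0.
Qed.

Lemma in_cone_radial n (A : 'M[R]_n) v : in_cone A (radial_proj v) = in_cone A v.
Proof.
rewrite /radial_proj; have [->|v0] := eqVneq v 0; first by rewrite scaler0.
by rewrite in_coneZ// invr_gt0 lt_neqAle eq_sym enorm_eq0 v0 sqrtr_ge0.
Qed.

Lemma measurable_in_cone d (T : measurableType d) n (A : T -> 'M[R]_n) (v : T -> 'rV[R]_n) :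
  measurable_mx A -> measurable_fun setT v ->
  measurable_fun setT (fun x => in_cone (A x) (v x)).
Proof.
move=> mA mv; apply: measurable_forall => j; apply: measurable_fun_ler => //.
apply: measurable_funM; last exact: measurable_det.
by apply: measurable_mulmx; [exact/measurable_mxP|exact: measurable_adj].
Qed.

(** A cone is invariant under positive scaling, so [radial_proj] can be removed from the uniform
    measure of the sphere. *)
Lemma simplex_angleE n (x : n.+1.-tuple 'rV[R]_n) : \det (edgemx x) != 0 ->
  ((internal_angle (conv_hull (range (tnth x))) (tnth x ord0))%:E =
   (ball_vol n)^-1%:E *
   \int[lebesgue_rV n]_v Iv (inball v && in_cone (edgemx x) v))%E.
Proof.
move=> dx; rewrite /internal_angle tangent_cone_simplex//.
set S := [set v | in_cone (edgemx x) v].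
have mS : measurable S.
  rewrite (_ : S = setT `&` in_cone (edgemx x) @^-1` [set true]); last first.
    by rewrite setTI; apply/seteqP; split.
  by apply: measurable_in_cone => //; exact: measurable_cstmx.
have mB : measurable (unit_ball n `&` S).
  by apply: measurableI => //; exact: measurable_unit_ball.
have fS : (uniform_sphere S : \bar R) \is a fin_num by exact: fin_num_measure.
rewrite fineK// /uniform_sphere; congr (_ * _)%E.
rewrite (_ : _ `&` _ = unit_ball n `&` S).
  apply/esym/integral_Iv => // v; rewrite /S /inball -enorm_lt1 /unit_ball /=.
  by split => [[-> ->]|/andP[]].
by apply/seteqP; split => v [vB]; rewrite /S /= in_cone_radial.
Qed.

End simplex_angle.

(** * Projection of the beta density with exponent -1/2 *)

Section beta_projection.
Context {R : realType}.
Local Notation lam D := (@lebesgue_rV R D).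
Local Notation mu := (@lebesgue_measure R).

Lemma beta_weightE (b : R) n (x : 'rV[R]_n) :
  beta_weight b x = (inball x)%:R * (1 - dot x x) `^ b.
Proof.
rewrite /beta_weight enorm_sqr mulrC indicE /inball -enorm_lt1.
congr (_%:R * _); congr nat_of_bool; apply/idP/idP; rewrite inE//.
Qed.

Lemma beta_weight_ge0 (b : R) n (x : 'rV[R]_n) : 0 <= beta_weight b x.
Proof. by rewrite beta_weightE mulr_ge0// powR_ge0. Qed.

Lemma measurable_natr_bool d (T : measurableType d) (b : T -> bool) :
  measurable_fun setT b -> measurable_fun setT (fun x => (b x)%:R : R).
Proof. by move=> mb; have /measurable_EFinP := @measurable_Iv R _ _ _ mb. Qed.

Lemma measurable_beta_weight (b : R) n :
  measurable_fun setT (fun x : 'rV[R]_n => beta_weight b x).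
Proof.
under eq_fun do rewrite beta_weightE.
apply: measurable_funM.
  by apply: measurable_natr_bool; apply: measurable_inball; exact: measurable_id.
apply: (measurableT_comp (measurable_powR _)); apply: measurable_funB => //.
by apply: measurable_dot; exact: measurable_id.
Qed.

Let beta1 (t : R) : R := (t ^+ 2 < 1)%R%:R * (1 - t ^+ 2) `^ (- 2^-1).

Let measurable_beta1 : measurable_fun setT (beta1 : measurableTypeR R -> R).
Proof.
apply: measurable_funM.
  by apply: measurable_natr_bool; exact: measurable_fun_ltr.
by apply: (measurableT_comp (measurable_powR _)); exact: measurable_funB.
Qed.

Let beta1_ge0 t : 0 <= beta1 t.
Proof. by rewrite mulr_ge0// powR_ge0. Qed.

(** The mass of the one-dimensional weight, carried as a symbol until the total mass 1 of the law
    fixes its product with [c]. *)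
Let beta1C : \bar R := (\int[mu]_t (beta1 t)%:E)%E.

(* The exponent -1/2 makes the marginal constant on the ball. *)
Let beta_slice D (y : 'rV[R]_D) :
  (\int[mu]_t (beta_weight (- 2^-1) (rV_cons (t, y)))%:E = Iv (inball y) * beta1C)%E.
Proof.
rewrite /Iv /inball; have [dy|dy] := ltP (dot y y) 1; last first.
  rewrite mul0e; apply: integral0_eq => t _; rewrite beta_weightE /inball dot_rV_cons.
  rewrite (_ : _ < 1 = false) ?mul0r//; apply/negbTE; rewrite -leNgt.
  by rewrite (le_trans dy)// lerDr -expr2 sqr_ge0.
rewrite mul1e; set s := Num.sqrt (1 - dot y y).
have A0 : 0 < 1 - dot y y by rewrite subr_gt0.
have s0 : 0 < s by rewrite sqrtr_gt0.
have s2 : s ^+ 2 = 1 - dot y y by rewrite sqr_sqrtr// ltW.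
have sV0 : s^-1 != 0 by rewrite invr_eq0 gt_eqF.
have mb : measurable_fun setT (fun t => (beta1 t)%:E) by exact/measurable_EFinP.
have b0 t : (0 <= (beta1 t)%:E)%E by rewrite lee_fin.
(* In the variable t / s, with s the half-length of the chord over [y], the weight splits off
   (s^2)^(-1/2) = 1 / s, which is exactly the Jacobian. *)
rewrite /beta1C -(integral_lebesgue_affine 0 sV0 mb b0) gtr0_norm ?invr_gt0//.
have sV : 0 <= s^-1 by rewrite invr_ge0 ltW.
have mba := measurableT_comp mb (measurable_affine s^-1 0).
rewrite -(ge0_integralZT _ sV mba) => [|t]; last exact: b0.
apply: eq_integral => t _ /=.
rewrite -EFinM; congr EFin; rewrite beta_weightE /inball dot_rV_cons /beta1 addr0 mulrCA.
have t2 : (s^-1 * t) ^+ 2 = t ^+ 2 / (1 - dot y y).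
  by rewrite exprMn exprVn s2 mulrC.
rewrite t2 ltr_pdivrMr// mul1r -ltrBrDr -expr2.
case: ltP => tA; last by rewrite !mul0r.
rewrite !mul1r (_ : 1 - (t ^+ 2 + _) = (1 - dot y y) * (1 - t ^+ 2 / (1 - dot y y))); last first.
  by field; rewrite gt_eqF.
rewrite powRM ?ltW//; last by rewrite subr_gt0 ltr_pdivrMr// mul1r.
by congr (_ * _); rewrite powRN powR12_sqrt// ltW.
Qed.

Lemma integral_orthogonal n (Q : 'M[R]_n) (f : 'rV[R]_n -> \bar R) :
    Q *m Q^T = 1%:M -> measurable_fun setT f -> (forall x, 0 <= f x)%E ->
  (\int[lam n]_x f (x *m Q) = \int[lam n]_x f x)%E.
Proof.
move=> QQ mf f0; have uQ : Q \in unitmx by apply: (mulmx1_unit QQ).1.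
by rewrite -(change_of_variables_unitmx uQ mf f0) det_orthogonal// mul1e.
Qed.

Variables (D : nat) (m : probability 'rV[R]_D.+1 R) (c : R).
Hypothesis c0 : 0 <= c.
Hypothesis mE : forall B, measurable B ->
  m B = (\int[lam D.+1]_(x in B) (c * beta_weight (- 2^-1) x)%:E)%E.

Let h (x : 'rV[R]_D.+1) : R := c * beta_weight (- 2^-1) x.

Let mh : measurable_fun setT h.
Proof. by apply: measurable_funM => //; exact: measurable_beta_weight. Qed.

Let h0 x : 0 <= h x.
Proof. by rewrite mulr_ge0// beta_weight_ge0. Qed.

Lemma integral_beta_density (f : 'rV[R]_D.+1 -> \bar R) :
    measurable_fun setT f -> (forall x, 0 <= f x)%E ->
  (\int[lam D.+1]_x ((h x)%:E * f x) = \int[m]_x f x)%E.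
Proof. by move=> mf f0; apply/esym/ge0_integral_density. Qed.

Definition unif_density (y : 'rV[R]_D) : R := (ball_vol D)^-1 * (inball y)%:R.

Lemma unif_density_ge0 y : 0 <= unif_density y.
Proof. by rewrite mulr_ge0// invr_ge0 ltW// ball_vol_gt0. Qed.

Lemma measurable_unif_density : measurable_fun setT unif_density.
Proof.
apply: measurable_funM => //; apply: measurable_natr_bool.
by apply: measurable_inball; exact: measurable_id.
Qed.

(** The weight is rotation invariant, so [v] may be taken along the first axis; projecting then
    means forgetting the first coordinate, and [beta_slice] gives a constant density on the ball. *)
Lemma beta_projection_law (v : 'rV[R]_D.+1) : v != 0 ->
  exists Pi : 'M[R]_(D.+1, D), [/\ v *m Pi = 0,
    (forall u, u *m Pi = 0 -> exists k, u = k *: v) &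
    forall f : 'rV[R]_D -> \bar R, measurable_fun setT f -> (forall y, 0 <= f y)%E ->
      (\int[m]_x f (x *m Pi) = \int[lam D]_y ((unif_density y)%:E * f y))%E].
Proof.
move=> v0; have [Q [QQ vQ]] := orthogonal_to_axis v.
have uQ : Q \in unitmx by apply: (mulmx1_unit QQ).1.
pose Pi := \matrix_(i, j) Q i (lift ord0 j) : 'M[R]_(D.+1, D).
have PiE (u : 'rV[R]_D.+1) j : (u *m Pi) ord0 j = (u *m Q) ord0 (lift ord0 j).
  by rewrite !mxE; apply: eq_bigr => i _; rewrite !mxE.
have nv0 : enorm v != 0 by rewrite enorm_eq0.
exists Pi; split.
- by apply/rowP => j; rewrite PiE vQ !mxE /= mulr0.
- move=> u uPi; exists ((u *m Q) ord0 ord0 / enorm v).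
  apply: (can_inj (mulmxK uQ)); rewrite -scalemxAl vQ scalerA divfK//.
  apply/rowP => j; case: (unliftP ord0 j) => [i|] ->.
    by rewrite -PiE uPi !mxE /= mulr0.
  by rewrite [RHS]mxE [X in _ * X]mxE !eqxx mulr1.
pose tail (u : 'rV[R]_D.+1) := (rV_uncons u).2.
have mtail : measurable_fun setT tail.
  exact: (measurableT_comp measurable_snd (@measurable_rV_uncons R D)).
have tailE (u : 'rV[R]_D.+1) : u *m Pi = tail (u *m Q).
  by apply/rowP => j; rewrite PiE /tail /= mxE.
have step (f : 'rV[R]_D -> \bar R) : measurable_fun setT f -> (forall y, 0 <= f y)%E ->
    (\int[m]_x f (x *m Pi) = \int[lam D]_y ((c%:E * (Iv (inball y) * beta1C)) * f y))%E.
  move=> mf f0.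
  have mfPi : measurable_fun setT (fun x : 'rV[R]_D.+1 => f (x *m Pi)).
    exact: (measurableT_comp mf (measurable_fun_mulmxr Pi)).
  rewrite -integral_beta_density//.
  pose G (u : 'rV[R]_D.+1) := ((h u)%:E * f (tail u))%E.
  have mG : measurable_fun setT G.
    apply: emeasurable_funM; first exact/measurable_EFinP.
    exact: (measurableT_comp mf mtail).
  have G0 u : (0 <= G u)%E by rewrite mule_ge0// lee_fin.
  rewrite (_ : \int[lam D.+1]_x _ = \int[lam D.+1]_x G (x *m Q))%E; last first.
    apply: eq_integral => x _; rewrite /G -tailE /h !beta_weightE /inball.
    by rewrite dot_mulmx_orthogonal.
  rewrite integral_orthogonal// integral_lebesgue_rVS_swap//.
  apply: eq_integral => y _; rewrite -beta_slice.
  have mb : measurable_fun setT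
      (fun t : measurableTypeR R => (beta_weight (- 2^-1) (rV_cons (t, y)))%:E).
    apply/measurable_EFinP; apply: (measurableT_comp (@measurable_beta_weight _ _)).
    exact: measurable_rV_consl.
  have mcb : measurable_fun setT
      (fun t : measurableTypeR R => (c%:E * (beta_weight (- 2^-1) (rV_cons (t, y)))%:E)%E).
    by apply: emeasurable_funM.
  rewrite -(ge0_integralZT _ c0 mb); last by move=> t; rewrite lee_fin beta_weight_ge0.
  rewrite -ge0_integralZr//; last by move=> t _; rewrite mule_ge0// lee_fin// beta_weight_ge0.
  by apply: eq_integral => t _; rewrite /G /tail rV_consK /= /h EFinM.
have C0 : (0 <= beta1C)%E by apply: integral_ge0 => t _; rewrite lee_fin.
(* The case f = 1 determines the constant density: it must be 1 / kappa_D. *)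
have cC : (c%:E * beta1C * (ball_vol D)%:E = 1)%E.
  have := step (fun=> 1%E) (measurable_cst _) (fun=> lee01).
  have -> : (\int[m]_x 1 = 1)%E.
    by rewrite [LHS](integral_cst m measurableT) mul1e; exact: probability_setT.
  move=> ->; rewrite -integral_inball.
  have mI : measurable_fun setT (fun y : 'rV[R]_D => Iv (inball y) : \bar R).
    by apply: measurable_Iv; apply: measurable_inball; exact: measurable_id.
  rewrite -ge0_integralZl//.
  - by apply: eq_integral => y _; rewrite mule1 [(Iv _ * _)%E]muleC muleA.
  - by move=> y _; exact: Iv_ge0.
  - by rewrite mule_ge0.
have k0 := @ball_vol_gt0 R D.
have cCE : (c%:E * beta1C = ((ball_vol D)^-1)%:E)%E.
  rewrite -[LHS]mule1 -[X in (_ * X)%E](_ : (ball_vol D)%:E * ((ball_vol D)^-1)%:E = 1)%E.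
    by rewrite muleA cC mul1e.
  by rewrite -EFinM mulfV// gt_eqF.
move=> f mf f0; rewrite step//; apply: eq_integral => y _.
by rewrite [(Iv _ * _)%E]muleC muleA cCE /unif_density EFinM.
Qed.

End beta_projection.

(** * Probability that a line in a given direction meets the tangent cone *)

Section expected_angle.
Context {R : realType}.
Local Notation lam D := (@lebesgue_rV R D).
Variables (D : nat) (m : probability 'rV[R]_D.+1 R) (c : R).
Hypothesis c0 : 0 <= c.
Hypothesis mE : forall B, measurable B ->
  m B = (\int[lam D.+1]_(x in B) (c * beta_weight (- 2^-1) x)%:E)%E.

(** The probability that the first of D + 2 uniform points of the ball lies in the simplex of the
    others, by [integral_simplex_prob]; the power of kappa_D normalizes the D + 2 densities. *)
Definition sylvester_prob : \bar R :=
  (((ball_vol D)^-1 ^+ D.+2)%:E * (simplex_int D * (D`!%:R^-1)%:E))%E.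

Lemma sylvester_prob_ge0 : (0 <= sylvester_prob)%E.
Proof.
rewrite mule_ge0//; first by rewrite lee_fin exprn_ge0// invr_ge0 ltW// ball_vol_gt0.
rewrite mule_ge0// ?lee_fin ?invr_ge0//.
by apply: integral_ge0 => z _; rewrite mule_ge0 ?Iv_ge0.
Qed.

(** The law has a density, so the null set of [edgemx_null] stays null. *)
Lemma edgemx_null_beta :
  (\int[tuple_measure m D.+2]_x Iv (\det (edgemx x) == 0)%R = 0)%E.
Proof.
pose h (x : 'rV[R]_D.+1) : R := c * beta_weight (- 2^-1) x.
have mh : measurable_fun setT h.
  by apply: measurable_funM => //; exact: measurable_beta_weight.
have h0 x : 0 <= h x by rewrite mulr_ge0// beta_weight_ge0.
have mb : measurable_fun setT (fun x : D.+2.-tuple 'rV[R]_D.+1 => \det (edgemx x) == 0).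
  by apply: measurable_det_edgemx_eq0; exact: measurable_id.
have mIb := @measurable_Iv R _ _ _ mb.
rewrite -(integral_tuple_map (@measurable_id _ _ setT) mh h0 (integral_beta_density c0 mE)
  mIb (fun=> Iv_ge0 _)).
rewrite -(integral0 (tuple_measure (lam D.+1) D.+2) setT).
have mid : measurable_fun setT (fun x : D.+2.-tuple 'rV[R]_D.+1 =>
    Iv (\det (edgemx (map_tuple id x)) == 0) : \bar R).
  exact: (measurableT_comp mIb (measurable_map_tuple (@measurable_id _ _ setT) (n := D.+2))).
apply: (eq_integral_null mb) => //.
- exact: edgemx_null.
- by apply: emeasurable_funM => //; apply/measurable_EFinP; exact: measurable_prod_tnth.
- by move=> x; rewrite mule_ge0 ?Iv_ge0// lee_fin prodr_ge0.
- move=> x dx; rewrite (_ : map_tuple id x = x); last by apply/val_inj; rewrite /= map_id.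
  by rewrite /Iv (negbTE dx) mule0.
Qed.

(** The value is the same for all [v], so the average over directions can be taken last. The guard
    on the determinant is there because [in_cone] accepts everything for a singular matrix. *)
Lemma cone_projection_prob (v : 'rV[R]_D.+1) : v != 0 ->
  (\int[tuple_measure m D.+2]_x
     (Iv ((\det (edgemx x) != 0)%R && in_cone (edgemx x) v) +
      Iv ((\det (edgemx x) != 0)%R && in_cone (edgemx x) (- v)%R)) = sylvester_prob)%E.
Proof.
move=> v0; have [Pi [vPi kerPi lawPi]] := beta_projection_law c0 mE v0.
have mphi := measurable_fun_mulmxr Pi.
pose phi : {mfun 'rV[R]_D.+1 >-> 'rV[R]_D} :=
  HB.pack (fun x : 'rV[R]_D.+1 => x *m Pi) (isMeasurableFun.Build _ _ _ _ _ mphi).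
(* The law of a projected point, as a pushforward of [m] and by its uniform density; [map_phi]
   combines both readings on tuples. *)
pose pm : probability 'rV[R]_D R := distribution m phi.
have int1 (f : 'rV[R]_D -> \bar R) : measurable_fun setT f -> (forall y, 0 <= f y)%E ->
    (\int[m]_x (1%:E * f (x *m Pi)%R) = \int[pm]_y f y)%E.
  move=> mf f0; rewrite [RHS](ge0_integral_pushforward mphi)//.
  by apply: eq_integral => x _; rewrite mul1e.
have int2 (f : 'rV[R]_D -> \bar R) : measurable_fun setT f -> (forall y, 0 <= f y)%E ->
    (\int[lam D]_y ((unif_density y)%:E * f (id y)) = \int[pm]_y f y)%E.
  move=> mf f0; rewrite -lawPi// -int1//.
  by apply: eq_integral => x _; rewrite mul1e.
have m1 : measurable_fun setT (fun _ : 'rV[R]_D.+1 => 1 : R) by [].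
have map_phi (f : D.+2.-tuple 'rV[R]_D -> \bar R) :
    measurable_fun setT f -> (forall z, 0 <= f z)%E ->
    (\int[tuple_measure m D.+2]_x f (map_tuple (fun u => u *m Pi) x) =
     \int[tuple_measure (lam D) D.+2]_z (((ball_vol D)^-1 ^+ D.+2)%:E *
        (Iv [forall i, inball (tnth z i)] * f z)))%E.
  move=> mf f0.
  transitivity (\int[tuple_measure pm D.+2]_z f z)%E.
    rewrite -(integral_tuple_map mphi m1 (fun=> ler01) int1 mf f0).
    by apply: eq_integral => x _; rewrite big1// mul1e.
  rewrite -(integral_tuple_map (@measurable_id _ _ setT) (@measurable_unif_density R D)
    (@unif_density_ge0 R D) int2 mf f0).
  apply: eq_integral => z _; rewrite (_ : map_tuple id z = z); last first.
    by apply/val_inj; rewrite /= map_id.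
  rewrite muleA Iv_forall -EFinM; congr (_%:E * _)%E.
  by rewrite /unif_density big_split /= prodr_const card_ord.
pose t (x : D.+2.-tuple 'rV[R]_D.+1) : D.+1.-tuple 'rV[R]_D :=
  (tuncons (map_tuple (fun u => u *m Pi) x)).2.
have mmap : measurable_fun setT
    (fun x : D.+2.-tuple 'rV[R]_D.+1 => map_tuple (fun u => u *m Pi) x).
  exact: measurable_map_tuple.
have mtail : measurable_fun setT (fun z : D.+2.-tuple 'rV[R]_D => (tuncons z).2).
  exact: (measurableT_comp measurable_snd (@measurable_tuncons _ _ D.+1)).
have mt : measurable_fun setT t by exact: (measurableT_comp mtail mmap).
have mb1 : measurable_fun setT (fun x : D.+2.-tuple 'rV[R]_D.+1 => \det (edgemx x) == 0).
  by apply: measurable_det_edgemx_eq0; exact: measurable_id.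
have mb2 : measurable_fun setT (fun x => \det (edgemx (t x)) == 0).
  exact: measurable_det_edgemx_eq0.
have mS : measurable_fun setT (fun z : D.+2.-tuple 'rV[R]_D =>
    Iv (in_simplex (tuncons z).1 (tuncons z).2) : \bar R).
  apply: measurable_Iv; apply: measurable_in_simplex => //.
  exact: (measurableT_comp measurable_fst (@measurable_tuncons _ _ D.+1)).
(* The projections of independent points may be degenerate in their turn; this event is null as
   well. *)
have nullt : (\int[tuple_measure m D.+2]_x Iv (\det (edgemx (t x)) == 0)%R = 0)%E.
  have mI : measurable_fun setT (fun z : D.+2.-tuple 'rV[R]_D =>
      Iv (\det (edgemx (tuncons z).2) == 0) : \bar R).
    by apply: measurable_Iv; exact: measurable_det_edgemx_eq0.
  rewrite (map_phi _ mI (fun=> Iv_ge0 _)).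
  have mbz : measurable_fun setT (fun z : D.+2.-tuple 'rV[R]_D =>
      \det (edgemx (tuncons z).2) == 0) by exact: measurable_det_edgemx_eq0.
  rewrite -(integral0 (tuple_measure (lam D) D.+2) setT).
  apply: (eq_integral_null mbz) => //.
  - rewrite (integral_tupleS _ mI (fun=> Iv_ge0 _)); apply: integral0_eq => y _.
    by rewrite -[RHS](@edgemx_null R D); apply: eq_integral => z _; rewrite tconsK.
  - apply: emeasurable_funM => //; apply: emeasurable_funM => //.
    by apply: measurable_Iv; apply: measurable_all_inball; exact: measurable_id.
  - move=> z; rewrite mule_ge0// ?mule_ge0 ?Iv_ge0// lee_fin exprn_ge0//.
    by rewrite invr_ge0 ltW// ball_vol_gt0.
  - by move=> z dz; rewrite /Iv (negbTE dz) !mule0.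
have nullb : (\int[tuple_measure m D.+2]_x
    Iv ((\det (edgemx x) == 0) || (\det (edgemx (t x)) == 0))%R = 0)%E.
  rewrite -nullt; apply: (eq_integral_null mb1 edgemx_null_beta).
  - by apply: measurable_Iv; exact: measurable_or.
  - exact: measurable_Iv.
  - by move=> x; exact: Iv_ge0.
  - by move=> x; exact: Iv_ge0.
  - by move=> x /negbTE ->.
transitivity (\int[tuple_measure m D.+2]_x Iv (in_simplex
    (tuncons (map_tuple (fun u => u *m Pi) x)).1 (t x)))%E; last first.
  rewrite (map_phi _ mS (fun=> Iv_ge0 _)) ge0_integralZT.
  - rewrite /sylvester_prob -integral_simplex_prob; congr (_ * _)%E.
    by apply: eq_integral => z _; rewrite IvM.
  - by rewrite exprn_ge0// invr_ge0 ltW// ball_vol_gt0.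
  - apply: emeasurable_funM => //; apply: measurable_Iv.
    by apply: measurable_all_inball; exact: measurable_id.
  - by move=> z; rewrite mule_ge0 ?Iv_ge0.
have mcone (u : 'rV[R]_D.+1) : measurable_fun setT (fun x : D.+2.-tuple 'rV[R]_D.+1 =>
    Iv ((\det (edgemx x) != 0) && in_cone (edgemx x) u) : \bar R).
  apply: measurable_Iv; apply: measurable_and; first exact: measurable_neg.
  by apply: measurable_in_cone => //; apply: measurable_edgemx; exact: measurable_id.
apply: (eq_integral_null (measurable_or mb1 mb2) nullb).
- exact: emeasurable_funD.
- exact: (measurableT_comp mS mmap).
- by move=> x; rewrite adde_ge0 ?Iv_ge0.
- by move=> x; exact: Iv_ge0.
move=> x; rewrite negb_or => /andP[dx dt]; rewrite dx !andTb.
have tE j : tnth (t x) j = tnth x (lift ord0 j) *m Pi.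
  by rewrite tnth_tuncons tnth_map.
have y0E : (tuncons (map_tuple (fun u => u *m Pi) x)).1 = tnth x ord0 *m Pi.
  by rewrite /tuncons /thead /= tnth_map.
by rewrite y0E /Iv -(in_cone_projection v0 vPi kerPi tE dx dt) -EFinD -natrD.
Qed.

End expected_angle.

(** * Expected angle at one vertex and expected sum of angles *)

Section expected_angle_sum.
Context {R : realType}.
Local Notation lam D := (@lebesgue_rV R D).
Local Notation mu := (@lebesgue_measure R).

Lemma slice_int_gt0 k : 0 < slice_int k :> R.
Proof. by have := @ball_vol_gt0 R k.+1; rewrite ball_volS pmulr_rgt0// ball_vol_gt0. Qed.

Definition sylvester_val D : R :=
  (ball_vol D)^-1 ^+ D.+2 *
  (ball_vol D.+1 ^+ D.+1 / (slice_int (D * D.+2) * (ball_vol D.+1 * D.+1%:R / 2)) *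
   D`!%:R^-1).

Lemma sylvester_probE D : sylvester_prob D = (sylvester_val D)%:E.
Proof.
have := @kingman R D; set w := slice_int _ * _ => K.
have w0 : 0 < w by rewrite mulr_gt0 ?slice_int_gt0// divr_gt0// mulr_gt0// ball_vol_gt0.
have SE : simplex_int D = (ball_vol D.+1 ^+ D.+1 / w)%:E.
  (* An infinite [simplex_int] would make the right side of Kingman's identity infinite, but the
     left side is finite. *)
  case: (simplex_int D) K => [r| |].
  - by rewrite -EFinM => -[->]; rewrite mulfK// gt_eqF.
  - by rewrite gt0_mulye ?lte_fin.
  - by rewrite gt0_mulNye ?lte_fin.
by rewrite /sylvester_prob SE -!EFinM.
Qed.

Lemma rV_null0 D : (\int[lam D.+1]_v Iv (v == 0)%R = 0)%E.
Proof.
have E (v : 'rV[R]_D.+1) : (v == 0) = (dot v v == 0) by rewrite dot_eq0.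
under eq_integral do rewrite E.
have mb : measurable_fun setT (fun v : 'rV[R]_D.+1 => dot v v == 0).
  by apply: measurable_fun_eqr => //; apply: measurable_dot; exact: measurable_id.
have mI := @measurable_Iv R _ _ _ mb.
rewrite (integral_lebesgue_rVS mI (fun=> Iv_ge0 _)) -(integral0 mu setT).
apply: (@eq_integral_null R _ (measurableTypeR R) mu (fun x => x == 0)) => //.
- exact: measurable_fun_eqr.
- exact: integral_set1_Iv.
- apply: (measurable_fun_fubini_tonelli_F
    (fun p : measurableTypeR R * 'rV[R]_D => Iv (dot (rV_cons p) (rV_cons p) == 0) : \bar R)).
    exact: (measurableT_comp mI (@measurable_rV_cons R D)).
  by move=> p; exact: Iv_ge0.
- by move=> x; apply: integral_ge0 => u _; exact: Iv_ge0.
- move=> x x0; apply: integral0_eq => u _; rewrite dot_rV_cons /Iv.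
  by rewrite gt_eqF// ltr_pwDl// ?dot_ge0// lt_neqAle eq_sym mulf_neq0//= -expr2 sqr_ge0.
Qed.

Let in_angle D (x : D.+2.-tuple 'rV[R]_D.+1) (v : 'rV[R]_D.+1) : bool :=
  (\det (edgemx x) != 0) && in_cone (edgemx x) v.

(** A measurable version of the angle at the first vertex, equal to 0 for degenerate
    configurations. *)
Let angle D (x : D.+2.-tuple 'rV[R]_D.+1) : \bar R :=
  ((ball_vol D.+1)^-1%:E * \int[lam D.+1]_v (Iv (inball v) * Iv (in_angle x v)))%E.

Let measurable_in_angle D : measurable_fun setT
  (fun p : D.+2.-tuple 'rV[R]_D.+1 * 'rV[R]_D.+1 => Iv (in_angle p.1 p.2) : \bar R).
Proof.
have me : measurable_mx (fun p : D.+2.-tuple 'rV[R]_D.+1 * 'rV[R]_D.+1 => edgemx p.1).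
  by apply: measurable_edgemx; exact: measurable_fst.
apply: measurable_Iv; apply: measurable_and; last exact: measurable_in_cone.
by apply: measurable_neg; apply: measurable_det_edgemx_eq0; exact: measurable_fst.
Qed.

Let measurable_ball_angle D : measurable_fun setT
  (fun p : D.+2.-tuple 'rV[R]_D.+1 * 'rV[R]_D.+1 =>
    (Iv (inball p.2) * Iv (in_angle p.1 p.2) : \bar R)%E).
Proof.
apply: emeasurable_funM; last exact: measurable_in_angle.
by apply: measurable_Iv; apply: measurable_inball; exact: measurable_snd.
Qed.

Let ball_angle_ge0 D (p : D.+2.-tuple 'rV[R]_D.+1 * 'rV[R]_D.+1) :
  (0 <= Iv (inball p.2) * Iv (in_angle p.1 p.2) :> \bar R)%E.
Proof. by rewrite mule_ge0 ?Iv_ge0. Qed.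

Let measurable_angle D : measurable_fun setT (@angle D).
Proof.
apply: emeasurable_funM => //.
exact: (measurable_fun_fubini_tonelli_F _ (@measurable_ball_angle D) (@ball_angle_ge0 D)).
Qed.

Let angle_ge0 D x : (0 <= @angle D x)%E.
Proof.
rewrite mule_ge0//; first by rewrite lee_fin invr_ge0 ltW// ball_vol_gt0.
by apply: integral_ge0 => v _; rewrite mule_ge0 ?Iv_ge0.
Qed.

Let angle_internal D (x : D.+2.-tuple 'rV[R]_D.+1) : \det (edgemx x) != 0 ->
  ((internal_angle (conv_hull (range (tnth x))) (tnth x ord0))%:E = angle x)%E.
Proof.
move=> dx; rewrite simplex_angleE//; congr (_ * _)%E; apply: eq_integral => v _.
by rewrite /in_angle dx IvM.
Qed.

(** Tonelli brings the integral over directions outside. The ball is symmetric, so twice that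
    integral collects the probabilities for v and -v together, which [cone_projection_prob]
    evaluates. *)
Lemma expected_angle D (m : probability 'rV[R]_D.+1 R) (c : R) : 0 <= c ->
    (forall B, measurable B ->
      m B = (\int[lam D.+1]_(x in B) (c * beta_weight (- 2^-1) x)%:E)%E) ->
  (\int[tuple_measure m D.+2]_x angle x = (sylvester_val D / 2)%:E)%E.
Proof.
move=> c0 mE; have k0 := @ball_vol_gt0 R D.+1.
rewrite /angle ge0_integralZT; last 3 first.
- by rewrite invr_ge0 ltW.
- exact: (measurable_fun_fubini_tonelli_F _ (@measurable_ball_angle D) (@ball_angle_ge0 D)).
- by move=> x; apply: integral_ge0 => v _; exact: (ball_angle_ge0 (x, v)).
rewrite (fubini_tonelli _ (@measurable_ball_angle D) (@ball_angle_ge0 D)) /=.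
have [H HE] : exists H : 'rV[R]_D.+1 -> \bar R, forall v,
    H v = (\int[tuple_measure m D.+2]_x Iv (in_angle x v))%E by eexists.
have mH : measurable_fun setT H.
  rewrite (funext HE); exact: (measurable_fun_fubini_tonelli_G _ (@measurable_in_angle D) (fun=> Iv_ge0 _)).
have H0 v : (0 <= H v)%E by rewrite HE; apply: integral_ge0 => x _; exact: Iv_ge0.
have mB : measurable_fun setT (fun v : 'rV[R]_D.+1 => Iv (inball v) : \bar R).
  by apply: measurable_Iv; apply: measurable_inball; exact: measurable_id.
pose J := (\int[lam D.+1]_v (Iv (inball v) * H v))%E.
have mJ : measurable_fun setT (fun v => Iv (inball v) * H v)%E by exact: emeasurable_funM.
have J0 v : (0 <= Iv (inball v) * H v)%E by rewrite mule_ge0 ?Iv_ge0.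
rewrite (_ : \int[lam D.+1]_v _ = J)%E; last first.
  apply: eq_integral => v _; rewrite HE ge0_integralZT//.
  - exact: (measurableT_comp (@measurable_in_angle D) (pair2_measurable v)).
  - by move=> x; exact: Iv_ge0.
have N1 : (-1 != 0 :> R) by rewrite oppr_eq0 oner_eq0.
have mN : measurable_fun setT (fun v : 'rV[R]_D.+1 => - v).
  apply/measurable_mxP => i j; under eq_fun do rewrite mxE.
  by apply: measurable_funN; rewrite ord1; exact: measurable_rV_coord.
have JN : (J = \int[lam D.+1]_v (Iv (inball v) * H (- v)%R))%E.
  rewrite /J -(integral_scale N1 mJ J0) normrN1 expr1n mul1e.
  by apply: eq_integral => v _; rewrite scaleN1r /inball dotNl dotNr opprK.
have mHN : measurable_fun setT (fun v => Iv (inball v) * H (- v)%R)%E.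
  by apply: emeasurable_funM => //; exact: (measurableT_comp mH mN).
have JNE0 v : (0 <= Iv (inball v) * H (- v)%R)%E by rewrite mule_ge0 ?Iv_ge0 ?H0.
have JJ : (J + J = (ball_vol D.+1 * sylvester_val D)%:E)%E.
  rewrite {2}JN /J -ge0_integralD//.
  transitivity (\int[lam D.+1]_v ((sylvester_val D)%:E * Iv (inball v)))%E; last first.
    have s0 : 0 <= sylvester_val D.
      by rewrite -lee_fin -sylvester_probE sylvester_prob_ge0.
    rewrite (ge0_integralZT _ s0 mB (fun=> Iv_ge0 _)) integral_inball.
    by rewrite -EFinM mulrC.
  have mv0 : measurable_fun setT (fun v : 'rV[R]_D.+1 => v == 0).
    rewrite (_ : (fun v => _) = (fun v : 'rV[R]_D.+1 => dot v v == 0)).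
      by apply: measurable_fun_eqr => //; apply: measurable_dot; exact: measurable_id.
    by apply/funext => v; rewrite dot_eq0.
  apply: (eq_integral_null mv0 (rV_null0 D)).
  - exact: emeasurable_funD.
  - exact: emeasurable_funM.
  - by move=> v; rewrite adde_ge0.
  - move=> v; rewrite mule_ge0 ?Iv_ge0//.
    by rewrite -sylvester_probE sylvester_prob_ge0.
  - move=> v v0; rewrite -ge0_muleDr// muleC; congr (_ * _)%E.
    rewrite !HE -sylvester_probE -(cone_projection_prob c0 mE v0) ge0_integralD//.
    + by move=> x _; exact: Iv_ge0.
    + exact: (measurableT_comp (@measurable_in_angle D) (pair2_measurable v)).
    + by move=> x _; exact: Iv_ge0.
    + exact: (measurableT_comp (@measurable_in_angle D) (pair2_measurable (- v))).
(* Halving takes place among real numbers: the identity for J + J rules out infinite values. *)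
have : J = (ball_vol D.+1 * sylvester_val D / 2)%:E.
  clear JN; case: J JJ => [r| |] //; rewrite -EFinD => -[rr]; congr EFin.
  by rewrite -rr; field.
by move=> ->; rewrite -EFinM; congr EFin; field; rewrite gt_eqF.
Qed.

(** Serves for the transpositions that bring a given vertex to the first place. *)
Lemma mutually_independent_involution d (Omega : measurableType d)
    (P : probability Omega R) d' (T : measurableType d') n
    (X : 'I_n -> {RV P >-> T}) (s : 'I_n -> 'I_n) :
  involutive s -> mutually_independent X -> mutually_independent (fun k => X (s k)).
Proof.
move=> sK indX J B mB; have := indX (s @: J)%SET (fun i => B (s i)) (fun i => mB _).
rewrite (_ : \bigcap_(i in [set` (s @: J)%SET]) _ =
    \bigcap_(i in [set` J]) X (s i) @^-1` B i); last first.
  apply/seteqP; split => w /= h i.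
    by move=> iJ; have := h (s i) (imset_f _ iJ); rewrite sK.
  by move=> /imsetP[k kJ ->]; rewrite sK; exact: h.
move=> ->; rewrite big_imset/=; last by move=> ? ? _ _; exact: (inv_inj sK).
by apply: eq_bigr => i _; rewrite sK.
Qed.

(** A negative [c] would give mass at most 0 instead of 1. The normalization is recorded because it
    determines [c], hence makes the points identically distributed. *)
Lemma beta_law d (Omega : measurableType d) (P : probability Omega R) D
    (X : {RV P >-> 'rV[R]_D.+1}) :
    has_density_proportional_to X (@beta_weight R (- 2^-1) D.+1) ->
  exists2 c : R, 0 <= c & (c%:E * \int[lam D.+1]_x (beta_weight (- 2^-1) x)%:E = 1)%E /\
    forall B, measurable B -> distribution P X B =
      (\int[lam D.+1]_(x in B) (c * beta_weight (- 2^-1) x)%:E)%E.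
Proof.
move=> [c cX].
have mw : measurable_fun setT
    (fun x : 'rV[R]_D.+1 => (beta_weight (- 2^-1) x)%:E).
  by apply/measurable_EFinP; exact: measurable_beta_weight.
have w0 (x : 'rV[R]_D.+1) : (0 <= (beta_weight (- 2^-1) x)%:E)%E.
  by rewrite lee_fin beta_weight_ge0.
have := cX setT measurableT; rewrite probability_setT => E.
have c0 : 0 <= c.
  rewrite leNgt; apply/negP => cneg; move: E.
  rewrite (eq_integral (fun x => (- (- c * beta_weight (- 2^-1) x)%:E)%E)); last first.
    by move=> x _; rewrite mulNr EFinN oppeK.
  rewrite integral_ge0N; last first.
    by move=> x _; rewrite EFinM mule_ge0// lee_fin oppr_ge0 ltW.
  have I0 : (0 <= \int[lam D.+1]_x (- c * beta_weight (- 2^-1) x)%:E)%E.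
    by apply: integral_ge0 => x _; rewrite EFinM mule_ge0// lee_fin oppr_ge0 ltW.
  move=> E; have : (1%E <= 0 :> \bar R)%E by rewrite E oppe_le0.
  by rewrite lee_fin ler10.
exists c => //; split=> //.
by rewrite -ge0_integralZT// -[RHS]E; apply: eq_integral => x _; rewrite EFinM.
Qed.

Theorem expected_vertex_angle_sum d (Omega : measurableType d) (P : probability Omega R)
    D (X : 'I_D.+2 -> {RV P >-> 'rV[R]_D.+1}) :
    mutually_independent X ->
    (forall i, has_density_proportional_to (X i) (@beta_weight R (- 2^-1) D.+1)) ->
  ('E_P[fun w => vertex_angle_sum (fun i => X i w)] =
   (D.+2%:R * (sylvester_val D / 2))%:E)%E.
Proof.
move=> indX densX.
pose m : probability 'rV[R]_D.+1 R := distribution P (X ord0).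
have [c c0 [cI mE]] := beta_law (densX ord0).
have lawX i A : measurable A -> P (X i @^-1` A) = m A.
  move=> mA; have [e e0 [eI eE]] := beta_law (densX i).
  suff ec : e = c.
    by rewrite -[LHS]/(distribution P (X i) A) (eE A mA) ec; exact: esym (mE A mA).
  (* Mass 1 excludes an infinite integral of the weight, so both constants are its reciprocal. *)
  case: (\int[lam D.+1]_x _)%E cI eI => [r| |].
  - rewrite -!EFinM => -[cr] [er].
    have r0 : r != 0 by apply/eqP => r0; move: cr; rewrite r0 mulr0 => /eqP; rewrite eq_sym oner_eq0.
    by apply: (mulIf r0); rewrite cr er.
  - move: c0; rewrite le_eqVlt => /predU1P[<-|c_gt0].
      by rewrite mul0e => -[] /eqP; rewrite eq_sym oner_eq0.
    by rewrite gt0_muley ?lte_fin.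
  - move: c0; rewrite le_eqVlt => /predU1P[<-|c_gt0].
      by rewrite mul0e => -[] /eqP; rewrite eq_sym oner_eq0.
    by rewrite gt0_muleNy ?lte_fin.
(* The configuration with vertices 0 and i exchanged: [edgemx] and [angle] single out the first
   vertex, and the hull is unchanged. *)
pose x (i : 'I_D.+2) (w : Omega) : D.+2.-tuple 'rV[R]_D.+1 :=
  [tuple X (tperm ord0 i k) w | k < D.+2].
have int_x i (f : D.+2.-tuple 'rV[R]_D.+1 -> \bar R) :
    measurable_fun setT f -> (forall t, 0 <= f t)%E ->
    (\int[P]_w f (x i w) = \int[tuple_measure m D.+2]_t f t)%E.
  apply: (integral_independent (X := fun k => X (tperm ord0 i k))).
    by apply: mutually_independent_involution => //; exact: tpermK.
  by move=> k A mA; exact: lawX.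
have mx i : measurable_fun setT (x i).
  exact: (measurable_mktuple_RV (fun k => X (tperm ord0 i k))).
have range_x i w : range (tnth (x i w)) = range (fun k => X k w).
  apply/seteqP; split => _ [k _ <-].
    by exists (tperm ord0 i k) => //; rewrite tnth_mktuple.
  by exists (tperm ord0 i k) => //; rewrite tnth_mktuple tpermK.
have x0 i w : tnth (x i w) ord0 = X i w by rewrite tnth_mktuple tpermL.
(* The exceptional event is taken over all vertices, so that off it every angle formula applies; its
   mass is at most a sum of null masses. *)
pose b w := [exists i, \det (edgemx (x i w)) == 0].
have mbi i : measurable_fun setT (fun w => \det (edgemx (x i w)) == 0).
  exact: measurable_det_edgemx_eq0.
have mb : measurable_fun setT b.
  rewrite (_ : b = (fun w => ~~ [forall i, \det (edgemx (x i w)) != 0])).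
    by apply: measurable_neg; apply: measurable_forall => i; exact: measurable_neg.
  by apply/funext => w; rewrite negb_forall; apply: eq_existsb => i; rewrite negbK.
have b0 : (\int[P]_w Iv (b w) = 0)%E.
  apply/eqP; rewrite eq_le; apply/andP; split; last first.
    by apply: integral_ge0 => w _; exact: Iv_ge0.
  apply: (@le_trans _ _ (\int[P]_w \sum_(i < D.+2) Iv (\det (edgemx (x i w)) == 0)%R)%E).
    apply: ge0_le_integral => //.
    - by move=> w _; exact: Iv_ge0.
    - exact: measurable_Iv.
    - by apply: emeasurable_sum => i; exact: measurable_Iv.
    - move=> w _; rewrite /b; case: existsP => [[i di]|_]; last first.
        by apply: sume_ge0 => i _; exact: Iv_ge0.
      rewrite (bigD1 i)//= di leeDl// sume_ge0// => j _; exact: Iv_ge0.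
  rewrite ge0_integral_sum//; last 2 first.
  - by move=> i; exact: measurable_Iv.
  - by move=> i w _; exact: Iv_ge0.
  rewrite big1// => i _.
  have md0 : measurable_fun setT (fun t : D.+2.-tuple 'rV[R]_D.+1 =>
      Iv (\det (edgemx t) == 0) : \bar R).
    by apply: measurable_Iv; apply: measurable_det_edgemx_eq0; exact: measurable_id.
  by rewrite (int_x i _ md0 (fun=> Iv_ge0 _)); exact: edgemx_null_beta c0 mE.
have mg i : measurable_fun setT (fun w => angle (x i w)).
  exact: (measurableT_comp (@measurable_angle D) (mx i)).
rewrite unlock /=.
transitivity (\int[P]_w \sum_(i < D.+2) angle (x i w))%E.
  apply: (ge0_integral_off_null mb b0).
  - exact: emeasurable_sum.
  - move=> w; rewrite lee_fin; apply: sumr_ge0 => i _.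
    by apply: fine_ge0; exact: measure_ge0.
  - by move=> w; apply: sume_ge0 => i _; exact: angle_ge0.
  - move=> w; rewrite /b negb_exists => /forallP dx.
    rewrite /vertex_angle_sum -sumEFin; apply: eq_bigr => i _.
    by rewrite -angle_internal// range_x x0.
rewrite ge0_integral_sum//.
under eq_bigr do rewrite (int_x _ _ (@measurable_angle D) (@angle_ge0 D)) (expected_angle c0 mE).
by rewrite sumEFin sumr_const card_ord mulr_natl.
Qed.

End expected_angle_sum.

(** * The Gamma function at half-integers *)

Section gamma_function.
Context {R : realType}.
Local Notation lam D := (@lebesgue_rV R D).
Local Notation mu := (@lebesgue_measure R).
Local Open Scope ereal_scope.

Lemma integral_expRN_tail (r : R) :
  \int[mu]_u (Iv (r < u)%R * (expR (- u))%:E) = (expR (- r))%:E.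
Proof.
have cN : continuous (fun x : R => expR (- x)%R).
  move=> z; apply: continuous_comp; last exact: continuous_expR.
  exact: opp_continuous.
have dN (x : R) : is_derive x (1%R : R) (fun x => - expR (- x))%R (expR (- x)).
  by apply: is_derive_eq; rewrite mulrN1 opprK.
transitivity (\int[mu]_(u in `]r, +oo[) (expR (- u))%:E).
  rewrite [RHS]integral_mkcond; apply: eq_integral => u _.
  rewrite patchE /Iv; case: ifPn => [|ru].
    by rewrite inE /= in_itv/= andbT => ->; rewrite mul1e.
  have -> : (r < u)%R = false.
    by apply/negbTE; apply: contra ru => ru; rewrite inE /= in_itv/= andbT.
  by rewrite mul0e.
rewrite integral_itv_obnd_cbnd; last first.
  apply/measurable_EFinP; apply: measurable_funTS.
  exact: continuous_measurable_fun.
rewrite (@ge0_continuous_FTC2y _ _ (fun x => - expR (- x))%R _ 0%R)//.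
- by rewrite EFinN oppeK add0e.
- exact: continuous_subspaceT.
- by rewrite -oppr0; apply: cvgN; exact: cvgr_expR.
- by apply: cvgN; apply/cvg_at_right_filter; exact: cN.
- by move=> x _; rewrite derive1E; exact: derive_val.
Qed.

(** For z < 1 the integrand is unbounded at 0, so the fundamental theorem of calculus is applied on
    intervals [a_i, u] that exhaust ]0, u]. *)
Lemma integral_powR_itv0 (z u : R) : (0 < z)%R -> (0 < u)%R ->
  \int[mu]_(s in `]0%R, u[) (z * s `^ (z - 1))%:E = (u `^ z)%:E.
Proof.
move=> z0 u0.
pose f (s : R) := (z * s `^ (z - 1))%R.
have mf : measurable_fun setT f by apply: measurable_funM => //; exact: measurable_powR.
have f0 (s : R) : (0 <= f s)%R by rewrite mulr_ge0 ?powR_ge0// ltW.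
(* The offset 2 keeps a_i < u already for i = 0. *)
pose a (i : nat) : R := (u / i.+2%:R)%R.
have a0 i : (0 < a i)%R by rewrite divr_gt0.
have au i : (a i < u)%R by rewrite ltr_pdivrMr// ltr_pMr// ltr1n.
have cpow (p x : R) : (0 < x)%R -> {for x, continuous (fun s : R => s `^ p)%R}.
  move=> x0; apply: differentiable_continuous; apply/derivable1_diffP.
  by have [] := is_derive1_powR p x0.
pose F (i : nat) := `[a i, u]%classic : set (measurableTypeR R).
have FE : \bigcup_i F i = `]0%R, u]%classic.
  apply/seteqP; split => [x [i _]|x].
    rewrite /F /= !in_itv/= => /andP[ax ->]; rewrite andbT.
    exact: lt_le_trans (a0 i) ax.
  rewrite /= in_itv/= => /andP[x0 xu]; exists (Num.truncn (u / x)) => //.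
  rewrite /F /= in_itv/= xu andbT ler_pdivrMr// mulrC -ler_pdivrMr//.
  apply: ltW; apply: lt_trans (truncnS_gt _) _; rewrite ?ltr_nat//.
have intF i : \int[mu]_(s in F i) (f s)%:E = (u `^ z - a i `^ z)%:E.
  rewrite /F (@continuous_FTC2 _ f (fun s : R => s `^ z)%R (a i) u (au i))//.
  - apply: continuous_in_subspaceT => x; rewrite inE /= in_itv/= => /andP[ax _].
    apply: cvgM; first exact: cvg_cst.
    by apply: cpow; exact: lt_le_trans (a0 i) ax.
  - split.
    + move=> x; rewrite in_itv/= => /andP[ax _].
      by have [] := is_derive1_powR z (lt_trans (a0 i) ax).
    + by apply: cvg_at_right_filter; exact: cpow.
    + by apply: cvg_at_left_filter; exact: cpow.
  - move=> x; rewrite in_itv/= => /andP[ax _]; apply: powR_derive1.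
    by rewrite in_itv/= andbT (lt_trans (a0 i) ax).
have : \int[mu]_(s in F i) (f s)%:E @[i --> \oo] --> \int[mu]_(s in \bigcup_i F i) (f s)%:E.
  apply: ge0_nondecreasing_set_cvg_integral.
  - move=> i j ij; apply/subsetPset => x; rewrite /F /= !in_itv/= => /andP[ax ->].
    by rewrite andbT (le_trans _ ax)// ler_pM2l// lef_pV2 ?posrE// ler_nat !ltnS.
  - by move=> i; exact: measurable_itv.
  - by move=> i; apply/measurable_EFinP; exact: measurable_funTS.
  - by move=> i x _; rewrite lee_fin f0.
have cvF : \int[mu]_(s in F i) (f s)%:E @[i --> \oo] --> (u `^ z)%:E.
  under eq_fun do rewrite intF.
  apply: cvg_EFin; first exact: nearW.
  rewrite [X in X @ _ --> _](_ : _ = fun i => (u `^ z - a i `^ z)%R)//.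
  rewrite -[X in _ --> X](subr0 (u `^ z)%R); apply: cvgB; first exact: cvg_cst.
  have /cvg_at_rightP := powR_cvg0 z0; apply; split=> //.
  rewrite -[X in _ --> X](mulr0 u); apply: cvgM; first exact: cvg_cst.
  by have := @cvg_harmonic R; rewrite -cvg_shiftS.
rewrite FE => /(cvg_unique (@ereal_hausdorff R)) => /(_ _ cvF) <-.
by rewrite [RHS]integral_itv_bndoo//; apply/measurable_EFinP; exact: measurable_funTS.
Qed.

Definition gamma_kernel (z t : R) : \bar R :=
  Iv (0 < t)%R * (t `^ (z - 1) * expR (- t))%:E.

Lemma gamma_kernel_ge0 z t : 0 <= gamma_kernel z t.
Proof. by rewrite mule_ge0 ?Iv_ge0// lee_fin mulr_ge0 ?powR_ge0 ?expR_ge0. Qed.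

Let measurable_expRN : measurable_fun setT (fun t : measurableTypeR R => expR (- t)).
Proof. by apply: (measurableT_comp (@measurable_expR R)); exact: oppr_measurable. Qed.

Let measurable_powR1 (z : R) : measurable_fun setT (fun t : measurableTypeR R => t `^ z)%R.
Proof. exact: measurable_powR. Qed.

Lemma measurable_gamma_kernel z :
  measurable_fun setT (gamma_kernel z : measurableTypeR R -> \bar R).
Proof.
apply: emeasurable_funM.
  by apply: measurable_Iv; exact: measurable_fun_ltr.
by apply/measurable_EFinP; apply: measurable_funM.
Qed.

Lemma GammaE (z : R) : Gamma z = fine (\int[mu]_t gamma_kernel z t).
Proof.
rewrite /Gamma /Rintegral; congr fine; rewrite integral_mkcond.
apply: eq_integral => t _; rewrite patchE /gamma_kernel /Iv.
have [t0|t0] := boolP (0 < t)%R.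
  by rewrite mem_set ?mul1e//= in_itv/= t0.
by rewrite memNset ?mul0e//= in_itv/= andbT => h; rewrite h in t0.
Qed.

(** Tonelli in place of integration by parts: t^z is the integral of z s^(z-1) over 0 < s < t, and
    the remaining integral over t > s gives e^(-s). *)
Lemma GammaS (z : R) : (0 < z)%R -> Gamma (z + 1) = (z * Gamma z)%R.
Proof.
move=> z0; suff E : \int[mu]_t gamma_kernel (z + 1) t = z%:E * \int[mu]_t gamma_kernel z t.
  rewrite !GammaE E; have : 0 <= \int[mu]_t gamma_kernel z t.
    by apply: integral_ge0 => t _; exact: gamma_kernel_ge0.
  (* For an infinite integral [fine] makes both sides 0, so the extended identity implies the real
     one in every case. *)
  by case: (integral _ _ _) => [r| |] //= _; rewrite gt0_muley// ?lte_fin// mulr0.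
pose K (p : measurableTypeR R * measurableTypeR R) : \bar R :=
  Iv ((0 < p.1) && (p.1 < p.2))%R * (z * p.1 `^ (z - 1) * expR (- p.2))%:E.
have K0 p : 0 <= K p.
  by rewrite mule_ge0 ?Iv_ge0// lee_fin !mulr_ge0 ?powR_ge0 ?expR_ge0// ltW.
have mK : measurable_fun setT K.
  apply: emeasurable_funM.
    by apply: measurable_Iv; apply: measurable_and; apply: measurable_fun_ltr.
  apply/measurable_EFinP; apply: measurable_funM.
    apply: measurable_funM => //.
    exact: (measurableT_comp (measurable_powR1 (z - 1))).
  exact: (measurableT_comp measurable_expRN).
transitivity (\int[mu]_u \int[mu]_s K (s, u)).
  apply: eq_integral => u _; rewrite /gamma_kernel /K addrK /=.
  have [u0|u0] := ltP 0%R u; last first.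
    rewrite /Iv mul0e integral0_eq// => s _.
    have [s0|//] := ltP 0%R s; last by rewrite mul0e.
    by rewrite ltNge (le_trans u0 (ltW s0)) mul0e.
  rewrite /Iv mul1e mulrC EFinM -(integral_powR_itv0 z0 u0) integral_mkcond.
  rewrite -ge0_integralZT ?expR_ge0//.
  - apply: eq_integral => s _; rewrite patchE.
    have [s0u|s0u] := boolP ((0 < s) && (s < u))%R.
      by rewrite mem_set ?mul1e -?EFinM ?(mulrC (expR _))//= in_itv.
    by rewrite memNset ?mul0e ?mule0//= in_itv/= => h; rewrite h in s0u.
  - apply/(measurable_restrictT _ _).1 => //.
    by apply/measurable_EFinP; apply: measurable_funM => //; exact: measurable_funTS.
  - by move=> s; apply: erestrict_ge0 => x _; rewrite lee_fin mulr_ge0 ?powR_ge0// ltW.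
rewrite -(fubini_tonelli K)// -ge0_integralZT; last 3 first.
- exact: ltW.
- exact: measurable_gamma_kernel.
- exact: gamma_kernel_ge0.
apply: eq_integral => s _; rewrite /gamma_kernel /K /=.
have [s0|s0] := ltP 0%R s; last first.
  by rewrite /Iv mul0e mule0 integral0_eq// => u _; rewrite mul0e.
rewrite {2}/Iv mul1e -EFinM mulrA EFinM -integral_expRN_tail -ge0_integralZT.
- by apply: eq_integral => u _; rewrite EFinM muleCA.
- by rewrite mulr_ge0 ?powR_ge0// ltW.
- apply: emeasurable_funM; last exact/measurable_EFinP.
  by apply: measurable_Iv; exact: measurable_fun_ltr.
- by move=> u; rewrite mule_ge0 ?Iv_ge0// lee_fin expR_ge0.
Qed.

Lemma integral_gauss_rV n :
  \int[lam n]_v (expR (- dot v v))%:E = (Num.sqrt pi ^+ n)%:E.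
Proof.
have mg k : measurable_fun setT (fun v : 'rV[R]_k => (expR (- dot v v))%:E).
  apply/measurable_EFinP; apply: (measurableT_comp (@measurable_expR R)).
  apply: (measurableT_comp (@oppr_measurable R setT)).
  by apply: measurable_dot; exact: measurable_id.
have g0 k (v : 'rV[R]_k) : 0 <= (expR (- dot v v))%:E by rewrite lee_fin expR_ge0.
elim: n => [|n IH].
  by rewrite integral_lebesgue_rV0// /dot big_ord0 oppr0 expR0 expr0.
rewrite integral_lebesgue_rVS//.
transitivity (\int[mu]_x ((Num.sqrt pi ^+ n)%:E * (gauss_fun x)%:E)).
  apply: eq_integral => x _; rewrite muleC -IH -ge0_integralZT ?expR_ge0//; last exact: mg.
  apply: eq_integral => v _.
  by rewrite dot_rV_cons opprD expRD EFinM -expr2.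
rewrite ge0_integralZT.
- by rewrite integralT_gauss -EFinM exprSr.
- by rewrite exprn_ge0// sqrtr_ge0.
- by apply/measurable_EFinP; exact: measurable_gauss_fun.
- by move=> x; rewrite lee_fin gauss_fun_ge0.
Qed.

(* Layer cake: e^(-|v|^2) is the integral of e^(-u) over u > |v|^2, and the
   ball |v|^2 < u has volume u^(n/2) kappa_n. *)
Lemma Gamma_ball_vol n :
  Gamma (n%:R / 2 + 1) = (Num.sqrt pi ^+ n / ball_vol n)%R :> R.
Proof.
suff : (ball_vol n)%:E * \int[mu]_t gamma_kernel (n%:R / 2 + 1)%R t =
    (Num.sqrt pi ^+ n)%:E.
  move=> /(congr1 (fun x => (ball_vol n)^-1%:E * x)).
  rewrite muleA -EFinM mulVf ?mul1e; last by rewrite gt_eqF// ball_vol_gt0.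
  by rewrite GammaE => ->; rewrite -EFinM mulrC.
rewrite -integral_gauss_rV -ge0_integralZT; last 3 first.
- exact/ltW/ball_vol_gt0.
- exact: measurable_gamma_kernel.
- exact: gamma_kernel_ge0.
pose K (p : 'rV[R]_n * measurableTypeR R) : \bar R :=
  Iv (dot p.1 p.1 < p.2)%R * (expR (- p.2))%:E.
have K0 p : 0 <= K p by rewrite mule_ge0 ?Iv_ge0// lee_fin expR_ge0.
have mK : measurable_fun setT K.
  apply: emeasurable_funM.
    apply: measurable_Iv; apply: measurable_fun_ltr => //.
    by apply: measurable_dot; exact: measurable_fst.
  by apply/measurable_EFinP; exact: (measurableT_comp measurable_expRN).
transitivity (\int[lam n]_v \int[mu]_u K (v, u)); last first.
  by apply: eq_integral => v _; rewrite -integral_expRN_tail.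
rewrite (fubini_tonelli K)//; apply: eq_integral => u _.
rewrite /K /gamma_kernel /= addrK.
have [u0|u0] := ltP 0%R u; last first.
  rewrite /Iv mul0e mule0 integral0_eq// => v _.
  by rewrite ltNge (le_trans u0 (dot_ge0 _)) mul0e.
have s0 : (0 < Num.sqrt u)%R by rewrite sqrtr_gt0.
have mI : measurable_fun setT (fun v : 'rV[R]_n => Iv (dot v v < u)%R : \bar R).
  apply: measurable_Iv; apply: measurable_fun_ltr => //.
  by apply: measurable_dot; exact: measurable_id.
under eq_integral do rewrite muleC.
rewrite ge0_integralZT ?expR_ge0//; last by move=> v; exact: Iv_ge0.
rewrite -(@integral_scale _ _ (Num.sqrt u)) ?gt_eqF//; last by move=> v; exact: Iv_ge0.
have -> : \int[lam n]_v Iv (dot (Num.sqrt u *: v) (Num.sqrt u *: v) < u)%R =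
    (ball_vol n)%:E.
  rewrite -integral_inball; apply: eq_integral => v _; congr (Iv _).
  rewrite /inball dotZl dotZr mulrA -expr2 sqr_sqrtr ?(ltW u0)//.
  by rewrite -[X in (_ < X)%R = _](mulr1 u) ltr_pM2l.
rewrite gtr0_norm// mul1e -!EFinM; congr EFin.
rewrite mulrC (mulrC n%:R) powRrM powR12_sqrt ?(ltW u0)// powR_mulrn ?(ltW s0)//.
by rewrite mulrCA !mulrA.
Qed.

End gamma_function.

(** * Ball volumes and slice integrals in terms of Gamma *)

Section half_integer_gamma.
Context {R : realType}.
Local Notation rpi := (Num.sqrt (pi : R)).

Let rpi_gt0 : 0 < rpi.
Proof. by rewrite sqrtr_gt0 pi_gt0. Qed.

Let rpi2 : rpi ^+ 2 = pi.
Proof. by rewrite sqr_sqrtr// pi_ge0. Qed.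

Let kappa_neq0 n : ball_vol n != 0 :> R.
Proof. by rewrite gt_eqF// ball_vol_gt0. Qed.

Lemma Gamma_half_gt0 n : 0 < Gamma (n.+1%:R / 2) :> R.
Proof.
suff : 0 < n.+1%:R / 2 * Gamma (n.+1%:R / 2) :> R.
  by rewrite pmulr_rgt0// divr_gt0.
rewrite -GammaS; last by rewrite divr_gt0.
by rewrite Gamma_ball_vol divr_gt0 ?exprn_gt0// ball_vol_gt0.
Qed.

Lemma Gamma1 : Gamma 1 = 1 :> R.
Proof.
have := @Gamma_ball_vol R 0.
by rewrite mul0r add0r expr0 ball_vol0 divr1.
Qed.

(** The ball of R^1 has length 2; inserted in [Gamma_ball_vol], this gives the value at 3/2. *)
Lemma Gamma_half1 : Gamma 2^-1 = rpi.
Proof.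
have := @Gamma_ball_vol R 1; rewrite mul1r GammaS ?invr_gt0//.
have -> : ball_vol 1 = 2 :> R.
  rewrite ball_volS ball_vol0 mul1r /slice_int.
  transitivity (fine (\int[@lebesgue_measure R]_s (`|s| ^+ 0 * (s ^+ 2 < 1)%R%:R)%R%:E)%E).
    by congr fine; apply: eq_integral => s _; rewrite /slice_wt !expr0 mulr1 mul1r.
  by rewrite (integral_normX 0) /= divr1.
by move=> h; apply: (mulfI (x := 2^-1)); rewrite ?h ?invr_eq0 ?pnatr_eq0// expr1 mulrC.
Qed.

Lemma Gamma_nat n : Gamma n.+1%:R = n`!%:R :> R.
Proof.
elim: n => [|n IH]; first by rewrite Gamma1.
by rewrite -natr1 GammaS// IH factS natrM.
Qed.

(** From n to n + 1 the second Gamma factor becomes the first, and the first is raised by the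
    functional equation, which yields the factor (n + 1) / 2. *)
Lemma Gamma_duplication n :
  n`!%:R * rpi = 2 ^+ n * Gamma (n.+1%:R / 2) * Gamma (n%:R / 2 + 1).
Proof.
elim: n => [|n IH].
  by rewrite fact0 expr0 !mul1r mul0r add0r Gamma1 Gamma_half1 mulr1.
rewrite factS natrM -mulrA IH [in RHS](GammaS (z := n.+1%:R / 2)); last by rewrite divr_gt0.
have -> : n.+2%:R / 2 = n%:R / 2 + 1 :> R by rewrite -addn2 natrD; field.
by rewrite exprS; field.
Qed.

Lemma slice_intG n :
  slice_int n = rpi * Gamma (n%:R / 2 + 1) / Gamma (n.+1%:R / 2 + 1).
Proof.
rewrite !Gamma_ball_vol exprS ball_volS.
have := kappa_neq0 n; have := kappa_neq0 n.+1; rewrite ball_volS.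
have := lt0r_neq0 rpi_gt0; move: (ball_vol n) (slice_int n) rpi => a b p p0 ab a0.
have b0 : b != 0 by move: ab; rewrite mulf_eq0 negb_or => /andP[].
have pn := expf_neq0 n p0.
by field; rewrite a0 b0 p0 pn.
Qed.

(** The origin of the central binomial coefficients: by duplication each is a slice integral up to
    powers of 2 and pi. *)
Lemma binom_halfE n : binom_half n.+1%:R = 2 ^+ n.+1 * slice_int n / pi :> R.
Proof.
have G0 := Gamma_half_gt0 n.+1.
have E : Gamma (n%:R / 2 + 1) = Gamma (n.+2%:R / 2) :> R.
  by congr Gamma; rewrite -addn2 natrD; field.
rewrite /binom_half natr1 Gamma_nat slice_intG E -[X in _ = _ / X]rpi2.
have := Gamma_duplication n.+1.
have : 0 < Gamma (n.+1%:R / 2 + 1) :> R.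
  by rewrite GammaS ?mulr_gt0 ?divr_gt0 ?Gamma_half_gt0.
move: (Gamma _) (Gamma _) G0 => a b; move: n.+1`!%:R rpi rpi_gt0 => f p p0 b0 a0 fE.
have -> : f = 2 ^+ n.+1 * b * a / p by rewrite -fE mulfK ?gt_eqF.
by field; rewrite !gt_eqF.
Qed.

(** Duplication once more; it removes the ball volumes that [sylvester_val] still contains. *)
Lemma ball_vol_mul_consecutive n :
  n.+1`!%:R * ball_vol n * ball_vol n.+1 = 2 ^+ n.+1 * pi ^+ n :> R.
Proof.
have := Gamma_duplication n.+1.
have -> : n.+2%:R / 2 = n%:R / 2 + 1 :> R by rewrite -addn2 natrD; field.
rewrite !Gamma_ball_vol => h.
apply: (mulIf (lt0r_neq0 rpi_gt0)).
transitivity ((n.+1`!%:R * rpi) * (ball_vol n * ball_vol n.+1)); first by ring.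
rewrite h (_ : pi ^+ n = rpi ^+ n * rpi ^+ n) ?exprS; last by rewrite -exprMn -expr2 rpi2.
by field; rewrite !kappa_neq0.
Qed.

End half_integer_gamma.

(** * The two closed forms *)

Section closed_form.
Context {R : realType}.
Local Notation rpi := (Num.sqrt (pi : R)).

Let pi_neq0 : pi != 0 :> R.
Proof. by rewrite gt_eqF// pi_gt0. Qed.

Let slice_neq0 k : slice_int k != 0 :> R.
Proof. by rewrite gt_eqF// slice_int_gt0. Qed.

(** The common middle term, free of ball volumes, to which the expectation, the binomial form and
    the Gamma form are each reduced. *)
Definition angle_sum_val D : R :=
  D.+2%:R * slice_int D ^+ D.+1 / (slice_int (D * D.+2) * 2 ^+ D.+1 * pi ^+ D).

Lemma angle_sum_sylvester D : D.+2%:R * (sylvester_val D / 2) = angle_sum_val D.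
Proof.
have k0 : ball_vol D != 0 :> R by rewrite gt_eqF// ball_vol_gt0.
have f0 : D`!%:R != 0 :> R by rewrite pnatr_eq0 -lt0n fact_gt0.
have n0 : D.+1%:R != 0 :> R by rewrite pnatr_eq0.
have w0 := slice_neq0 D; have v0 := slice_neq0 (D * D.+2).
have := @ball_vol_mul_consecutive R D.
rewrite /sylvester_val /angle_sum_val -[_ * 2 ^+ _ * _]mulrA => <-.
rewrite factS natrM !ball_volS !exprMn !(exprS (ball_vol D)) exprVn !exprS.
have kD : ball_vol D ^+ D != 0 :> R by rewrite expf_neq0.
by field; rewrite k0 f0 nat1r n0 w0 v0 kD.
Qed.

Lemma angle_sum_binom_half D :
  2 ^- D.+1 * D.+2%:R * binom_half D.+1%:R ^+ D.+1 *
    (binom_half (D * D.+2).+1%:R)^-1 = angle_sum_val D.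
Proof.
(* Since (D + 1)^2 = D (D + 2) + 1, the binomial coefficient at (n - 1)^2 is the slice integral of
   Kingman's formula. *)
rewrite !binom_halfE /angle_sum_val (_ : (D * D.+2).+1 = D.+1 * D.+1)%N; last by lia.
rewrite exprM !exprMn exprVn (exprS pi D).
have w0 := slice_neq0 D; have v0 := slice_neq0 (D * D.+2).
have p0 := expf_neq0 D pi_neq0.
have t0 : 2 ^+ D.+1 != 0 :> R by rewrite expf_neq0// pnatr_eq0.
have t1 : (2 ^+ D.+1) ^+ D.+1 != 0 :> R by rewrite expf_neq0.
have pi0 := pi_neq0.
move: (2 ^+ D.+1) ((2 ^+ D.+1) ^+ D.+1) (pi : R) t0 t1 pi0 p0 => a b p a0 b0 pi0 p0.
by field; rewrite a0 b0 p0 v0 pi0.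
Qed.

Lemma angle_sum_Gamma D (m : R) : m = D.+1%:R ->
  angle_sum_val D = D.+2%:R * m ^+ 2 / (2 ^+ D.+2 * pi `^ (D%:R / 2)) *
    (Gamma (D.+2%:R / 2) / Gamma (D.+3%:R / 2)) ^+ D.+1 *
    (Gamma (m ^+ 2 / 2) / Gamma ((m ^+ 2 + 1) / 2)).
Proof.
have G2 n : Gamma (n%:R / 2 + 1) = Gamma (n.+2%:R / 2) :> R.
  by congr Gamma; rewrite -addn2 natrD; field.
have E : ((D * D.+2).+1%:R : R) = D.+1%:R ^+ 2.
  by rewrite -natrX; congr (_%:R); lia.
move=> ->; rewrite -E natr1 /angle_sum_val !slice_intG !G2.
(* The functional equation at m^2 / 2 produces one factor m^2 and raises the power of 2 from n - 1
   to n. *)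
rewrite -(G2 (D * D.+2).+1) GammaS ?divr_gt0//.
have /lt0r_neq0 g1 := @Gamma_half_gt0 R D.+1.
have /lt0r_neq0 g2 := @Gamma_half_gt0 R D.+2.
have /lt0r_neq0 g3 := @Gamma_half_gt0 R (D * D.+2).
have /lt0r_neq0 g4 := @Gamma_half_gt0 R (D * D.+2).+1.
have p0 : rpi != 0 by rewrite gt_eqF// sqrtr_gt0 pi_gt0.
have -> : pi `^ (D%:R / 2) = rpi ^+ D.
  by rewrite mulrC powRrM powR12_sqrt ?pi_ge0// powR_mulrn// sqrtr_ge0.
have -> : pi ^+ D = rpi ^+ D * rpi ^+ D by rewrite -exprMn -expr2 sqr_sqrtr// pi_ge0.
rewrite !exprMn !exprVn (exprS 2 D.+1) (exprS rpi D).
have := expf_neq0 D p0; have := expf_neq0 D.+1 g2.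
have t0 : 2 ^+ D.+1 != 0 :> R by rewrite expf_neq0// pnatr_eq0.
have q0 : (D * D.+2).+1%:R != 0 :> R by rewrite pnatr_eq0.
move: (2 ^+ D.+1) (Gamma (D.+3%:R / 2) ^+ D.+1) (rpi ^+ D) t0 => a b c a0 b0 c0.
move: ((D * D.+2).+1%:R : R) q0 g3 => q q0 g3.
by field; rewrite a0 b0 c0 p0 g3 g4 q0.
Qed.

End closed_form.

Theorem theorem3p9 (R : realType) (n : nat) :
  (2 <= n)%N ->
  let m : R := n%:R - 1 in
  let J : R :=
    2 ^ (1 - n%:Z) * n%:R * binom_half m ^+ n.-1 * (binom_half (m ^+ 2))^-1 in
  (forall (d : measure_display) (Omega : measurableType d)
      (P : probability Omega R) (X : 'I_n -> {RV P >-> 'rV[R]_n.-1}),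
    mutually_independent X ->
    (forall i, has_density_proportional_to (X i) (@beta_weight R (- 2^-1) n.-1)) ->
    'E_P[fun w => vertex_angle_sum (fun i => X i w)]%E = J%:E) /\
  J = n%:R * m ^+ 2 / (2 ^+ n * pi `^ ((n%:R - 2) / 2)) *
      (Gamma (n%:R / 2) / Gamma ((n%:R + 1) / 2)) ^+ n.-1 *
      (Gamma (m ^+ 2 / 2) / Gamma ((m ^+ 2 + 1) / 2)).
Proof.
(* With n = D + 2 the simplex lives in R^(D+1), m = D + 1 and m^2 = D (D + 2) + 1. *)
case: n => [|[|D]]// _ m J.
have mE : m = D.+1%:R by rewrite /m -natr1 addrK.
have m2E : m ^+ 2 = (D * D.+2).+1%:R by rewrite mE -natrX; congr (_%:R); lia.
have JE : J = angle_sum_val D.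
  rewrite /J m2E mE -angle_sum_binom_half; congr (_ * _ * _ * _).
  by rewrite (_ : 1 - D.+2%:Z = - D.+1%:Z)//; lia.
split.
  by move=> d Omega P X iX dX; rewrite expected_vertex_angle_sum// angle_sum_sylvester JE.
rewrite JE (angle_sum_Gamma mE) natr1.
by have -> : D.+2%:R - 2 = D%:R :> R by rewrite -addn2 natrD addrK.
Qed.
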